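(* There is a uniform algebra $A$ on a compact, metrizable topological space $X$ with $X=\Phi_A$ such that every point of $X$ is a peak point for $A$ and such that $A$ is not regular.
   Context: A uniform algebra on a compact Hausdorff space $X$ is a uniformly closed subalgebra of $C(X)$ (continuous complex-valued functions) that contains the constants and separates the points of $X$. $\Phi_A$ denotes the character space of $A$ (with the Gelfand topology); $X=\Phi_A$ means that every character of $A$ is evaluation at a point of $X$. A point $x\in X$ is a peak point for $A$ if there is $f\in A$ with $f(x)=1$ and $|f(y)|<1$ for all $y\in X\setminus\{x\}$. When $X=\Phi_A$, $A$ is regular if for each closed subset $E$ of $X$ and each $x\in X\setminus E$ there is $f\in A$ with $f(x)=1$ and $f$ identically $0$ on $E$. *)

(* Defs.v *)
From HB Require Import structures.
From mathcomp Require Import all_boot all_order all_algebra.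
From mathcomp Require Import complex.
From mathcomp Require Import all_classical all_reals all_analysis.

Set Implicit Arguments.
Unset Strict Implicit.
Unset Printing Implicit Defensive.

Import Order.TTheory GRing.Theory Num.Theory.
Import numFieldNormedType.Exports.

Local Open Scope classical_set_scope.
Local Open Scope ring_scope.
Local Open Scope complex_scope.

(* The complex numbers over R. The regular-module alias ^o is what carries the
   topology and uniformity of the modulus. The order of R[i] is partial:
   `|z| < 1 holds exactly when the modulus of z is less than 1. *)
Notation Cplx R := (R[i]^o).

Record uniform_algebra (R : realType) (X : topologicalType)
    (A : set (X -> Cplx R)) : Prop := UniformAlgebra {
  ua_compact : compact [set: X] ;
  ua_hausdorff : hausdorff_space X ;
  ua_continuous : forall f, A f -> continuous f ;
  ua_cst : forall c : Cplx R, A (cst c) ;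
  ua_add : forall f g, A f -> A g -> A (f + g) ;
  ua_scale : forall (c : R[i]) f, A f -> A (c *: f) ;
  ua_mul : forall f g, A f -> A g -> A (f * g) ;
  ua_separates : forall x y : X, x <> y -> exists2 f, A f & f x <> f y ;
  ua_closed : closed (A : set {uniform X -> Cplx R}) }.

(* A character of A is given by a function phi on all of X -> Cplx R of which
   only the values on A matter: nothing is required of phi outside A. *)
Record character (R : realType) (X : topologicalType)
    (A : set (X -> Cplx R)) (phi : (X -> Cplx R) -> Cplx R) : Prop :=
  Character {
  char_add : forall f g, A f -> A g -> phi (f + g) = phi f + phi g ;
  char_scale : forall (c : R[i]) f, A f -> phi (c *: f) = c *: phi f ;
  char_mul : forall f g, A f -> A g -> phi (f * g) = phi f * phi g ;
  char_neq0 : exists2 f, A f & phi f <> 0 }.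

(* X = Phi_A. When A is a uniform algebra on X, evaluation is always a
   homeomorphism of X onto its image in Phi_A, so only surjectivity is asked. *)
Definition is_character_space (R : realType) (X : topologicalType)
    (A : set (X -> Cplx R)) : Prop :=
  forall phi, character A phi ->
    exists x : X, forall f, A f -> phi f = f x.

Definition peak_point (R : realType) (X : topologicalType)
    (A : set (X -> Cplx R)) (x : X) : Prop :=
  exists f, [/\ A f, f x = 1 & forall y, y <> x -> `|f y| < 1].

(* This is the notion of regularity appropriate when is_character_space A. *)
Definition regular_algebra (R : realType) (X : topologicalType)
    (A : set (X -> Cplx R)) : Prop :=
  forall (E : set X) (x : X), closed E -> ~ E x ->
    exists f, [/\ A f, f x = 1 & forall y, E y -> f y = 0].

(* Main.v *)
(* Let K be the disc |z| <= 2 with a sequence of disjoint open discs removed, and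
   let X be the set of the points (z, w) with z in K and |z|^2 + |w|^2 = 5.  Let A
   be the uniform closure on X of the algebra generated by z, w, 1 / w and the
   functions 1 / (z - c), where c runs over the centers of the removed discs.
   As X lies on a sphere centered at the origin, each point (a, b) of X is the
   peak point of (5 + a^* z + b^* w) / 10 (Basener's trick).

   The removed discs are tiny and surround the N-th roots of r^N that do not lie
   in an earlier disc, for radii r dense in (1/2, 2).  With u = (z / r)^N the
   functions u / (u - 1) and 1 / (u - 1) belong to A.  For l large and N = l n,
   the n-th roots of their moduli are almost bounded by 1, and tiny inside,
   respectively outside, the circle |z| = r up to a small margin.  Hence,
   for a character phi with a = phi(z), b = phi(w), a function that is less than 1
   in modulus over the circle |z| = |a| cannot take the value 1 at phi.  Applied
   to b / w and w / b, whose moduli only depend on |z|, this gives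
   |a|^2 + |b|^2 = 5, so phi is the evaluation at (a, b).

   The removed discs also accumulate at the unit circle, but there their radii
   decrease so fast that the functions on K have a quasi-analyticity property.
   Up to a tiny error coming from the discs of the later stages, such a function is
   a Cauchy integral over circles at positive distance from the unit circle, and
   so its value at x = (-3 + 4i) / 5 is determined by its values on an arc.
   This applies to the Fourier coefficients in w of the elements of A: if f in A
   vanishes where Re z >= 0, it vanishes at the points with z = x. *)
Require Import Defs.
From HB Require Import structures.
From mathcomp Require Import all_boot all_order all_algebra.
From mathcomp Require Import ring lra zify.
From mathcomp Require Import complex.
From mathcomp Require Import all_classical all_reals all_analysis.

Set Implicit Arguments.
Unset Strict Implicit.
Unset Printing Implicit Defensive.

Import Order.TTheory GRing.Theory Num.Theory.
Import numFieldNormedType.Exports.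
Import ComplexField.Normc.

Local Open Scope classical_set_scope.
Local Open Scope ring_scope.
Local Open Scope complex_scope.

(** Integrals are replaced by averages over [n]-th roots of unity, which are exact on Laurent
    polynomials of degree below [n]. The same device yields Cauchy's formula for partial fractions,
    the Fourier modes in [w] and the partial fractions of [1 / (u - 1)]. The discs have two
    conflicting tasks: the control of characters wants them on a dense set of circles, also near the
    unit circle, while quasi-analyticity wants them to be negligible there. The order of choices
    reconciles the two. Stage [k] first fixes a finite combination [c] of evaluations on an arc that
    imitates the evaluation at [x] on Cauchy integrals over the circles present so far. Its
    coefficients may be enormous, but all discs added from then on are chosen small relative to
    them. Small discs are cheap on the other side: their radius [kappa] is of order [1 / N^2], and
    the [n]-th root of a bound of order [N^2], with [N = l n], is close to 1. The vanishing on the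
    fiber over [x] is obtained from the mean square of [f] on a circle: pairing with a fixed
    approximant leaves finitely many modes to estimate. *)

(** * The modulus as a real number, and roots of unity *)

Section Modulus.
Variable R : realType.
Local Notation C := R[i].
Implicit Types (x y z : C) (a : R).

Lemma normrc z : `|z| = (normc z)%:C.
Proof. by []. Qed.

Lemma normc_ge0 z : 0 <= normc z.
Proof. by case: z => a b /=; exact: sqrtr_ge0. Qed.

Lemma normc_eq0 z : (normc z == 0) = (z == 0).
Proof.
apply/eqP/eqP => [/eq0_normc //|->]; exact: normc0.
Qed.

Lemma normc_gt0 z : (0 < normc z) = (z != 0).
Proof. by rewrite lt_def normc_ge0 andbT normc_eq0. Qed.

Lemma normcX z n : normc (z ^+ n) = normc z ^+ n.
Proof. by elim: n => [|n IH]; rewrite ?expr0 ?normc1 // !exprS normcM IH. Qed.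

Lemma normc_real a : normc a%:C = `|a|.
Proof. by rewrite /= expr0n addr0 sqrtr_sqr. Qed.

Lemma normc_nat n : normc (n%:R : C) = n%:R.
Proof. by rewrite -(rmorph_nat (real_complex R)) normc_real normr_nat. Qed.

Lemma normcBC x y : normc (x - y) = normc (y - x).
Proof. by rewrite -[LHS]normcN opprB. Qed.

Lemma normc_conj z : normc (conjc z) = normc z.
Proof. by case: z => a b /=; rewrite sqrrN. Qed.

Lemma le_normcB x y : normc (x - y) <= normc x + normc y.
Proof. by rewrite -(normcN y) le_normcD. Qed.

Lemma le_normc_dist x y : normc x - normc y <= normc (x - y).
Proof. by rewrite lerBlDr -{1}(subrK y x) le_normcD. Qed.

Lemma normc_div x y : normc (x / y) = normc x / normc y.
Proof. by rewrite normcM normcV. Qed.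

Lemma le_normc_sum (I : Type) (r : seq I) (P : pred I) (F : I -> C) :
  normc (\sum_(i <- r | P i) F i) <= \sum_(i <- r | P i) normc (F i).
Proof.
elim/big_rec2: _ => [|i y x _ h]; first by rewrite normc0.
by rewrite (le_trans (le_normcD _ _)) // lerD2l.
Qed.

Lemma sqr_normcE z : normc z ^+ 2 = complex.Re z ^+ 2 + complex.Im z ^+ 2.
Proof. by case: z => a b /=; rewrite sqr_sqrtr // addr_ge0 ?sqr_ge0. Qed.

Lemma mulc_conj z : z * conjc z = (normc z ^+ 2)%:C.
Proof.
rewrite sqr_normcE; case: z => a b; simpc.
by congr (_ +i* _); ring.
Qed.

Lemma conjc_unit_ratio z m n : normc z = 1 ->
  conjc (z ^+ m * z ^- n) = z ^- m * z ^+ n.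
Proof.
move=> z1; have z0 : z != 0 by rewrite -normc_gt0 z1.
have u1 : normc (z ^+ m * z ^- n) = 1.
  by rewrite normcM normcV !normcX z1 !expr1n invr1 mulr1.
have u0 : z ^+ m * z ^- n != 0 by rewrite mulf_neq0 ?invr_neq0 ?expf_neq0.
apply: (mulfI u0); rewrite mulc_conj u1 expr1n mulrACA divff ?expf_neq0 //.
by rewrite mulVf ?expf_neq0 // mulr1.
Qed.

Lemma le_Re_normc z : complex.Re z <= normc z.
Proof.
rewrite (le_trans (ler_norm _)) // -ler_sqr ?nnegrE ?normc_ge0 //.
by rewrite sqr_normcE real_normK ?num_real // lerDl sqr_ge0.
Qed.

Lemma sqr_normcD (x y : C) : normc (x + y) ^+ 2 =
  normc x ^+ 2 + normc y ^+ 2 + 2 * complex.Re (x * conjc y).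
Proof. by rewrite !sqr_normcE; case: x y => [a b] [c d] /=; ring. Qed.

(** As [C] is algebraically closed, [X^n - 1] splits; its roots are distinct by separability, and a
    finite group of roots of unity is cyclic. *)
Lemma exists_prim_root n : (0 < n)%N -> exists z : C, n.-primitive_root z.
Proof.
move=> n0; have [r Dp] := closed_field_poly_normal ('X^n - 1 : {poly C}).
have nX : ('X^n - 1 : {poly C}) \is monic by exact: monic_Xn_sub_1.
rewrite (monicP nX) scale1r in Dp.
have sr : size r = n.
  have := size_Xn_sub_1 C n0; rewrite Dp size_prod_XsubC => -[].
  by [].
have ur : uniq r.
  rewrite -separable.separable_prod_XsubC -Dp.
  by apply: cyclotomic.separable_Xn_sub_1; rewrite pnatr_eq0 -lt0n.
have all_r : all n.-unity_root r.
  apply/allP => z zr; rewrite unity_rootE -subr_eq0.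
  have -> : z ^+ n - 1 = ('X^n - 1 : {poly C}).[z].
    by rewrite !hornerE.
  by rewrite Dp -rootE root_prod_XsubC.
have := cyclic.has_prim_root n0 all_r ur; rewrite sr leqnn => /(_ isT).
by case/hasP => z _ zp; exists z.
Qed.

Lemma normc_prim_root n (w : C) k : n.-primitive_root w -> normc (w ^+ k) = 1.
Proof.
move=> pw; have n0 := prim_order_gt0 pw.
have : normc w ^+ n = 1 by rewrite -normcX (prim_expr_order pw) normc1.
move/eqP; rewrite pexpr_eq1 ?normc_ge0 // => /eqP nw.
by rewrite normcX nw expr1n.
Qed.

Lemma prim_root_neq0 n (w : C) k : n.-primitive_root w -> w ^+ k != 0.
Proof.
by move=> pw; rewrite -normc_eq0 (normc_prim_root k pw) oner_eq0.
Qed.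

(** A geometric sum. Averaged over all [n]-th roots [t] of unity it keeps only the term [k = 0],
    which gives the partial fractions of [1 / (y ^+ n - 1)]. *)
Lemma unity_root_kernel n (y t : C) : t ^+ n = 1 -> y != t -> t != 0 ->
  t / (y - t) * (y ^+ n - 1) = \sum_(k < n) y ^+ k * t ^- k.
Proof.
move=> tn yt t0; rewrite -[X in _ ^+ _ - X]tn subrXX mulrA mulfVK ?subr_eq0 //.
rewrite mulr_sumr (reindex_inj rev_ord_inj) /=.
apply: eq_bigr => k _; have kn := ltn_ord k.
have -> : (n.-1 - (n - k.+1) = k)%N by lia.
rewrite mulrCA -exprS; congr (_ * _).
apply: (@mulfI _ (t ^+ k)); first by rewrite expf_neq0.
rewrite divff ?expf_neq0 // -exprD -tn; congr (_ ^+ _); lia.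
Qed.

End Modulus.

(** * Averages over roots of unity *)

Section RootAverage.
Variable R : realType.
Local Notation C := R[i].

(** For a primitive root [w], a Riemann sum for the mean of [F] over the unit circle. *)
Definition root_avg (n : nat) (w : C) (F : C -> C) : C :=
  n%:R^-1 * \sum_(k < n) F (w ^+ k).

Variables (n : nat) (w : C).
Hypothesis pw : n.-primitive_root w.

Let n0 : (n%:R : C) != 0.
Proof. by rewrite pnatr_eq0 -lt0n (prim_order_gt0 pw). Qed.

Lemma root_avgX m : root_avg n w (fun t => t ^+ m) = (n %| m)%:R.
Proof.
rewrite /root_avg.
have -> : \sum_(k < n) (w ^+ k) ^+ m = \sum_(k < n) (w ^+ m) ^+ k.
  by apply: eq_bigr => k _; rewrite -!exprM mulnC.
have [nm|nm] := boolP (n %| m)%N.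
  have -> : w ^+ m = 1 by apply/eqP; rewrite -(prim_order_dvd pw).
  under eq_bigr do rewrite expr1n.
  by rewrite sumr_const card_ord mulVf.
have wm : w ^+ m - 1 != 0 by rewrite subr_eq0 -(prim_order_dvd pw).
apply/eqP; rewrite mulf_eq0 invr_eq0 (negbTE n0) /=.
rewrite -(mulrI_eq0 _ (mulfI wm)) -subrX1 -exprM mulnC exprM.
by rewrite (prim_expr_order pw) expr1n subrr.
Qed.

Lemma root_avgXV m : root_avg n w (fun t => t ^- m) = (n %| m)%:R.
Proof.
rewrite -root_avgX /root_avg; congr (_ * _).
have [->|m0] := posnP m; first by under eq_bigr do rewrite invr1.
have w0 : w != 0 by rewrite -(expr1 w) (prim_root_neq0 1 pw).
rewrite (reindex_inj rev_ord_inj) /=.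
have h (k : 'I_n) : (w ^+ (n - k.+1)) ^- m = (w ^+ k.+1) ^+ m.
  apply: (@mulfI _ ((w ^+ (n - k.+1)) ^+ m)).
    by rewrite !expf_neq0.
  rewrite divff ?expf_neq0 //.
  rewrite -exprMn -exprD subnK ?ltn_ord //.
  by rewrite (prim_expr_order pw) expr1n.
rewrite (eq_bigr _ (fun k _ => h k)).
(* Splitting off the first term on one side and the last on the other compares the sums over
   [0 .. n - 1] and [1 .. n], as [w ^+ n = 1]. *)
have := erefl (\sum_(k < n.+1) (w ^+ k) ^+ m).
rewrite {1}big_ord_recl big_ord_recr /= (prim_expr_order pw) expr0 addrC.
by move/addrI.
Qed.

Lemma root_avgD F G :
  root_avg n w (fun t => F t + G t) = root_avg n w F + root_avg n w G.
Proof. by rewrite /root_avg big_split mulrDr. Qed.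

Lemma root_avgB F G :
  root_avg n w (fun t => F t - G t) = root_avg n w F - root_avg n w G.
Proof. by rewrite /root_avg sumrB mulrBr. Qed.

Lemma root_avgZ c F : root_avg n w (fun t => c * F t) = c * root_avg n w F.
Proof. by rewrite /root_avg -mulr_sumr mulrCA. Qed.

Lemma root_avg_sum (I : Type) (r : seq I) (F : I -> C -> C) :
  root_avg n w (fun t => \sum_(i <- r) F i t) =
  \sum_(i <- r) root_avg n w (F i).
Proof.
elim: r => [|i r IH].
  by rewrite big_nil /root_avg big1 ?mulr0 // => k _; rewrite big_nil.
rewrite big_cons -IH -root_avgD /root_avg.
by congr (_ * _); apply: eq_bigr => k _; rewrite big_cons.
Qed.

Lemma eq_root_avg F G : (forall t, normc t = 1 -> F t = G t) ->
  root_avg n w F = root_avg n w G.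
Proof.
move=> FG; congr (_ * _); apply: eq_bigr => k _; apply: FG.
exact: normc_prim_root pw.
Qed.

Lemma le_normc_root_avg_roots F e : (forall k, normc (F (w ^+ k)) <= e) ->
  normc (root_avg n w F) <= e.
Proof.
move=> Fe; rewrite normcM normcV normc_nat ler_pdivrMl; last first.
  by rewrite ltr0n (prim_order_gt0 pw).
rewrite (le_trans (le_normc_sum _ _ _)) //.
rewrite mulr_natl -[n in e *+ n]card_ord -sumr_const.
by apply: ler_sum => k _; exact: Fe.
Qed.

Lemma le_normc_root_avg F e : (forall t, normc t = 1 -> normc (F t) <= e) ->
  normc (root_avg n w F) <= e.
Proof.
move=> Fe; apply: le_normc_root_avg_roots => k; apply: Fe.
exact: normc_prim_root pw.
Qed.

Lemma root_avg_cst c : root_avg n w (fun=> c) = c.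
Proof.
by rewrite /root_avg sumr_const card_ord -[c *+ n]mulr_natl mulKf.
Qed.

End RootAverage.

(** * Pushing poles along the unit circle *)

Section CircleChain.
Variable R : realType.
Local Notation C := R[i].
Implicit Types (z zeta : C) (c : seq (C * C)) (d e t : R).

(** Inverse stereographic projection from [-1]: the segment [[0, 1]] goes to the quarter circle from
    [1] to [i], and [2] to [(-3 + 4i) / 5]. *)
Definition circ_pt t : C := (1 +i* t) / (1 -i* t).

Lemma one_sub_it_neq0 t : (1 -i* t : C) != 0.
Proof. by rewrite eq_complex /= oner_eq0. Qed.

Lemma normc_circ_pt t : normc (circ_pt t) = 1.
Proof.
rewrite /circ_pt normc_div -[X in X / _]normc_conj divff //.
by rewrite normc_eq0 one_sub_it_neq0.
Qed.

Lemma circ_ptB t t' : circ_pt t - circ_pt t' =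
  (t - t')%:C * (0 +i* 2) / ((1 -i* t) * (1 -i* t')).
Proof.
rewrite /circ_pt -mulNr addf_div ?one_sub_it_neq0 //; congr (_ / _).
by simpc; congr (_ +i* _); ring.
Qed.

Lemma circ_pt_inj : injective circ_pt.
Proof.
move=> t t' /eqP; rewrite -subr_eq0 circ_ptB !mulf_eq0 invr_eq0 mulf_eq0.
rewrite !(negbTE (one_sub_it_neq0 _)) !orbF => /orP[|].
  by rewrite eq_complex /= subr_eq0 => /andP[/eqP].
by rewrite eq_complex /= pnatr_eq0 andbF.
Qed.

Lemma le_normc_circ_ptB t t' : normc (circ_pt t - circ_pt t') <= 2 * `|t - t'|.
Proof.
have ge1 s : 1 <= normc (1 -i* s : C).
  by rewrite /= -[leLHS]sqrtr1 ler_wsqrtr // expr1n lerDl sqr_ge0.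
rewrite circ_ptB normc_div !normcM normc_real ler_pdivrMr; last first.
  by rewrite mulr_gt0 // (lt_le_trans ltr01).
have -> : normc (0 +i* 2 : C) = 2.
  by rewrite /= expr0n add0r sqrtr_sqr ger0_norm.
rewrite mulrC ler_peMr ?mulr_ge0 //.
by rewrite -[leLHS]mulr1 ler_pM.
Qed.

(** A list of pairs (coefficient, point) stands for a finitely supported measure, or a combination
    of evaluations; this is its Cauchy transform. *)
Definition pole_sum c zeta : C := \sum_(p <- c) p.1 / (zeta - p.2).

Lemma pole_sum_cat c c' zeta :
  pole_sum (c ++ c') zeta = pole_sum c zeta + pole_sum c' zeta.
Proof. by rewrite /pole_sum big_cat. Qed.

Lemma pole_sum_cons p c zeta :
  pole_sum (p :: c) zeta = p.1 / (zeta - p.2) + pole_sum c zeta.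
Proof. by rewrite /pole_sum big_cons. Qed.

Definition pole_scale (a : C) c := [seq (a * p.1, p.2) | p <- c].

Lemma pole_sum_scale a c zeta :
  pole_sum (pole_scale a c) zeta = a * pole_sum c zeta.
Proof.
rewrite /pole_sum big_map mulr_sumr; apply: eq_bigr => p _.
by rewrite mulrA.
Qed.

Definition nodal (l : seq C) (y : C) : C := \prod_(a <- l) (y - a).

Lemma nodal_neq0 l y : (nodal l y != 0) = (y \notin l).
Proof.
rewrite prodf_seq_neq0; apply/allP/idP => [h|yl a al /=].
  by apply/negP => /h /=; rewrite subrr eqxx.
by rewrite subr_eq0; apply: contraNneq yl => ->.
Qed.

(** Lagrange interpolation of [1 / (zeta - z)] as a function of [z], with nodes [l]; the remainder
    is the ratio of the nodal polynomials over [zeta - z]. *)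
Lemma kernel_interpolation (l : seq C) : uniq l -> forall z,
  exists2 c, (forall p, p \in c -> p.2 \in l) &
  forall zeta, zeta \notin l -> zeta != z ->
    pole_sum c zeta = (1 - nodal l z / nodal l zeta) / (zeta - z).
Proof.
elim: l => [_ z|y l IH /= /andP[yl ul] z].
  exists [::] => // zeta _ _.
  by rewrite /pole_sum /nodal !big_nil divr1 subrr mul0r.
have [c1 c1l h1] := IH ul z; have [c2 c2l h2] := IH ul y.
(* Subtracting [a] times the remainder at [y] from the remainder at [z] leaves
   [1 / (zeta - z) - 1 / (zeta - y)] times [nodal l z / nodal l zeta], which supplies the factor
   [(z - y) / (zeta - y)] of the new node. *)
pose a := nodal l z / nodal l y.
exists (c1 ++ (a, y) :: pole_scale (- a) c2) => [p|zeta].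
  rewrite mem_cat in_cons => /or3P[/c1l pl|/eqP->|/mapP[q /c2l ql ->]].
  - by rewrite in_cons pl orbT.
  - by rewrite mem_head.
  - by rewrite in_cons ql orbT.
rewrite in_cons negb_or => /andP[zy zl] zz.
rewrite pole_sum_cat pole_sum_cons pole_sum_scale h1 // h2 //.
have nodalE u : nodal (y :: l) u = (u - y) * nodal l u by rewrite /nodal big_cons.
rewrite !nodalE.
have := zl; rewrite -nodal_neq0 => nz; have := yl; rewrite -nodal_neq0 => ny.
rewrite /a /=; field.
by rewrite nz ny !subr_eq0 zy zz.
Qed.

Lemma nodal_ratio_le (l : seq C) z zeta (b : R) d : 0 < d -> 0 <= b ->
  {in l, forall a, normc (z - a) <= b * d} ->
  {in l, forall a, d <= normc (zeta - a)} ->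
  normc (nodal l z / nodal l zeta) <= b ^+ size l.
Proof.
move=> d0 b0; elim: l => [|a l IH] hz hzeta.
  by rewrite /nodal !big_nil divr1 normc1 expr0.
rewrite /nodal !big_cons -/(nodal l z) -/(nodal l zeta) -mulf_div normcM exprS.
rewrite ler_pM ?normc_ge0 //; last first.
  by apply: IH => x xl; [apply: hz | apply: hzeta]; rewrite in_cons xl orbT.
have ha := hzeta a (mem_head _ _).
rewrite normc_div ler_pdivrMr ?(lt_le_trans d0) //.
by rewrite (le_trans (hz a (mem_head _ _))) // ler_wpM2l.
Qed.

Definition far_from_circle d zeta :=
  forall z, normc z = 1 -> d <= normc (zeta - z).

Definition in_arc z := exists2 t, 0 <= t <= 1 & z = circ_pt t.

(** Runge's pole pushing, with the error measured at the points at distance at least [d] from the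
    circle. Dually, for Cauchy integrals over such points the value at [circ_pt t] is determined by
    the values on the arc. *)
Definition reach d t := forall e, 0 < e -> exists2 c,
  (forall p, p \in c -> in_arc p.2) &
  forall zeta, far_from_circle d zeta ->
    normc ((zeta - circ_pt t)^-1 - pole_sum c zeta) <= e.

Lemma reach_arc d t : 0 <= t <= 1 -> reach d t.
Proof.
move=> t01 e e0; exists [:: (1, circ_pt t)] => [p|zeta _].
  by rewrite inE => /eqP->; exists t.
by rewrite /pole_sum big_seq1 mul1r subrr normc0 ltW.
Qed.

Lemma reach_combine d c : (forall p, p \in c -> exists2 t, reach d t & p.2 = circ_pt t) ->
  forall e, 0 < e -> exists2 c',
    (forall p, p \in c' -> in_arc p.2) &
    forall zeta, far_from_circle d zeta ->
      normc (pole_sum c zeta - pole_sum c' zeta) <= e.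
Proof.
elim: c => [_ e e0|[a u] c IH h e e0].
  by exists [::] => // zeta _; rewrite subrr normc0 ltW.
have e20 : 0 < e / 2 by rewrite divr_gt0.
have [|c1 c1in c1e] := IH _ _ e20.
  by move=> p pc; apply: h; rewrite in_cons pc orbT.
have [t rt /= ut] := h _ (mem_head _ _).
have na : 0 < normc a + 1 by rewrite ltr_wpDl ?normc_ge0.
have [|c2 c2in c2e] := rt (e / 2 / (normc a + 1)); first by rewrite divr_gt0.
exists (pole_scale a c2 ++ c1) => [p|zeta hz].
  by rewrite mem_cat => /orP[/mapP[q /c2in qin ->]|/c1in].
rewrite pole_sum_cons pole_sum_cat pole_sum_scale /= ut.
have -> : a / (zeta - circ_pt t) + pole_sum c zeta -
    (a * pole_sum c2 zeta + pole_sum c1 zeta) =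
  a * ((zeta - circ_pt t)^-1 - pole_sum c2 zeta) +
  (pole_sum c zeta - pole_sum c1 zeta) by ring.
rewrite (le_trans (le_normcD _ _)) // [leRHS](splitr e) lerD ?c1e //.
rewrite normcM; have := c2e _ hz; rewrite ler_pdivlMr // => h2.
rewrite (le_trans _ h2) // mulrC ler_wpM2l ?normc_ge0 //.
by rewrite lerDl.
Qed.

Lemma small_pow (b e : R) : 0 <= b < 1 -> 0 < e -> exists n, b ^+ n <= e.
Proof.
move=> /andP[b0 b1] e0.
have : (b ^+ n @[n --> \oo] --> 0) by apply: cvg_expr; rewrite ger0_norm.
move/cvgrPdist_le => /(_ _ e0) [n _ /(_ n (leqnn n))] /=.
by rewrite sub0r normrN ger0_norm ?exprn_ge0 // => h; exists n.
Qed.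

(** The nodes have parameters in [[s - d / 16, s]], so they are within [d / 8] of [t]. As [circ_pt]
    is 2-Lipschitz, their points are within [d / 4] of [circ_pt t], while [zeta] is at distance at
    least [d]: each node divides the interpolation error by [4]. *)
Lemma reach_step d s : 0 < d <= 1 -> 1 <= s ->
  (forall t, 0 <= t <= s -> reach d t) ->
  forall t, s <= t <= s + d / 16 -> reach d t.
Proof.
move=> /andP[d0 d1] s1 hs t /andP[st td] e e0.
have [||n hn] := @small_pow 4^-1 (e / 2 * d).
  by lra.
  by rewrite mulr_gt0 // divr_gt0.
pose node (i : nat) := s - d / 16 * (i%:R / n.+1%:R).
have node_in i : (i < n.+1)%N -> s - d / 16 <= node i <= s.
  move=> lin; have i1 : 0 <= (i%:R / n.+1%:R : R) <= 1.
    by rewrite divr_ge0 //= ler_pdivrMr ?mul1r ?ler_nat ?ltr0n // ltnW.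
  rewrite /node; move: i1 => /andP[i1 i2]; apply/andP; split.
    by rewrite lerD2l lerN2 ler_piMr // divr_ge0 // ltW.
  by rewrite gerDl oppr_le0 mulr_ge0 // divr_ge0 // ltW.
pose l : seq C := mkseq (fun i => circ_pt (node i)) n.+1.
have ul : uniq l.
  apply: mkseq_uniq => i j /circ_pt_inj.
  rewrite /node => /addrI /oppr_inj /mulfI h.
  have {h} /mulIf h : i%:R / n.+1%:R = j%:R / n.+1%:R :> R.
    by apply: h; rewrite mulf_neq0 ?invr_neq0 // gt_eqF.
  by apply/eqP; rewrite -(eqr_nat R) h // invr_neq0 // pnatr_eq0.
have lP (a : C) : a \in l -> exists2 i, (i < n.+1)%N & a = circ_pt (node i).
  by move=> /mapP[k]; rewrite mem_iota => /andP[_ lin] ->; exists k.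
have [c cl hc] := kernel_interpolation ul (circ_pt t).
have [||c' c'in c'e] := @reach_combine d c _ (e / 2).
- move=> p /cl /lP [i lin ->]; exists (node i) => //; apply: hs.
  by have /andP[h1 ->] := node_in _ lin; rewrite andbT (le_trans _ h1) //; lra.
- by rewrite divr_gt0.
exists c' => // zeta hz.
have hzt u : d <= normc (zeta - circ_pt u) by apply: hz; exact: normc_circ_pt.
have zneq u : zeta != circ_pt u.
  by rewrite -subr_eq0 -normc_eq0 gt_eqF // (lt_le_trans d0).
rewrite -[X in normc X](subrKA (pole_sum c zeta)) (le_trans (le_normcD _ _)) //.
rewrite [leRHS](splitr e) lerD ?c'e //.
rewrite hc //; last first.
  by apply/negP => /lP[i _ zi]; move: (zneq (node i)); rewrite zi eqxx.
rewrite mulrBl mul1r opprB addrC subrK normc_div.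
have hr : normc (nodal l (circ_pt t) / nodal l zeta) <= 4^-1 ^+ size l.
  apply: (@nodal_ratio_le _ _ _ _ d) => // a /lP[i lin ->]; last exact: hzt.
  rewrite (le_trans (le_normc_circ_ptB _ _)) //.
  have /andP[h1 h2] := node_in _ lin; rewrite ger0_norm; lra.
rewrite size_mkseq exprS in hr.
rewrite ler_pdivrMr ?(lt_le_trans d0) //.
have : e / 2 * d <= e / 2 * normc (zeta - circ_pt t).
  by rewrite ler_wpM2l // divr_ge0 // ltW.
apply: le_trans; apply: le_trans hr _; apply: le_trans hn.
by rewrite ler_piMl ?exprn_ge0 // invf_le1 ?ler1n.
Qed.

Lemma reach_all d t : 0 < d <= 1 -> 0 <= t -> reach d t.
Proof.
move=> d01 t0.
have h n : forall u, 0 <= u <= 1 + n%:R * (d / 16) -> reach d u.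
  elim: n => [|n IH] u /andP[u0 un].
    by apply: reach_arc; rewrite u0; move: un; rewrite mul0r addr0.
  have [un'|un'] := leP u (1 + n%:R * (d / 16)); first by apply: IH; rewrite u0.
  apply: (reach_step d01 _ IH); first by rewrite lerDl mulr_ge0 // divr_ge0 //; lra.
  by rewrite (ltW un') -addrA -{2}[d / 16]mul1r -mulrDl natr1.
have d160 : 0 < d / 16 by case/andP: d01 => *; rewrite divr_gt0.
have /archi_boundP hb : 0 <= t / (d / 16) by rewrite divr_ge0 // ltW.
apply: (h (Num.bound (t / (d / 16)))); rewrite t0 /=.
move: hb; rewrite ltr_pdivrMr // => hb; lra.
Qed.

End CircleChain.

(** * Means over the unit circle as limits of averages *)

Section DiscreteCauchy.
Variable R : realType.
Local Notation C := R[i].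
Implicit Types (F G : C -> C) (l z y t : C) (e : R) (s : seq (C * R)).

(** Plays the role of the integral of [F] against [dt / (2 pi i t)] over the unit circle. *)
Definition avg_lim F l := forall e, 0 < e -> exists n0, forall n, (n0 <= n)%N ->
  forall w : C, n.-primitive_root w -> normc (root_avg n w F - l) <= e.

Lemma eq_avg_lim F G l : (forall t, normc t = 1 -> F t = G t) ->
  avg_lim G l -> avg_lim F l.
Proof.
move=> FG h e /h[n0 hn]; exists n0 => n n0n w pw.
by rewrite (eq_root_avg pw FG) hn.
Qed.

Lemma avg_limD F G l l' : avg_lim F l -> avg_lim G l' ->
  avg_lim (fun t => F t + G t) (l + l').
Proof.
move=> hF hG e e0; have e20 : 0 < e / 2 by rewrite divr_gt0.
have [n1 h1] := hF _ e20; have [n2 h2] := hG _ e20.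
exists (maxn n1 n2) => n; rewrite geq_max => /andP[n1n n2n] w pw.
rewrite root_avgD opprD addrACA (le_trans (le_normcD _ _)) //.
by rewrite [leRHS](splitr e) lerD ?h1 ?h2.
Qed.

Lemma avg_limZ a F l : avg_lim F l -> avg_lim (fun t => a * F t) (a * l).
Proof.
move=> hF e e0; have na : 0 < normc a + 1 by rewrite ltr_wpDl ?normc_ge0.
have [|n0 h] := hF (e / (normc a + 1)); first by rewrite divr_gt0.
exists n0 => n n0n w pw; rewrite root_avgZ -mulrBr normcM.
have := h n n0n w pw; rewrite ler_pdivlMr // => h'.
by rewrite (le_trans _ h') // mulrC ler_wpM2l ?normc_ge0 // lerDl.
Qed.

Lemma avg_lim1 a : avg_lim (fun=> a) a.
Proof.
move=> e e0; exists 1%N => n n1 w pw.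
by rewrite (root_avg_cst pw) subrr normc0 ltW.
Qed.

(* Boundary values of the disc algebra. *)
Definition poly_approx F := forall e, 0 < e ->
  exists p : {poly C}, forall t, normc t = 1 -> normc (F t - p.[t]) <= e.

Lemma poly_bounded (p : {poly C}) :
  exists2 B, 0 < B & forall t, normc t = 1 -> normc p.[t] <= B.
Proof.
exists (1 + \sum_(k < size p) normc p`_k).
  by rewrite ltr_wpDr // sumr_ge0 // => k _; rewrite normc_ge0.
move=> t t1; rewrite horner_coef (le_trans (le_normc_sum _ _ _)) //.
rewrite ler_wpDl // ler_sum // => k _.
by rewrite normcM normcX t1 expr1n mulr1.
Qed.

Lemma poly_approx_bounded F : poly_approx F ->
  exists2 B, 0 < B & forall t, normc t = 1 -> normc (F t) <= B.
Proof.
move=> /(_ _ ltr01)[p hp]; have [B B0 hB] := poly_bounded p.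
exists (1 + B) => [|t t1]; first by rewrite addr_gt0.
rewrite -[F t](subrK p.[t]) (le_trans (le_normcD _ _)) //.
by rewrite lerD ?hp ?hB.
Qed.

Lemma poly_approxM F G : poly_approx F -> poly_approx G ->
  poly_approx (fun t => F t * G t).
Proof.
move=> hF hG e e0; have [B B0 hB] := poly_approx_bounded hG.
have [|p hp] := hF (e / 2 / B); first by rewrite !divr_gt0.
have [B' B'0 hB'] := poly_bounded p.
have [|q hq] := hG (e / 2 / B'); first by rewrite !divr_gt0.
exists (p * q) => t t1; rewrite hornerM.
have -> : F t * G t - p.[t] * q.[t] =
  (F t - p.[t]) * G t + p.[t] * (G t - q.[t]) by ring.
rewrite (le_trans (le_normcD _ _)) // !normcM [leRHS](splitr e) lerD //.
  rewrite -[leRHS](mulfVK (lt0r_neq0 B0)).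
  by rewrite ler_pM ?normc_ge0 ?hp ?hB.
rewrite -[leRHS](mulfVK (lt0r_neq0 B'0)) mulrC.
by rewrite ler_pM ?normc_ge0 ?hq ?hB'.
Qed.

Lemma poly_approx_cst a : poly_approx (fun=> a).
Proof.
by move=> e e0; exists a%:P => t _; rewrite hornerC subrr normc0 ltW.
Qed.

Lemma poly_approxE F n : poly_approx F -> poly_approx (fun t => F t ^+ n).
Proof.
move=> hF; elim: n => [|n IH].
  by move=> e /(poly_approx_cst 1)[p hp]; exists p.
by move=> e /(poly_approxM hF IH)[p hp]; exists p => t /hp; rewrite exprS.
Qed.

Lemma eq_poly_approx F G : (forall t, normc t = 1 -> F t = G t) ->
  poly_approx G -> poly_approx F.
Proof. by move=> FG h e /h[p hp]; exists p => t t1; rewrite FG ?hp. Qed.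

Lemma poly_approx_geometric q : normc q < 1 ->
  poly_approx (fun t => (1 - q * t)^-1).
Proof.
move=> q1 e e0; have q10 : 0 < 1 - normc q by rewrite subr_gt0.
have [||n hn] := @small_pow R (normc q) (e * (1 - normc q)).
- by rewrite normc_ge0.
- by rewrite mulr_gt0.
exists (\poly_(k < n) q ^+ k) => t t1.
have qt1 : 1 - normc q <= normc (1 - q * t).
  by have := le_normc_dist 1 (q * t); rewrite normcM t1 mulr1 normc1.
have nz : 1 - q * t != 0 by rewrite -normc_gt0 (lt_le_trans q10).
have -> : (\poly_(k < n) q ^+ k).[t] = (1 - (q * t) ^+ n) / (1 - q * t).
  apply: (mulfI nz); rewrite [RHS]mulrC mulfVK // horner_poly.
  rewrite -{2}(expr1n _ n) subrXX; case: n {hn} => [|n].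
    by rewrite !big_ord0 !mulr0.
  congr (_ * _); apply: eq_bigr => k _.
  by rewrite expr1n mul1r exprMn.
rewrite -[X in X - _]mul1r -mulrBl opprB addrC subrK normc_div.
rewrite ler_pdivrMr ?normc_gt0 // normcX normcM t1 mulr1.
by rewrite (le_trans hn) // ler_wpM2l // ltW.
Qed.

Lemma poly_approx_kernel y n : 1 < normc y ->
  poly_approx (fun t => (t - y) ^- n).
Proof.
move=> y1; have y0 : y != 0 by rewrite -normc_gt0 (lt_trans ltr01).
have h : poly_approx (fun t => (t - y)^-1).
  apply: (@eq_poly_approx _ (fun t => - y^-1 * (1 - y^-1 * t)^-1)) => [t t1|].
    have -> : t - y = - y * (1 - y^-1 * t) by field.
    by rewrite invfM invrN.
  apply: poly_approxM; first exact: poly_approx_cst.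
  apply: poly_approx_geometric; rewrite normcV invf_lt1 //.
  exact: lt_trans y1.
by apply: eq_poly_approx (poly_approxE n h) => t _; rewrite exprVn.
Qed.

(** The mean value property at a zero. For [n >= size p + m] the exponents in [t ^+ m * p.[t]] lie
    strictly between [0] and [n], so the average of each power is zero. *)
Lemma avg_lim0_approx F m : (0 < m)%N -> poly_approx F ->
  avg_lim (fun t => t ^+ m * F t) 0.
Proof.
move=> m0 hF e e0; have [p hp] := hF _ e0.
exists (size p + m)%N => n pn w pw.
have h0 : root_avg n w (fun t => t ^+ m * p.[t]) = 0.
  rewrite (@eq_root_avg _ _ _ pw _
    (fun t => \sum_(k <- iota 0 (size p)) p`_k * t ^+ (m + k))) => [|t _].
    rewrite root_avg_sum big_seq big1 // => k; rewrite mem_iota => kp.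
    by rewrite root_avgZ (root_avgX pw) gtnNdvd ?mulr0 //; lia.
  rewrite horner_coef mulr_sumr -(big_mkord xpredT (fun k => _ * (p`_k * t ^+ k))).
  rewrite /index_iota subn0; apply: eq_bigr => k _.
  by rewrite mulrCA exprD.
rewrite -h0 -root_avgB (le_normc_root_avg pw) // => t t1.
by rewrite -mulrBr normcM normcX t1 expr1n mul1r hp.
Qed.

Lemma avg_lim0_approxV F m : (0 < m)%N -> poly_approx F ->
  avg_lim (fun t => t ^- m * F t^-1) 0.
Proof.
move=> m0 hF e e0; have [p hp] := hF _ e0.
exists (size p + m)%N => n pn w pw.
have h0 : root_avg n w (fun t => t ^- m * p.[t^-1]) = 0.
  rewrite (@eq_root_avg _ _ _ pw _
    (fun t => \sum_(k <- iota 0 (size p)) p`_k * t ^- (m + k))) => [|t _].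
    rewrite root_avg_sum big_seq big1 // => k; rewrite mem_iota => kp.
    by rewrite root_avgZ (root_avgXV pw) gtnNdvd ?mulr0 //; lia.
  rewrite horner_coef mulr_sumr
    -(big_mkord xpredT (fun k => _ * (p`_k * t^-1 ^+ k))).
  rewrite /index_iota subn0; apply: eq_bigr => k _.
  by rewrite mulrCA exprD invfM exprVn.
rewrite -h0 -root_avgB (le_normc_root_avg pw) // => t t1.
rewrite -mulrBr normcM normcV normcX t1 expr1n invr1 mul1r hp //.
by rewrite normcV t1 invr1.
Qed.

(** Dividing [t ^+ n.+1] by [t - y] yields positive powers of [t], the constant [y ^+ n], and a
    remainder that is a series in [1 / t] without constant term. Only the constant survives the
    averaging. *)
Lemma avg_lim_in_pow y n : normc y < 1 ->
  avg_lim (fun t => t ^+ n.+1 / (t - y)) (y ^+ n).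
Proof.
move=> y1; have h t : normc t = 1 -> t ^+ n.+1 / (t - y) =
    (\sum_(k < n) t ^+ (n - k) * y ^+ k + y ^+ n) +
    y ^+ n.+1 * (t ^- 1 * (1 - y * t^-1)^-1).
  move=> t1; have t0 : t != 0 by rewrite -normc_gt0 t1.
  have ty : t - y != 0.
    by rewrite subr_eq0; apply: contraTneq y1 => <-; rewrite t1 ltxx.
  have -> : t ^- 1 * (1 - y * t^-1)^-1 = (t - y)^-1.
    by rewrite -invfM; congr (_^-1); field.
  apply: (mulIf ty); rewrite mulfVK // mulrDl mulfVK //.
  have -> : \sum_(k < n) t ^+ (n - k) * y ^+ k + y ^+ n =
      \sum_(k < n.+1) t ^+ (n.+1.-1 - k) * y ^+ k.
    by rewrite big_ord_recr /= subnn mul1r.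
  by rewrite mulrC -subrXX subrK.
apply: eq_avg_lim h _.
rewrite -[X in avg_lim _ X]addr0; apply: avg_limD; last first.
  rewrite -[0](mulr0 (y ^+ n.+1)); apply: avg_limZ.
  exact: (avg_lim0_approxV (m := 1) isT (poly_approx_geometric y1)).
rewrite -[X in avg_lim _ X]add0r; apply: avg_limD; last exact: avg_lim1.
apply: (@eq_avg_lim _ (fun t => \sum_(k <- iota 0 n) y ^+ k * t ^+ (n - k))).
  move=> t _; rewrite -(big_mkord xpredT (fun k => t ^+ (n - k) * y ^+ k)).
  by rewrite /index_iota subn0; apply: eq_bigr => k _; rewrite mulrC.
move=> e e0; exists n.+1 => m nm w pw; rewrite subr0 root_avg_sum big_seq.
rewrite big1 ?normc0 1?ltW // => k; rewrite mem_iota => kn.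
by rewrite root_avgZ (root_avgX pw) gtnNdvd ?mulr0 //; lia.
Qed.

(** The mirror image: negative powers of [t], the constant, and a power series in [t] without
    constant term. *)
Lemma avg_lim_out_pow y n : 1 < normc y ->
  avg_lim (fun t => t ^- n / (t - y)) (- y ^- n.+1).
Proof.
move=> y1; have y0 : y != 0 by rewrite -normc_gt0 (lt_trans ltr01).
have h t : normc t = 1 -> t ^- n / (t - y) =
    (\sum_(k < n) (- y ^- (n - k)) * t ^- k.+1 + - y ^- n.+1) +
    - y ^- n.+1 * (y^-1 * (t ^+ 1 * (1 - y^-1 * t)^-1)).
  move=> t1; have t0 : t != 0 by rewrite -normc_gt0 t1.
  have ty : t - y != 0.
    by rewrite subr_eq0; apply: contraTneq y1 => <-; rewrite t1 ltxx.
  have -> : y^-1 * (t ^+ 1 * (1 - y^-1 * t)^-1) = t / (y - t).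
    by field; rewrite -oppr_eq0 opprB ty y0.
  have -> : \sum_(k < n) (- y ^- (n - k)) * t ^- k.+1 =
      - (t ^- n * y ^- n) * \sum_(k < n) t ^+ (n.-1 - k) * y ^+ k.
    rewrite mulr_sumr; apply: eq_bigr => k _; have kn := ltn_ord k.
    rewrite !mulNr; congr (- _).
    move: (nat_of_ord k) kn => {}k kn.
    have [j nE] : exists j, n = (k.+1 + j)%N by exists (n - k.+1)%N; lia.
    have -> : (n.-1 - k = j)%N by lia.
    have -> : (n - k = j.+1)%N by lia.
    rewrite nE addSn -addnS !exprD !exprS.
    have tk : t ^+ k != 0 by rewrite expf_neq0.
    have tj : t ^+ j != 0 by rewrite expf_neq0.
    have yk : y ^+ k != 0 by rewrite expf_neq0.
    have yj : y ^+ j != 0 by rewrite expf_neq0.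
    by field; rewrite t0 y0 tk tj yk yj.
  have ty' : y - t != 0 by rewrite -oppr_eq0 opprB.
  apply: (mulIf ty); rewrite mulfVK // !mulrDl.
  rewrite -[X in X + _ + _]mulrA [X in _ * X + _ + _]mulrC -subrXX.
  have -> : (- y ^- n.+1) * (t / (y - t)) * (t - y) = t * y ^- n.+1.
    by rewrite -[t - y]opprB mulrN -mulrA mulfVK // mulNr opprK mulrC.
  rewrite exprS invfM; field.
  by rewrite y0 !expf_neq0.
apply: eq_avg_lim h _.
rewrite -[X in avg_lim _ X]addr0; apply: avg_limD; last first.
  rewrite -[0](mulr0 (- y ^- n.+1)); apply: avg_limZ.
  rewrite -[0](mulr0 y^-1); apply: avg_limZ.
  have y1' : normc y^-1 < 1 by rewrite normcV invf_lt1 // (lt_trans ltr01).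
  exact: (avg_lim0_approx (m := 1) isT (poly_approx_geometric y1')).
rewrite -[X in avg_lim _ X]add0r; apply: avg_limD; last exact: avg_lim1.
apply: (@eq_avg_lim _ (fun t => \sum_(k <- iota 0 n) (- y ^- (n - k)) * t ^- k.+1)).
  move=> t _; rewrite -(big_mkord xpredT (fun k => (- y ^- (n - k)) * t ^- k.+1)).
  by rewrite /index_iota subn0.
move=> e e0; exists n.+1 => m nm w pw; rewrite subr0 root_avg_sum big_seq.
rewrite big1 ?normc0 1?ltW // => k; rewrite mem_iota => kn.
by rewrite root_avgZ (root_avgXV pw) gtnNdvd ?mulr0 //; lia.
Qed.

End DiscreteCauchy.

(** * Cauchy's formula for elementary fractions on a disc with holes *)

Section CauchyFormula.
Variable R : realType.
Local Notation C := R[i].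
Implicit Types (F : C -> C) (z c : C) (h : C * R) (s : seq (C * R)).

Inductive elem_fraction := Monomial of nat | Pole of C & nat.

Definition elem_eval (b : elem_fraction) z : C :=
  match b with Monomial n => z ^+ n | Pole c n => (z - c) ^- n.+1 end.

Definition disjoint_holes s := [/\ uniq s,
  forall h, h \in s -> 0 < h.2 /\ normc h.1 + h.2 < 2 &
  forall h h', h \in s -> h' \in s -> h != h' ->
    h.2 + h'.2 < normc (h.1 - h'.1)].

Definition circle_pt h t : C := h.1 + h.2%:C * t.

(** [F(zeta) / (zeta - z) d zeta / (2 pi i)] on the boundary of [h], as a density with respect to
    [dt / (2 pi i t)]; hence the factor [h.2%:C * t]. *)
Definition circle_integrand h F z t : C :=
  F (circle_pt h t) * (h.2%:C * t / (circle_pt h t - z)).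

Lemma normc_circle_pt h t : 0 <= h.2 -> normc t = 1 ->
  normc (circle_pt h t - h.1) = h.2.
Proof.
by move=> h0 t1; rewrite /circle_pt addrC addKr normcM t1 normc_real mulr1 ger0_norm.
Qed.

Lemma circle_pt_kernelE h z t : 0 < h.2 ->
  h.2%:C * t / (circle_pt h t - z) = t / (t - (z - h.1) / h.2%:C).
Proof.
move=> h0; have hC : h.2%:C != 0 :> C by rewrite eq_complex /= eqxx andbT gt_eqF.
have -> : circle_pt h t - z = h.2%:C * (t - (z - h.1) / h.2%:C).
  by rewrite /circle_pt; field.
by rewrite invfM mulrACA divff // mul1r.
Qed.

Lemma normc_rescale z (r : R) : 0 < r -> normc (z / r%:C) = normc z / r.
Proof. by move=> r0; rewrite normc_div normc_real gtr0_norm. Qed.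

(** Both the fraction and the Cauchy kernel are holomorphic across the disc [h], so the integrand is
    [t] times a function of the disc algebra. *)
Lemma circle_integral_regular h (b : elem_fraction) z : 0 < h.2 ->
  h.2 < normc (z - h.1) ->
  (if b is Pole c _ then h.2 < normc (c - h.1) else true) ->
  avg_lim (circle_integrand h (elem_eval b) z) 0.
Proof.
move=> h0 hz hb.
have hC : h.2%:C != 0 :> C by rewrite eq_complex /= eqxx andbT gt_eqF.
have hF : poly_approx (fun t => elem_eval b (circle_pt h t)).
  case: b hb => [n _ |c n hc] /=.
    apply: poly_approxE => e e0; exists (h.1%:P + h.2%:C *: 'X) => t _.
    by rewrite !hornerE subrr normc0 ltW.
  apply: (@eq_poly_approx _ _
    (fun t => h.2%:C ^- n.+1 * (t - (c - h.1) / h.2%:C) ^- n.+1)) => [t _|].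
    rewrite -invfM -exprMn; congr (_ ^- _).
    by rewrite /circle_pt; field.
  apply: poly_approxM; first exact: poly_approx_cst.
  by apply: poly_approx_kernel; rewrite normc_rescale // ltr_pdivlMr // mul1r.
apply: (@eq_avg_lim _ _ (fun t => t ^+ 1 * (elem_eval b (circle_pt h t) *
  (t - (z - h.1) / h.2%:C) ^- 1))) => [t _|].
  by rewrite /circle_integrand circle_pt_kernelE // mulrCA.
apply: avg_lim0_approx => //; apply: poly_approxM => //.
by apply: poly_approx_kernel; rewrite normc_rescale // ltr_pdivlMr // mul1r.
Qed.

Lemma circle_integral_pole h n z : 0 < h.2 -> h.2 < normc (z - h.1) ->
  avg_lim (circle_integrand h (elem_eval (Pole h.1 n)) z)
    (- elem_eval (Pole h.1 n) z).
Proof.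
move=> h0 hz.
have hC : h.2%:C != 0 :> C by rewrite eq_complex /= eqxx andbT gt_eqF.
have zh : z - h.1 != 0 by rewrite -normc_gt0 (lt_trans h0).
have -> : - elem_eval (Pole h.1 n) z =
    h.2%:C ^- n.+1 * (- ((z - h.1) / h.2%:C) ^- n.+1).
  by rewrite mulrN -invfM -exprMn mulrC mulfVK.
apply: (@eq_avg_lim _ _ (fun t => h.2%:C ^- n.+1 *
    (t ^- n / (t - (z - h.1) / h.2%:C)))) => [t t1|].
  have t0 : t != 0 by rewrite -normc_gt0 t1.
  rewrite /circle_integrand circle_pt_kernelE //= /circle_pt addrC addKr.
  rewrite exprMn invfM [t ^+ n.+1]exprS invfM -!mulrA; congr (_ * _).
  by rewrite mulrCA mulKf.
apply: avg_limZ; apply: avg_lim_out_pow.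
by rewrite normc_rescale // ltr_pdivlMr // mul1r.
Qed.

Lemma outer_integral_monomial (r : R) n z : 0 < r -> normc z < r ->
  avg_lim (circle_integrand (0, r) (elem_eval (Monomial n)) z) (z ^+ n).
Proof.
move=> r0 zr; have rC : r%:C != 0 :> C by rewrite eq_complex /= eqxx andbT gt_eqF.
have -> : z ^+ n = r%:C ^+ n * (z / r%:C) ^+ n by rewrite -exprMn mulrC mulfVK.
apply: (@eq_avg_lim _ _ (fun t => r%:C ^+ n * (t ^+ n.+1 / (t - z / r%:C)))).
  move=> t _; rewrite /circle_integrand circle_pt_kernelE //= subr0.
  by rewrite /circle_pt /= add0r exprMn -!mulrA exprSr -!mulrA.
apply: avg_limZ; apply: avg_lim_in_pow.
by rewrite normc_rescale // ltr_pdivrMr // mul1r.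
Qed.

(** All poles lie inside the circle: in the variable [1 / t] the integrand belongs to the disc
    algebra and vanishes at [0]. *)
Lemma outer_integral_pole (r : R) c n z : 0 < r -> normc z < r -> normc c < r ->
  avg_lim (circle_integrand (0, r) (elem_eval (Pole c n)) z) 0.
Proof.
move=> r0 zr cr; have rC : r%:C != 0 :> C by rewrite eq_complex /= eqxx andbT gt_eqF.
have lt1 a : normc a < r -> normc (a / r%:C) < 1.
  by move=> ar; rewrite normc_rescale // ltr_pdivrMr // mul1r.
pose G t := r%:C ^- n.+1 * ((1 - c / r%:C * t)^-1 ^+ n.+1 * (1 - z / r%:C * t)^-1).
apply: (@eq_avg_lim _ _ (fun t => t ^- n.+1 * G t^-1)) => [t t1|].
  have t0 : t != 0 by rewrite -normc_gt0 t1.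
  rewrite /circle_integrand circle_pt_kernelE //= subr0 /circle_pt /= add0r.
  have -> : t / (t - z / r%:C) = (1 - z / r%:C * t^-1)^-1.
    by rewrite -[t in t / _]invrK -invfM; congr (_^-1); field; rewrite t0 rC.
  have -> : (r%:C * t - c) ^- n.+1 =
      t ^- n.+1 * r%:C ^- n.+1 * (1 - c / r%:C / t)^-1 ^+ n.+1.
    rewrite exprVn -!invfM -!exprMn; congr (_ ^- _).
    by field; rewrite t0 rC.
  by rewrite /G !mulrA.
apply: avg_lim0_approxV => //; apply: poly_approxM; first exact: poly_approx_cst.
by apply: poly_approxM; [apply: poly_approxE|]; apply/poly_approx_geometric/lt1.
Qed.

(** As poles occur only at centers of holes, each integral is explicit. The circles of the holes are
    oriented positively, so the integral over the outer circle is the value at [z] plus the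
    integrals over the holes. *)
Lemma cauchy_formula s b z : disjoint_holes s -> normc z < 2 ->
  (forall h, h \in s -> h.2 < normc (z - h.1)) ->
  (if b is Pole c _ then exists2 h, h \in s & c = h.1 else True) ->
  exists2 l, avg_lim (circle_integrand (0, 2) (elem_eval b) z)
      (elem_eval b z + \sum_(h <- s) l h) &
    forall h, h \in s -> avg_lim (circle_integrand h (elem_eval b) z) (l h).
Proof.
move=> [us sin sdis] z2 zs; have r2 : 0 < 2 :> R by [].
case: b => [n _|_ n [h0 h0s ->]].
  exists (fun=> 0) => [|h hs].
    by rewrite big1 // addr0; exact: outer_integral_monomial.
  by apply: circle_integral_regular => //; have [] := sin _ hs; rewrite ?zs.
have [h00 h02] := sin _ h0s.
(* The circle around the pole carries the whole value, and the outer circle nothing. *)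
exists (fun h => if h == h0 then - elem_eval (Pole h0.1 n) z else 0).
  rewrite (bigD1_seq h0) //= eqxx big1 ?addr0 => [|h /negbTE -> //].
  rewrite subrr; apply: outer_integral_pole => //.
  by apply: lt_trans h02; rewrite ltrDl.
move=> h hs; have [->|hh0] := eqVneq h h0.
  by apply: circle_integral_pole; rewrite ?zs.
apply: circle_integral_regular; rewrite ?zs //; have [] := sin _ hs => //.
move=> _ _; have := sdis _ _ h0s hs; rewrite eq_sym hh0 => /(_ isT).
by apply: lt_trans; rewrite ltrDr.
Qed.

End CauchyFormula.

(** * Bounds for combinations of point values *)

Section CauchyBound.
Variable R : realType.
Local Notation C := R[i].
Implicit Types (F : C -> C) (z : C) (h : C * R) (s : seq (C * R)).
Implicit Types (l : C * R -> C) (c : seq (C * C)).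

Lemma avg_lim_le F a (B : R) : (forall t, normc t = 1 -> normc (F t) <= B) ->
  avg_lim F a -> normc a <= B.
Proof.
move=> FB hF; apply/ler_addgt0Pl => e e0; have [n0 h] := hF _ e0.
(* [avg_lim] quantifies over primitive roots, so it is informative only because one exists for each
   order. *)
have [w pw] := @exists_prim_root R n0.+1 isT.
rewrite -(subrK (root_avg n0.+1 w F) a) (le_trans (le_normcD _ _)) // lerD //.
  by rewrite normcBC h.
exact: (le_normc_root_avg pw FB).
Qed.

Definition pole_in s (b : elem_fraction R) :=
  if b is Pole c _ then exists2 h, h \in s & c = h.1 else True.

Inductive fraction s : (C -> C) -> Prop :=
| fraction0 : fraction s (fun=> 0)
| fractionD a b F : pole_in s b -> fraction s F ->
    fraction s (fun z => a * elem_eval b z + F z).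

Definition off_holes s z := normc z < 2 /\ forall h, h \in s -> h.2 < normc (z - h.1).

Definition cauchy_values s F z l :=
  avg_lim (circle_integrand (0, 2) F z) (F z + \sum_(h <- s) l h) /\
  forall h, h \in s -> avg_lim (circle_integrand h F z) (l h).

Lemma fraction_cauchy s F z : disjoint_holes s -> off_holes s z ->
  fraction s F -> exists l, cauchy_values s F z l.
Proof.
move=> ds [z2 zs]; elim=> [|a b {}F pb _ [l [hl1 hl2]]].
  exists (fun=> 0); split=> [|h _]; rewrite ?big1 ?addr0 //;
    by apply: (@eq_avg_lim _ _ (fun=> 0)) (avg_lim1 0) => t _;
       rewrite /circle_integrand mul0r.
have [l' h1 h2] := cauchy_formula ds z2 zs pb.
have IE h t : circle_integrand h (fun z => a * elem_eval b z + F z) z t =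
    a * circle_integrand h (elem_eval b) z t + circle_integrand h F z t.
  by rewrite /circle_integrand mulrDl -!mulrA.
exists (fun h => a * l' h + l h); split=> [|h hs].
  have -> : a * elem_eval b z + F z + \sum_(h <- s) (a * l' h + l h) =
      a * (elem_eval b z + \sum_(h <- s) l' h) + (F z + \sum_(h <- s) l h).
    by rewrite big_split /= -mulr_sumr; ring.
  apply: (eq_avg_lim (fun t _ => IE _ t)); apply: avg_limD.
    exact: avg_limZ.
  by [].
apply: (eq_avg_lim (fun t _ => IE _ t)); apply: avg_limD; last exact: hl2.
by apply: avg_limZ; apply: h2.
Qed.

Lemma cauchy_combination s F c : disjoint_holes s -> fraction s F ->
  (forall p, p \in c -> off_holes s p.2) ->
  exists2 l,
    avg_lim (fun t => \sum_(p <- c) p.1 * circle_integrand (0, 2) F p.2 t)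
      (\sum_(p <- c) p.1 * F p.2 + \sum_(h <- s) l h) &
    forall h, h \in s ->
      avg_lim (fun t => \sum_(p <- c) p.1 * circle_integrand h F p.2 t) (l h).
Proof.
move=> ds hF; elim: c => [_|p c IH hc].
  exists (fun=> 0) => [|h _]; rewrite ?big_nil ?big1 ?addr0 //;
    by apply: (@eq_avg_lim _ _ (fun=> 0)) (avg_lim1 0) => t _; rewrite big_nil.
have [l' [h1 h2]] := fraction_cauchy ds (hc _ (mem_head _ _)) hF.
have [q qc|l hl1 hl2] := IH; first by apply: hc; rewrite in_cons qc orbT.
exists (fun h => p.1 * l' h + l h) => [|h hs].
  have -> : \sum_(q <- p :: c) q.1 * F q.2 + \sum_(h <- s) (p.1 * l' h + l h) =
      p.1 * (F p.2 + \sum_(h <- s) l' h) +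
      (\sum_(q <- c) q.1 * F q.2 + \sum_(h <- s) l h).
    by rewrite big_cons big_split /= -mulr_sumr; ring.
  apply: (eq_avg_lim (fun t _ => big_cons _ _ _ _ _ _)); apply: avg_limD.
    exact: avg_limZ.
  by [].
apply: (eq_avg_lim (fun t _ => big_cons _ _ _ _ _ _)); apply: avg_limD; last exact: hl2.
by apply: avg_limZ; apply: h2.
Qed.

Lemma circle_integrand_sum F h c t :
  \sum_(p <- c) p.1 * circle_integrand h F p.2 t =
  F (circle_pt h t) * (h.2%:C * t * pole_sum c (circle_pt h t)).
Proof.
rewrite /pole_sum !mulr_sumr; apply: eq_bigr => p _.
by rewrite /circle_integrand; ring.
Qed.

(** Exchanging the two sums turns the combination [c] of values into the integral of
    [F * pole_sum c] over the boundary circles. It is small when the Cauchy transform of [c] is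
    small there, each circle counting with its radius. *)
Lemma cauchy_bound s F c (M : R) (E : C * R -> R) :
  disjoint_holes s -> fraction s F -> (forall p, p \in c -> off_holes s p.2) ->
  (forall h, h \in (0, 2) :: s -> forall t, normc t = 1 ->
     normc (F (circle_pt h t)) <= M /\
     normc (pole_sum c (circle_pt h t)) <= E h) ->
  normc (\sum_(p <- c) p.1 * F p.2) <=
    M * (2 * E (0, 2) + \sum_(h <- s) h.2 * E h).
Proof.
move=> ds hF hc hb; have [l hl1 hl2] := cauchy_combination ds hF hc.
have bound h : 0 < h.2 -> h \in (0, 2) :: s -> forall t, normc t = 1 ->
    normc (\sum_(p <- c) p.1 * circle_integrand h F p.2 t) <= M * (h.2 * E h).
  move=> h0 hs t t1; have [hM hE] := hb h hs t t1.
  rewrite circle_integrand_sum !normcM t1 mulr1 normc_real gtr0_norm //.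
  by rewrite ler_pM ?mulr_ge0 ?normc_ge0 ?(ltW h0) // ler_wpM2l // ltW.
have [_ sin _] := ds.
rewrite -[X in normc X](addrK (\sum_(h <- s) l h)) (le_trans (le_normcB _ _)) //.
rewrite mulrDr lerD //.
  by apply: avg_lim_le hl1; apply: bound; rewrite ?mem_head.
rewrite (le_trans (le_normc_sum _ _ _)) // mulr_sumr big_seq [leRHS]big_seq.
apply: ler_sum => h hs; apply: avg_lim_le (hl2 _ hs); apply: bound.
  by have [] := sin _ hs.
by rewrite in_cons hs orbT.
Qed.

End CauchyBound.

(** * Elementary estimates for the placement of holes *)

Section Holes.
Variable R : realType.
Local Notation C := R[i].
Implicit Types (z : C) (h : C * R) (s : seq (C * R)).

Lemma quadratic_not_small (a b x y z v : R) : 0 < v ->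
  v <= `|x - y| -> v <= `|x - z| -> v <= `|y - z| ->
  v ^+ 2 / 4 <= Num.max `|x ^+ 2 + a * x + b|
    (Num.max `|y ^+ 2 + a * y + b| `|z ^+ 2 + a * z + b|).
Proof.
move=> v0 xy xz yz; pose Q u := u ^+ 2 + a * u + b; rewrite -!/(Q _).
rewrite leNgt; apply/negP; rewrite !gt_max => /and3P[hx hy hz].
have nz (u : R) : v <= `|u| -> u != 0 by move=> vu; rewrite -normr_gt0 (lt_le_trans v0).
have term (u u' f : R) : v <= `|u| -> v <= `|u'| -> `|f| < v ^+ 2 / 4 ->
    `|f / (u * u')| <= 4^-1.
  move=> vu vu' hf; rewrite normf_div ler_pdivrMr; last first.
    by rewrite normr_gt0 mulf_neq0 ?nz.
  rewrite (le_trans (ltW hf)) // mulrC ler_wpM2l // normrM expr2.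
  by rewrite ler_pM ?(ltW v0).
(* The second divided difference of a monic quadratic is 1. *)
have dd : Q x / ((x - y) * (x - z)) - Q y / ((x - y) * (y - z)) +
    Q z / ((x - z) * (y - z)) = 1.
  by rewrite /Q; field; rewrite !nz.
have := term _ _ _ xy xz hx; have := term _ _ _ xy yz hy.
have := term _ _ _ xz yz hz; rewrite !ler_norml; lra.
Qed.

Lemma ler1_dist_nat (i j : nat) : i != j -> 1 <= `|i%:R - j%:R| :> R.
Proof.
wlog ij : i j / (i < j)%N => [hw|_].
  rewrite neq_ltn => /orP[ij|ji]; first by apply: hw => //; rewrite ltn_eqF.
  by rewrite distrC; apply: hw => //; rewrite ltn_eqF.
have : i.+1%:R <= j%:R :> R by rewrite ler_nat.
by rewrite distrC -natr1 => h; rewrite ger0_norm; lra.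
Qed.

Lemma sqr_normc_ray (r : R) (w c : C) : normc w = 1 ->
  normc (r%:C * w - c) ^+ 2 =
  r ^+ 2 + (- 2 * complex.Re (w * conjc c)) * r + normc c ^+ 2.
Proof.
move=> w1; rewrite sqr_normcD normcN normcM w1 mulr1 normc_real real_normK ?num_real //.
by case: w c {w1} => [a b] [u v] /=; ring.
Qed.

(* Pigeonhole: each condition is a monic quadratic in [r], hence fails for at most
   two of the [2 * n * size s + 1] equally spaced candidates. *)
Lemma avoiding_radius (n : nat) (w : C) s (p q : R) :
  n.-primitive_root w -> p < q ->
  exists2 r, p <= r <= q &
    forall k h, h \in s ->
    ((q - p) / (2 * n%:R * (size s)%:R + 1)) ^+ 2 / 4 <=
    `|normc (r%:C * w ^+ k - h.1) ^+ 2 - h.2 ^+ 2|.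
Proof.
move=> pw pq; set v := (q - p) / _.
pose m := size s; pose T := (2 * n * m).+1.
have n0 := prim_order_gt0 pw.
have TE : 2 * n%:R * m%:R + 1 = T%:R :> R by rewrite -natrM -natrM natr1.
have v0 : 0 < v by rewrite divr_gt0 ?subr_gt0 // TE ltr0n.
pose r (j : 'I_T) := p + v * j%:R.
have rP j : p <= r j <= q.
  rewrite lerDl mulr_ge0 ?(ltW v0) //= -lerBrDl.
  have -> : q - p = v * T%:R by rewrite /v TE mulfVK // pnatr_eq0.
  by rewrite ler_wpM2l ?(ltW v0) // ler_nat ltnW.
pose bad (j : 'I_T) (y : 'I_n * 'I_m) := let h := nth (0, 0) s y.2 in
  `|normc ((r j)%:C * w ^+ y.1 - h.1) ^+ 2 - h.2 ^+ 2| < v ^+ 2 / 4.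
have [//|nogood] := pselect (exists2 r, p <= r <= q & forall k h, h \in s ->
  v ^+ 2 / 4 <= `|normc (r%:C * w ^+ k - h.1) ^+ 2 - h.2 ^+ 2|).
have /choice[f fbad] j : exists y, bad j y.
  apply: contrapT => nobad; apply: nogood; exists (r j) => // k h hs.
  rewrite leNgt; apply/negP => hb; apply: nobad.
  have kn : (k %% n < n)%N by rewrite ltn_mod.
  have hm : (index h s < m)%N by rewrite index_mem.
  exists (Ordinal kn, Ordinal hm).
  by rewrite /bad /= nth_index // (prim_expr_mod pw).
have : (\sum_(j : 'I_T) 1 <= 2 * n * m)%N.
  rewrite (partition_big f xpredT) //=.
  have -> : (2 * n * m = \sum_(y : 'I_n * 'I_m) 2)%N.
    by rewrite sum_nat_const card_prod !card_ord [RHS]mulnC mulnA.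
  apply: leq_sum => y _; rewrite leqNgt sum1_card; apply/negP.
  move=> /card_gt2P[j1 [j2 [j3 [[f1 f2 f3] [n12 n23 n31]]]]].
  have {}f1 : f j1 = y by exact/eqP.
  have {}f2 : f j2 = y by exact/eqP.
  have {}f3 : f j3 = y by exact/eqP.
  have sep j j' : j != j' -> v <= `|r j - r j'|.
    move=> jj'; rewrite /r opprD addrACA subrr add0r -mulrBr normrM gtr0_norm //.
    by rewrite ler_peMr ?(ltW v0) // ler1_dist_nat.
  have := fbad j1; have := fbad j2; have := fbad j3.
  rewrite f1 f2 f3 /bad; set h := nth _ _ _ => b3 b2 b1.
  have := quadratic_not_small (- 2 * complex.Re (w ^+ y.1 * conjc h.1))
    (normc h.1 ^+ 2 - h.2 ^+ 2) v0 (sep _ _ n12) (sep _ _ _) (sep _ _ n23).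
  rewrite eq_sym n31 => /(_ isT); rewrite leNgt => /negP; apply.
  by rewrite !gt_max !addrA -!sqr_normc_ray ?(normc_prim_root _ pw) // b1 b2 b3.
by rewrite sum1_card card_ord ltnn.
Qed.

(** The powers of [u] sum to [0], so [n] is the sum of the [1 - u ^+ k] for [k < n], and each of
    these is at most [k * normc (1 - u)] in modulus. *)
Lemma unity_root_separation (n : nat) (u : C) : u ^+ n = 1 -> u != 1 ->
  (0 < n)%N -> n%:R^-1 <= normc (1 - u).
Proof.
move=> un u1 n0.
have nu : normc u = 1.
  have : normc u ^+ n = 1 by rewrite -normcX un normc1.
  by move/eqP; rewrite pexpr_eq1 ?normc_ge0 // => /eqP.
have s0 : \sum_(k < n) u ^+ k = 0.
  have u10 : u - 1 != 0 by rewrite subr_eq0.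
  by apply: (mulfI u10); rewrite mulr0 -subrX1 un subrr.
have hk k : normc (1 - u ^+ k) <= k%:R * normc (1 - u).
  elim: k => [|k IH]; first by rewrite expr0 subrr normc0 mul0r.
  have -> : 1 - u ^+ k.+1 = (1 - u ^+ k) + u ^+ k * (1 - u) by rewrite exprSr; ring.
  rewrite (le_trans (le_normcD _ _)) // -natr1 mulrDl mul1r lerD //.
  by rewrite normcM normcX nu expr1n mul1r.
have nR : 0 < n%:R :> R by rewrite ltr0n.
have : n%:R <= n%:R * (n%:R * normc (1 - u)).
  rewrite -[X in X <= _]normc_nat.
  have -> : n%:R = \sum_(k < n) (1 - u ^+ k) :> C.
    by rewrite sumrB s0 subr0 sumr_const card_ord.
  rewrite (le_trans (le_normc_sum _ _ _)) // mulr_natl.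
  rewrite -[n in _ *+ n]card_ord -sumr_const ler_sum // => k _.
  by rewrite (le_trans (hk k)) // ler_wpM2r ?normc_ge0 // ler_nat ltnW.
by rewrite -[X in X <= _]mulr1 ler_pM2l // -ler_pdivrMl // mulr1.
Qed.

(** The cube of Bernoulli's bound [(1 + x) ^+ k >= k x] is cubic in [k], and [n = 3 k] makes the
    right-hand side quadratic in [k]. *)
Lemma exp_beats_square (x B : R) : 0 < x -> 0 < B ->
  exists2 n, (0 < n)%N & 2 + B * n%:R ^+ 2 <= (1 + x) ^+ n.
Proof.
move=> x0 B0; have x30 : 0 < x ^+ 3 by rewrite exprn_gt0.
have /archi_boundP : 0 <= (2 + 9 * B) / x ^+ 3.
  by rewrite divr_ge0 ?(ltW x30) //; lra.
set k := Num.bound _ => hk; exists (3 * k)%N.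
  rewrite muln_gt0 /= lt0n; apply/eqP => k0; move: hk; rewrite k0.
  by rewrite ltr_pdivrMr // mul0r; lra.
have k1 : 1 <= k%:R :> R.
  rewrite -[1]/(1%:R) ler_nat lt0n; apply/eqP => k0; move: hk; rewrite k0.
  by rewrite ltr_pdivrMr // mul0r; lra.
have bern m : 1 + m%:R * x <= (1 + x) ^+ m.
  elim: m => [|m IH]; first by rewrite mul0r addr0 expr0.
  rewrite exprS -natr1; have x1 : 0 <= 1 + x by lra.
  rewrite (le_trans _ (ler_wpM2l x1 IH)) //.
  have : 0 <= x * (m%:R * x) by rewrite !mulr_ge0 ?(ltW x0) //.
  by lra.
rewrite mulnC exprM; have kx : 0 <= k%:R * x by rewrite mulr_ge0 ?(ltW x0).
have h : k%:R * x <= (1 + x) ^+ k by rewrite (le_trans _ (bern k)) // lerDr.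
rewrite (le_trans _ (lerXn2r 3 _ _ h)) ?nnegrE ?exprn_ge0 //; last by lra.
rewrite exprMn natrM exprMn; move: hk; rewrite ltr_pdivrMr // => hk.
have k2 : 1 <= k%:R ^+ 2 :> R by rewrite exprn_ege1.
rewrite [_ ^+ 3 * _](_ : _ = k%:R ^+ 2 * (k%:R * x ^+ 3)); last by rewrite exprS; ring.
have k20 : 0 <= k%:R ^+ 2 :> R by rewrite exprn_ge0.
rewrite (le_trans _ (ler_wpM2l k20 (ltW hk))) //.
have : 2 * 1 <= 2 * k%:R ^+ 2 :> R by rewrite ler_wpM2l.
by rewrite mulrDr; lra.
Qed.

End Holes.

(** * One stage of the removal of discs *)

Section HoleStage.
Variable R : realType.
Local Notation C := R[i].
Implicit Types (z : C) (h : C * R) (s : seq (C * R)).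

(** When positive, the distance from the disc [h] to the unit circle. *)
Definition gap h : R := `|normc h.1 - 1| - h.2.

(** The disc around [0] keeps [|z| >= 1/2], so that only radii in [[1/2, 2]] have to be treated. *)
Definition good_holes s := [/\ disjoint_holes s, (0, 2^-1) \in s &
  forall h, h \in s -> 0 < gap h].

Definition outside s z := normc z <= 2 /\ forall h, h \in s -> h.2 <= normc (z - h.1).

Lemma sqr_gap_le (x y c B : R) : 0 <= x -> 0 <= y -> x + y <= B -> 0 < B ->
  c <= `|x ^+ 2 - y ^+ 2| -> c / B <= `|x - y|.
Proof.
move=> x0 y0 xyB B0; rewrite subr_sqr normrM [`|x + y|]ger0_norm ?addr_ge0 // => h.
by rewrite ler_pdivrMr // (le_trans h) // ler_wpM2l.
Qed.

(** The radius is [kappa = B / N^2] with [N = l n] and [B] independent of [n]. This is small enough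
    for up to [N] disjoint discs of small total weight, yet [1 / kappa] is only quadratic in [n], so
    the exponential [(1 + 1 / l) ^ n] overtakes it. *)
Lemma hole_stage s (p q : R) (l : nat) (beta : R) :
  good_holes s -> 2^-1 <= p -> p < q -> q < 2 -> q < 1 \/ 1 < p ->
  (0 < l)%N -> 0 < beta ->
  exists new r n w kappa,
  [/\ good_holes (s ++ new), \sum_(h <- new) h.2 / gap h <= beta,
    [/\ p <= r <= q, (0 < n)%N & (l * n).-primitive_root w],
    0 < kappa /\ 2 * (1 + 2 / kappa) <= (1 + l%:R^-1) ^+ n &
    forall k, (forall z, outside (s ++ new) z -> kappa <= normc (z - r%:C * w ^+ k)) /\
      exists2 h, h \in s ++ new & normc (r%:C * w ^+ k - h.1) < h.2].
Proof.
move=> [[us sin sdis] s0 sgap] p2 pq q2 pq1 l0 beta0.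
have [g g0 [gq gp]] : exists2 g : R, 0 < g & (q <= 2 - 2 * g) /\
    forall r, p <= r <= q -> 2 * g <= `|r - 1|.
  exists (Num.min ((2 - q) / 2) ((if q < 1 then 1 - q else p - 1) / 2)).
    by rewrite lt_min; apply/andP; split; case: ltP pq1 => ? []; lra.
  split; first by have := ge_min ((2 - q) / 2) ((2 - q) / 2)
    ((if q < 1 then 1 - q else p - 1) / 2); rewrite lexx /= => /esym; lra.
  move=> r /andP[pr rq].
  have : Num.min ((2 - q) / 2) ((if q < 1 then 1 - q else p - 1) / 2) <=
    (if q < 1 then 1 - q else p - 1) / 2 by rewrite ge_min lexx orbT.
  case: ltP pq1 => [q1 _|q1 []]; [|lra|move=> p1].
    by rewrite ler0_norm; lra.
  by rewrite ger0_norm; lra.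
(* For every [N >= 1] the spacing in [avoiding_radius] is at least [A / N]; so [A] and [B] can be
   fixed before [n]. *)
pose m := size s; pose A := (q - p) / (3 * (m.+1)%:R).
have A0 : 0 < A by rewrite divr_gt0 ?subr_gt0 // mulr_gt0 // ltr0n.
(* In turn, these bounds give the clearance [2 * kappa] from the old circles, the position of the
   new discs relative to the circles [|z| = 1] and [|z| = 2], their disjointness, and their total
   weight. *)
have [B [B0 BA Bg B8 Bb]] : exists B : R, [/\ 0 < B, B <= A ^+ 2 / 48, B <= g,
    B <= 8^-1 & B <= beta * g].
  exists (Num.min (Num.min (A ^+ 2 / 48) g) (Num.min 8^-1 (beta * g))).
  have A48 : 0 < A ^+ 2 / 48 by rewrite divr_gt0 // exprn_gt0.
  have bg : 0 < beta * g by rewrite mulr_gt0.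
  have e8 : 0 < 8^-1 :> R by rewrite invr_gt0.
  by split; rewrite ?lt_min ?A48 ?g0 ?bg ?e8 // !ge_min lexx ?orbT.
have lR : 0 < l%:R :> R by rewrite ltr0n.
(* For [kappa = B / (l n)^2], the quantity [2 (1 + 2 / kappa)] is [2 + (4 l^2 / B) n^2]. *)
have [||n n0 hn] := @exp_beats_square R l%:R^-1 (4 * l%:R ^+ 2 / B).
- by rewrite invr_gt0.
- by rewrite divr_gt0 // mulr_gt0 // exprn_gt0.
pose N := (l * n)%N; have N0 : (0 < N)%N by rewrite muln_gt0 l0.
have NR : 1 <= N%:R :> R by rewrite ler1n.
have NR0 : 0 < N%:R :> R by rewrite ltr0n.
have [w pw] := @exists_prim_root R N N0.
have [r rpq hr] := avoiding_radius s pw pq.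
pose kappa := B / N%:R ^+ 2.
have k0 : 0 < kappa by rewrite divr_gt0 // exprn_gt0.
have kB : kappa <= B / N%:R.
  rewrite /kappa expr2 invfM mulrA ler_piMr ?divr_ge0 ?(ltW B0) ?(ltW NR0) //.
  by rewrite invf_le1.
have kB1 : kappa <= B.
  by rewrite (le_trans kB) // ler_piMr ?(ltW B0) // invf_le1.
have [pr rq] := andP rpq.
have r0 : 0 < r by lra.
pose c k : C := r%:C * w ^+ k.
have nc k : normc (c k) = r.
  by rewrite normcM (normc_prim_root _ pw) mulr1 normc_real gtr0_norm.
have far k h : h \in s -> 2 * kappa <= `|normc (c k - h.1) - h.2|.
  move=> hs; have [h0 h2] := sin _ hs; have := hr k _ hs.
  have nh : normc (c k - h.1) + h.2 <= 6.
    have := le_normcB (c k) h.1; rewrite nc; lra.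
  have B6 : 0 < 6 :> R by [].
  move/(sqr_gap_le (normc_ge0 _) (ltW h0) nh B6); apply: le_trans.
  have vA : A / N%:R <= (q - p) / (2 * N%:R * m%:R + 1).
    rewrite /A -mulrA -invfM ler_wpM2l ?subr_ge0 ?(ltW pq) // lef_pV2 ?posrE.
    - have : N%:R * m%:R >= 0 :> R by rewrite mulr_ge0 ?ler0n.
      by rewrite -natr1; nra.
    - by rewrite !mulr_gt0 // ltr0n.
    - by rewrite ltr_wpDl // !mulr_ge0 ?ler0n.
  have AN0 : 0 <= A / N%:R by rewrite divr_ge0 ?(ltW A0) ?(ltW NR0).
  have := lerXn2r 2 AN0 (le_trans AN0 vA) vA.
  rewrite exprMn exprVn /kappa => h1.
  have : B / N%:R ^+ 2 <= A ^+ 2 / 48 / N%:R ^+ 2.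
    by rewrite ler_wpM2r // invr_ge0 exprn_ge0 ?(ltW NR0).
  lra.
(* A root inside an old hole gets no disc of its own: it is already at distance at least [2 * kappa]
   from the remaining set. *)
pose inold k := has (fun h => normc (c k - h.1) < h.2) s.
pose new := [seq (c k, kappa) | k <- iota 0 N & ~~ inold k].
have newP h : h \in new -> exists k, [/\ (k < N)%N, ~~ inold k & h = (c k, kappa)].
  move=> /mapP[k]; rewrite mem_filter mem_iota => /andP[ik /andP[_ kN]] ->.
  by exists k.
have cinj j k : (j < N)%N -> (k < N)%N -> c j = c k -> j = k.
  move=> jN kN /mulfI h; have {}h : w ^+ j = w ^+ k.
    by apply: h; rewrite eq_complex /= eqxx andbT gt_eqF.
  have := eq_prim_root_expr pw j k; rewrite h eqxx => /esym/eqP.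
  by rewrite !modn_small.
have sep j k : (j < N)%N -> (k < N)%N -> j != k -> kappa + kappa < normc (c j - c k).
  wlog jk : j k / (j < k)%N => [hw|] jN kN njk.
    move: (njk); rewrite neq_ltn => /orP[jk|kj]; first exact: hw.
    by rewrite normcBC; apply: hw => //; rewrite eq_sym.
  have -> : c j - c k = r%:C * (w ^+ j * (1 - w ^+ (k - j))).
    by rewrite mulrBr mulr1 -exprD subnKC ?(ltnW jk) // mulrBr.
  rewrite normcM normc_real gtr0_norm // normcM (normc_prim_root _ pw) mul1r.
  have u1 : w ^+ (k - j) != 1.
    rewrite -(prim_order_dvd pw) gtnNdvd ?subn_gt0 //.
    by rewrite (leq_ltn_trans (leq_subr _ _)).
  have uN : (w ^+ (k - j)) ^+ N = 1.
    by rewrite -exprM mulnC exprM (prim_expr_order pw) expr1n.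
  have hs := unity_root_separation uN u1 N0.
  have : 2^-1 * N%:R^-1 <= r * normc (1 - w ^+ (k - j)).
    by rewrite ler_pM // ?invr_ge0 ?(ltW NR0) //; lra.
  have : B / N%:R <= 8^-1 / N%:R by rewrite ler_wpM2r // invr_ge0 (ltW NR0).
  have : 0 < N%:R^-1 :> R by rewrite invr_gt0.
  lra.
have oldnew h k : h \in s -> ~~ inold k -> h.2 + 2 * kappa <= normc (c k - h.1).
  move=> hs /hasPn /(_ _ hs); rewrite -leNgt => hk.
  have := far k _ hs; rewrite ger0_norm ?subr_ge0 //; lra.
have newgap h : h \in new -> g <= gap h.
  move=> /newP[k [kN ik ->]]; rewrite /gap /= nc; have := gp r rpq; lra.
exists new, r, n, w, kappa; split=> //.
- split; first split.
  + rewrite cat_uniq us /= map_inj_in_uniq ?filter_uniq ?iota_uniq ?andbT //.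
      apply/hasPn => h /newP[k [kN ik hE]]; apply/negP => hs.
      have := oldnew _ _ hs ik; rewrite hE /= subrr normc0; lra.
    move=> j k; rewrite !mem_filter !mem_iota => /andP[_ /andP[_ jN]].
    by move=> /andP[_ /andP[_ kN]] [/cinj h]; apply: h.
  + move=> h; rewrite mem_cat => /orP[/sin //|/newP[k [kN ik ->]]] /=.
    by split=> //; rewrite nc; lra.
  + have cross h k : h \in s -> ~~ inold k -> h.2 + kappa < normc (c k - h.1).
      by move=> hs ik; have := oldnew _ _ hs ik; lra.
    move=> h h'; rewrite !mem_cat => /orP[hs|/newP[k [kN ik hE]]].
      move=> /orP[h's|/newP[k [kN ik ->]] _]; first exact: sdis.
      by rewrite normcBC; apply: cross.
    move=> /orP[h's _|/newP[j [jN ij h'E]]]; first by rewrite addrC hE; apply: cross.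
    rewrite hE h'E => hh; apply: sep => //; apply: contraNneq hh => ->.
    by rewrite eqxx.
  + by rewrite mem_cat s0.
  + move=> h; rewrite mem_cat => /orP[/sgap //|/newgap gh].
    exact: lt_le_trans g0 gh.
- rewrite (@le_trans _ _ (\sum_(h <- new) kappa / g)) //.
    rewrite big_seq [leRHS]big_seq; apply: ler_sum => h hn'.
    have gh := newgap _ hn'.
    have -> : h.2 = kappa by have [k [_ _ ->]] := newP _ hn'.
    rewrite ler_wpM2l ?(ltW k0) // lef_pV2 ?posrE //.
    exact: lt_le_trans g0 gh.
  rewrite big_map big_filter big_mkcond /=.
  rewrite (@le_trans _ _ (\sum_(k <- iota 0 N) kappa / g)) //.
    by apply: ler_sum => k _; case: ifP => // _; rewrite divr_ge0 // ltW.
  have -> : iota 0 N = index_iota 0 N by rewrite /index_iota subn0.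
  rewrite big_mkord sumr_const card_ord -mulr_natl.
  rewrite mulrA ler_pdivrMr // (le_trans _ Bb) // -ler_pdivlMl //.
  by rewrite [_^-1 * _]mulrC.
- split=> //; rewrite (le_trans _ hn) // /kappa /N natrM.
  rewrite [X in _ <= X](_ : _ = 2 * (1 + 2 / (B / (l%:R * n%:R) ^+ 2))) //.
  by field; rewrite !gt_eqF // ltr0n.
move=> k; have [ik|ik] := boolP (inold k).
  have /hasP[h hs hk] := ik.
  split; last by exists h => //; rewrite mem_cat hs.
  move=> z [_ /(_ h)]; rewrite mem_cat hs => /(_ isT) hz.
  have := far k _ hs; rewrite ler0_norm ?subr_le0 ?(ltW hk) // => hf.
  have := le_normcD (z - c k) (c k - h.1); rewrite addrA subrK; lra.
have kN : (k %% N < N)%N by rewrite ltn_mod.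
have ck : c (k %% N)%N = c k by rewrite /c (prim_expr_mod pw).
have hn' : (c k, kappa) \in s ++ new.
  rewrite mem_cat; apply/orP; right; rewrite -ck; apply: map_f.
  by rewrite mem_filter mem_iota kN /= andbT /inold ck.
split=> [z [_ /(_ _ hn')] //|]; exists (c k, kappa) => //=.
by rewrite subrr normc0.
Qed.

End HoleStage.

(** * The sequence of all stages *)

Section HoleSequence.
Variable R : realType.
Local Notation C := R[i].
Implicit Types (z : C) (h : C * R) (s : seq (C * R)) (c : seq (C * C)).

Lemma gap_le_dist h z t : 0 <= h.2 -> normc t = 1 -> normc z = 1 ->
  gap h <= normc (circle_pt h t - z).
Proof.
move=> h0 t1 z1; have := normc_circle_pt h0 t1; rewrite /gap.
have a1 := le_normc_dist h.1 z; have a2 := le_normc_dist z h.1.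
rewrite normcBC z1 in a2; rewrite z1 in a1 => a3.
have : normc (h.1 - z) <= normc (circle_pt h t - h.1) + normc (circle_pt h t - z).
  rewrite (normcBC (circle_pt h t)).
  have -> : h.1 - z = (h.1 - circle_pt h t) + (circle_pt h t - z) by ring.
  exact: le_normcD.
by rewrite a3; case: ler0P; lra.
Qed.

Lemma normc_pole_sum_le c zeta (d : R) : 0 < d ->
  (forall p, p \in c -> d <= normc (zeta - p.2)) ->
  normc (pole_sum c zeta) <= (\sum_(p <- c) normc p.1) / d.
Proof.
move=> d0 hd; rewrite (le_trans (le_normc_sum _ _ _)) // mulr_suml.
rewrite big_seq [leRHS]big_seq; apply: ler_sum => p pc.
have hp := hd _ pc; rewrite normc_div ler_wpM2l ?normc_ge0 //.
by rewrite lef_pV2 ?posrE // (lt_le_trans d0).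
Qed.

Let x : C := circ_pt 2.

Definition kernel_error c zeta := normc ((zeta - x)^-1 - pole_sum c zeta).

(** A crude bound for the holes of later stages, which are unknown when [c] is chosen. It is why
    holes are weighted by [h.2 / gap h]. *)
Lemma kernel_error_le_gap c h t : (forall p, p \in c -> in_arc p.2) ->
  0 <= h.2 -> 0 < gap h -> normc t = 1 ->
  kernel_error c (circle_pt h t) <= (1 + \sum_(p <- c) normc p.1) / gap h.
Proof.
move=> arc h0 g0 t1; rewrite /kernel_error (le_trans (le_normcB _ _)) // mulrDl.
have hx u : gap h <= normc (circle_pt h t - circ_pt u).
  by apply: gap_le_dist => //; exact: normc_circ_pt.
rewrite lerD //.
  by rewrite normcV mul1r lef_pV2 ?posrE ?(lt_le_trans g0 (hx _)) ?hx.
by apply: normc_pole_sum_le => // p /arc[u _ ->].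
Qed.

Definition pole_circle s (r : R) (w : C) (kappa : R) := forall k,
  (forall z, outside s z -> kappa <= normc (z - r%:C * w ^+ k)) /\
  exists2 h, h \in s & normc (r%:C * w ^+ k - h.1) < h.2.

(** For [r <= 2], a kernel [1 / (u - 1)] with poles at the [r * w ^+ k] is bounded by [2 / kappa].
    The growth condition makes the [n]-th root of this bound, after normalization at a character, at
    most [1 + 1 / l]. *)
Definition kills s (p q : R) (l : nat) := exists r n w kappa,
  [/\ p <= r <= q, (0 < n)%N, (l * n).-primitive_root w,
    0 < kappa /\ 2 * (1 + 2 / kappa) <= (1 + l%:R^-1) ^+ n &
    pole_circle s r w kappa].

(** A state consists of the holes and of a real number that dominates the masses of the functionals
    chosen so far. The index [k] serves both as accuracy [2^-k] and, through [unpickle], as the code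
    of the ring and exponent to be treated. *)
Definition hole_step k (st st' : seq (C * R) * R) :=
  [/\ good_holes st'.1, st.2 <= st'.2,
   exists2 new, st'.1 = st.1 ++ new &
     \sum_(h <- new) h.2 / gap h <= 2^-1 ^+ k / st'.2,
   exists2 c, (forall p, p \in c -> in_arc p.2) &
     1 + \sum_(p <- c) normc p.1 <= st'.2 /\
     (forall h, h \in (0, 2) :: st.1 -> forall t, normc t = 1 ->
       kernel_error c (circle_pt h t) <= 2^-1 ^+ k / (2 + \sum_(h <- st.1) h.2)) &
   forall (p q : rat) l, unpickle k = Some (p, q, l) ->
     2^-1 <= ratr p :> R -> ratr p < ratr q :> R -> ratr q < 2 :> R ->
     ratr q < 1 :> R \/ 1 < ratr p :> R -> (0 < l)%N -> kills st'.1 (ratr p) (ratr q) l].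

Lemma min_gap s : good_holes s -> exists2 d : R, 0 < d <= 1 &
  forall h, h \in (0, 2) :: s -> forall t, normc t = 1 ->
    far_from_circle d (circle_pt h t).
Proof.
move=> [[_ sin _] _ sgap].
have [d d01 hd] : exists2 d : R, 0 < d <= 1 & forall h, h \in s -> d <= gap h.
  elim: s sgap {sin} => [_|h s IH sgap]; first by exists 1 => //; rewrite ltr01 lexx.
  have [h' h's|d /andP[d0 d1] hd] := IH; first by apply: sgap; rewrite in_cons h's orbT.
  exists (Num.min d (gap h)).
    by rewrite lt_min d0 sgap ?mem_head // ge_min d1.
  by move=> h'; rewrite in_cons => /orP[/eqP ->|/hd dh']; rewrite ge_min ?lexx ?orbT // dh'.
exists d => // h; rewrite in_cons => /orP[/eqP ->|hs] t t1 z z1.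
  have := le_normc_dist (circle_pt (0, 2) t) z.
  rewrite /circle_pt /= add0r normcM normc_real t1 z1 ger0_norm //.
  by case/andP: d01; lra.
rewrite (le_trans (hd _ hs)) // gap_le_dist //.
by have [/ltW] := sin _ hs.
Qed.

Lemma exists_hole_step k st : good_holes st.1 -> exists st', hole_step k st st'.
Proof.
move: st => [s L] gs; have [[us sin sdis] s0 sgap] := gs.
have [d d01 hd] := min_gap gs.
have sum0 : 0 <= \sum_(h <- s) h.2.
  by rewrite big_seq sumr_ge0 // => h /sin[/ltW].
have e0 : 0 < 2^-1 ^+ k / (2 + \sum_(h <- s) h.2).
  by rewrite divr_gt0 ?exprn_gt0 ?invr_gt0 // ltr_wpDr.
(* [2] is the parameter of [x], and the accuracy is divided by the sum of the radii of the circles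
   present. *)
have [c carc cerr] := reach_all d01 (ler0n R 2) e0.
(* The mass of [c] is known before the new holes, which can therefore be chosen small relative to
   it. *)
pose L' := Num.max L (1 + \sum_(p <- c) normc p.1).
have L'0 : 0 < L'.
  rewrite lt_max; apply/orP; right; rewrite ltr_wpDr //.
  by rewrite sumr_ge0 // => p _; rewrite normc_ge0.
have b0 : 0 < 2^-1 ^+ k / L' by rewrite divr_gt0 ?exprn_gt0 ?invr_gt0.
have [new [gnew hnew hk]] : exists new, [/\ good_holes (s ++ new),
    \sum_(h <- new) h.2 / gap h <= 2^-1 ^+ k / L' &
    forall (p q : rat) l, unpickle k = Some (p, q, l) ->
     2^-1 <= ratr p :> R -> ratr p < ratr q :> R -> ratr q < 2 :> R ->
     ratr q < 1 :> R \/ 1 < ratr p :> R -> (0 < l)%N ->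
     kills (s ++ new) (ratr p) (ratr q) l].
  case E : (unpickle k) => [[[p q] l]|]; last first.
    by exists [::]; split; rewrite ?cats0 ?big_nil // ltW.
  have [[h1 h2 h3 h4 h5]|nh] := pselect [/\ 2^-1 <= ratr p :> R,
    ratr p < ratr q :> R, ratr q < 2 :> R, ratr q < 1 :> R \/ 1 < ratr p :> R &
    (0 < l)%N].
    have [new [r [n [w [kappa [a1 a2 [a3 a4 a5] a6 a7]]]]]] :=
      hole_stage gs h1 h2 h3 h4 h5 b0.
    exists new; split=> // _ _ _ [<- <- <-] *.
    by exists r, n, w, kappa; split.
  exists [::]; split; rewrite ?cats0 ?big_nil ?ltW // => _ _ _ [<- <- <-] *.
  by case: nh.
exists (s ++ new, L'); split=> //=.
- by rewrite le_max lexx.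
- by exists new.
- exists c => //; split; first by rewrite le_max lexx orbT.
  by move=> h hs t t1; apply: cerr; apply: hd.
Qed.

(* The functional [f x - \sum p.1 * f p.2] chosen at stage [k] stays small on
   the Cauchy kernels of the holes of all later stages. *)
Definition hole_system (S : nat -> seq (C * R)) :=
  [/\ forall k, good_holes (S k),
   forall k j, (k <= j)%N -> {subset S k <= S j},
   forall k, exists2 c, (forall p, p \in c -> in_arc p.2) &
     forall j, (k <= j)%N -> exists2 E : C * R -> R,
       (forall h, h \in (0, 2) :: S j -> forall t, normc t = 1 ->
         kernel_error c (circle_pt h t) <= E h) &
       2 * E (0, 2) + \sum_(h <- S j) h.2 * E h <= 3 * 2^-1 ^+ k &
   forall (p q : R) l, 2^-1 <= p -> p < q -> q <= 2 -> (0 < l)%N ->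
     exists j, kills (S j) p q l].

Theorem hole_system_exists : exists S, hole_system S.
Proof.
have /choice[f hf] : forall y : nat * (seq (C * R) * R), exists st',
    good_holes y.2.1 -> hole_step y.1 y.2 st'.
  move=> [k st]; have [gs|ngs] := pselect (good_holes st.1).
    by have [st' hst'] := exists_hole_step k gs; exists st'.
  by exists st.
pose st := fix st k := if k is k'.+1 then f (k', st k') else ([:: (0, 2^-1)], 1).
have good k : good_holes (st k).1.
  elim: k => [|k IH] /=; last by have [] := hf (k, st k) IH.
  split; rewrite ?mem_head //.
    split=> // [h|h h']; rewrite !inE => /eqP ->; last by move=> /eqP ->; rewrite eqxx.
    change (0 < 2^-1 :> R /\ normc (0 : C) + 2^-1 < 2 :> R).
    by rewrite normc0; split; lra.
  move=> h; rewrite inE => /eqP ->.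
  change (0 < `|normc (0 : C) - 1| - 2^-1 :> R).
  by rewrite normc0 sub0r normrN normr1; lra.
have step k : hole_step k (st k) (st k.+1) by exact: (hf (k, st k) (good k)).
pose S k := (st k).1.
have L1 k : 1 <= (st k).2.
  elim: k => [//|k IH]; have [_ h _ _ _] := step k; exact: le_trans h.
(* The divisors never decrease, so the weights added from stage [k] on are bounded by a geometric
   sum over [(st k.+1).2]; [2 - 2 * 2^-1 ^+ m] is its partial sum. *)
have later k m : (st k.+1).2 <= (st (k + m).+1).2 /\
    exists2 new, S (k + m)%N = S k ++ new &
    \sum_(h <- new) h.2 / gap h <= 2^-1 ^+ k * (2 - 2 * 2^-1 ^+ m) / (st k.+1).2.
  elim: m => [|m [IH1 [new IH2 IH3]]].
    rewrite addn0; split=> //; exists [::]; rewrite ?cats0 //.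
    by rewrite big_nil expr0 mulr1 subrr mulr0 mul0r.
  have [_ mono _ _ _] := step (k + m).+1.
  have [_ _ [new' S' b'] _ _] := step (k + m)%N.
  rewrite addnS; split; first exact: le_trans mono.
  exists (new ++ new'); first by rewrite [LHS]S' -/(S (k + m)%N) IH2 catA.
  rewrite big_cat; apply: le_trans (lerD IH3 b') _.
  have pk : 0 < 2^-1 ^+ (k + m) :> R by rewrite exprn_gt0 ?invr_gt0.
  have inv_le : (st (k + m).+1).2^-1 <= (st k.+1).2^-1.
    by rewrite lef_pV2 ?posrE // (lt_le_trans ltr01).
  rewrite (le_trans (lerD (lexx _) (ler_wpM2l (ltW pk) inv_le))) //.
  rewrite exprD [2^-1 ^+ m.+1]exprS -mulrDl; apply: ler_wpM2r.
    by rewrite invr_ge0 (le_trans ler01).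
  by lra.
exists S; split=> //.
- move=> k j kj h hk; have [_ [new SE _]] := later k (j - k)%N.
  by move: SE; rewrite subnKC // => ->; rewrite mem_cat hk.
- move=> k; have [_ _ _ [c carc [cL cerr]] _] := step k.
  exists c => // j kj; have [_ [new SE hnew]] := later k (j - k)%N.
  rewrite subnKC // in SE; pose e := 2^-1 ^+ k / (2 + \sum_(h <- S k) h.2).
  have [[uj sin _] _ sgap] : good_holes (S j) := good j.
  (* The circles known at stage [k] have the approximation error, the later ones the crude bound,
     paid for by their radii. In the factor [3] of the total the former count for [1] and the latter
     for [2]. *)
  exists (fun h => if h \in (0, 2) :: S k then e
                   else (1 + \sum_(p <- c) normc p.1) / gap h).
    move=> h hj t t1; case: ifPn => hk; first exact: cerr.
    have hSj : h \in S j.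
      by move: hj hk; rewrite !in_cons negb_or => /orP[->|].
    apply: kernel_error_le_gap => //; last exact: sgap.
    by have [/ltW] := sin _ hSj.
  have ek : e * (2 + \sum_(h <- S k) h.2) = 2^-1 ^+ k.
    rewrite mulfVK // gt_eqF // ltr_wpDr // big_seq sumr_ge0 // => h.
    by have [[_ sk _] _ _] := good k; move=> /sk[/ltW].
  rewrite mem_head SE big_cat /=.
  have -> : \sum_(h <- S k) h.2 * (if h \in (0, 2) :: S k then e
      else (1 + \sum_(p <- c) normc p.1) / gap h) = (\sum_(h <- S k) h.2) * e.
    rewrite mulr_suml big_seq [RHS]big_seq; apply: eq_bigr => h hk.
    by rewrite in_cons hk orbT.
  rewrite addrA -mulrDl [_ * e]mulrC ek.
  suff : \sum_(h <- new) h.2 * (if h \in (0, 2) :: S k then e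
      else (1 + \sum_(p <- c) normc p.1) / gap h) <= 2 * 2^-1 ^+ k by lra.
  have Lk : 0 < (st k.+1).2 by rewrite (lt_le_trans ltr01).
  apply: (@le_trans _ _ (\sum_(h <- new) h.2 / gap h * (st k.+1).2)).
    rewrite big_seq [leRHS]big_seq; apply: ler_sum => h hn.
    have hj : h \in S j by rewrite SE mem_cat hn orbT.
    have [h0 h2] := sin _ hj.
    have /negbTE -> : h \notin (0, 2) :: S k.
      rewrite in_cons negb_or; apply/andP; split.
        by apply: contraTneq h2 => ->; rewrite -[X in normc X]/(0 : C) normc0 add0r ltxx.
      by move: uj; rewrite SE cat_uniq => /and3P[_ /hasPn/(_ _ hn)].
    rewrite mulrCA [leRHS]mulrC ler_wpM2r // divr_ge0 ?(ltW h0) //.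
    exact/ltW/sgap.
  rewrite -mulr_suml (le_trans (ler_wpM2r (ltW Lk) hnew)) // mulfVK ?gt_eqF //.
  have : 0 <= 2^-1 ^+ (j - k) :> R by rewrite exprn_ge0 ?invr_ge0.
  have : 0 <= 2^-1 ^+ k :> R by rewrite exprn_ge0 ?invr_ge0.
  by nra.
move=> p q l p2 pq q2 l0.
(* A stage treats only rings on one side of the unit circle, with rational radii; such a ring exists
   inside any given one. *)
have [p' [q' [pp' pq' qq' side]]] : exists p' q' : R, [/\ p <= p', p' < q', q' <= q &
    q' <= 1 \/ 1 <= p'].
  have [p1|p1] := ltP p 1; last by exists p, q; split=> //; right.
  exists p, (Num.min q 1); split=> //; rewrite ?lt_min ?pq ?p1 ?ge_min ?lexx ?orbT //.
  by left.
have [a] := rat_in_itvoo pq'; rewrite in_itv /= => /andP[pa aq].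
have [b] := rat_in_itvoo aq; rewrite in_itv /= => /andP[ab bq].
exists (pickle (a, b, l)).+1; have [_ _ _ _ kl] := step (pickle (a, b, l)).
have [||||||r [n [w [kappa [rab h1 h2 h3 h4]]]]] := kl a b l => //.
- exact: pickleK.
- lra.
- lra.
- by case: side => ?; [left|right]; lra.
exists r, n, w, kappa; split=> //.
by move: rab => /andP[? ?]; apply/andP; split; lra.
Qed.

End HoleSequence.

(** * Mean squares over roots of unity *)

Section RootDensity.
Variable R : realType.
Local Notation C := R[i].

Lemma le_normc_ReIm (z : C) : normc z <= `|complex.Re z| + `|complex.Im z|.
Proof.
rewrite -ler_sqr ?nnegrE ?normc_ge0 ?addr_ge0 // sqr_normcE sqrrD.
by rewrite !real_normK ?num_real // lerD2r lerDl mulrn_wge0 // mulr_ge0.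
Qed.

(** Pigeonhole: the square [[-1, 1]^2] is covered by [m] cells of side less than [d / 2]. Dividing
    the roots of one cell by one of them yields as many roots within [d] of [1]. *)
Lemma roots_near_1 (d : R) : 0 < d -> exists2 m : nat, (0 < m)%N &
  forall n (w : C), n.-primitive_root w ->
    (n <= m * #|[pred k : 'I_n | (normc (w ^+ k - 1) < d)%R]|)%N.
Proof.
move=> d0; pose q := Num.bound (2 / d).
have hq : 2 / d < q%:R by apply: archi_boundP; rewrite divr_ge0 // ltW.
have q0 : 0 < q%:R :> R by apply: lt_trans hq; rewrite divr_gt0.
pose cell (u : R) := Num.truncn ((u + 1) * q%:R).
have cellP u v : -1 <= u <= 1 -> -1 <= v <= 1 -> cell u = cell v ->
    `|u - v| < q%:R^-1.
  move=> /andP[u1 u2] /andP[v1 v2] uv.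
  have nn x : -1 <= x -> 0 <= (x + 1) * q%:R :> R.
    by move=> x1; rewrite mulr_ge0 ?(ltW q0) //; lra.
  have /andP[a1 a2] := truncn_itv (nn _ u1).
  have /andP[b1 b2] := truncn_itv (nn _ v1).
  rewrite -!/(cell _) uv -natr1 in a1 a2 b1 b2.
  have : `|u - v| * q%:R < 1.
    rewrite -[q%:R]gtr0_norm // -normrM ltr_norml mulrBl.
    by move: a1 a2 b1 b2; rewrite !mulrDl -!natr1; lra.
  by rewrite -ltr_pdivlMr // mul1r.
have cell_lt u : -1 <= u <= 1 -> (cell u < (2 * q).+1)%N.
  move=> /andP[u1 u2]; rewrite ltnS /cell truncn_le_nat -natr1 natrM.
  have : (u + 1) * q%:R <= 2 * q%:R by rewrite ler_wpM2r ?(ltW q0) //; lra.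
  lra.
have box (t : C) : normc t = 1 -> -1 <= complex.Re t <= 1 /\ -1 <= complex.Im t <= 1.
  move=> t1; have := sqr_normcE t; rewrite t1 expr1n => e.
  have h1 : complex.Re t ^+ 2 <= 1 ^+ 2 by rewrite expr1n e lerDl sqr_ge0.
  have h2 : complex.Im t ^+ 2 <= 1 ^+ 2 by rewrite expr1n e lerDr sqr_ge0.
  by rewrite -!ler_norml -!(@ler_sqr _ `|_|) ?nnegrE // !real_normK ?num_real // h1 h2.
pose m := #|{: 'I_(2 * q).+1 * 'I_(2 * q).+1}|.
exists m => [|n w pw]; first by rewrite /m card_prod !card_ord.
have n0 := prim_order_gt0 pw.
have w1 k := normc_prim_root k pw.
pose f (k : 'I_n) := (Ordinal (cell_lt _ (box _ (w1 k)).1),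
                      Ordinal (cell_lt _ (box _ (w1 k)).2)).
set near1 := [pred k | _].
have nE : n = (\sum_(k : 'I_n) 1)%N by rewrite sum1_card card_ord.
apply: (leq_trans (eq_leq nE)).
rewrite (partition_big f xpredT) //= /m -sum_nat_const; apply: leq_sum => y _.
rewrite sum1_card.
have [k1 fk1|nofib] := pickP [pred k | f k == y]; last first.
  by rewrite (eq_card0 (A := [pred k | f k == y])).
pose g (k : 'I_n) : 'I_n := Ordinal (ltn_pmod (k + (n - k1)) n0).
have wg k : w ^+ g k * w ^+ k1 = w ^+ k.
  rewrite /= (prim_expr_mod pw) -exprD -addnA subnK ?(ltnW (ltn_ord k1)) //.
  by rewrite exprD (prim_expr_order pw) mulr1.
have ginj : {in [pred k | f k == y] &, injective g}.
  move=> k k' _ _ gk; apply/val_inj/eqP.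
  have := eq_prim_root_expr pw k k'; rewrite -(wg k) -(wg k') gk eqxx.
  by move=> /esym; rewrite !modn_small.
suff sub : {subset fintype.image g [pred k | f k == y] <= near1}.
  have /subset_leq_card : fintype.image g [pred k | f k == y] \subset near1.
    exact/fintype.subsetP.
  by rewrite (card_in_image ginj).
move=> k' /fintype.imageP[k].
rewrite !inE => /eqP fk ->.
have w10 : w ^+ k1 != 0 by apply: prim_root_neq0 pw.
have -> : normc (w ^+ g k - 1) = normc (w ^+ k - w ^+ k1).
  have -> : w ^+ k - w ^+ k1 = (w ^+ g k - 1) * w ^+ k1 by rewrite mulrBl mul1r wg.
  by rewrite normcM [normc (w ^+ k1)](w1 k1) mulr1.
move: fk1 => /= /eqP; rewrite -fk => -[] e1 e2.
apply: le_lt_trans (le_normc_ReIm _) _; rewrite !raddfB /=.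
have c1 := cellP _ _ (box _ (w1 k)).1 (box _ (w1 k1)).1 (esym e1).
have c2 := cellP _ _ (box _ (w1 k)).2 (box _ (w1 k1)).2 (esym e2).
have : q%:R^-1 < d / 2.
  by rewrite -[d / 2]invrK ltf_pV2 ?posrE ?invr_gt0 ?divr_gt0 // invf_div.
lra.
Qed.

(** A fixed proportion [1 / m] of the roots is close to [1], and each of them contributes at least
    [1 / 4]. The bound is uniform in [n], which later grows with the approximants. *)
Lemma root_avg_norm_lower_bound (F : C -> C) (d : R) : 0 < d ->
  (forall t, normc t = 1 -> normc (t - 1) < d -> 2^-1 <= normc (F t)) ->
  exists2 c : R, 0 < c & forall n w, n.-primitive_root w ->
    c <= normc (root_avg n w (fun t => F t * conjc (F t))).
Proof.
move=> d0 hF; have [m m0 hm] := roots_near_1 d0.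
exists ((4 * m%:R)^-1) => [|n w pw]; first by rewrite invr_gt0 mulr_gt0 // ltr0n.
have n0 := prim_order_gt0 pw; have nR : 0 < n%:R :> R by rewrite ltr0n.
rewrite /root_avg; under eq_bigr do rewrite mulc_conj.
rewrite -rmorph_sum normcM normcV normc_nat normc_real ger0_norm; last first.
  by rewrite sumr_ge0 // => k _; rewrite sqr_ge0.
rewrite ler_pdivlMl // ler_pdivrMr ?mulr_gt0 ?ltr0n //.
pose near1 := [pred k : 'I_n | normc (w ^+ k - 1) < d].
have h : 4^-1 * #|near1|%:R <= \sum_(k < n) normc (F (w ^+ k)) ^+ 2.
  rewrite (bigID (mem near1)) /= -[leLHS]addr0 lerD //; last first.
    by rewrite sumr_ge0 // => k _; rewrite sqr_ge0.
  rewrite mulr_natr -sumr_const ler_sum // => k; rewrite inE.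
  move=> /(hF _ (normc_prim_root k pw)) hk.
  by rewrite -[4%:R]/(2 * 2)%:R natrM invfM -expr2 lerXn2r ?nnegrE ?normc_ge0 ?invr_ge0.
have := hm n w pw; rewrite -(ler_nat R) natrM -/near1 => h2.
have mR : 0 < m%:R :> R by rewrite ltr0n.
rewrite (le_trans h2) //.
by have := ler_wpM2l (ltW mR) h; lra.
Qed.

End RootDensity.

(** * Partial fractions in [z], and polynomials in [w] over them *)

Section RationalFunctions.
Variable R : realType.
Local Notation C := R[i].
Implicit Types (z w : C) (s : seq (C * R)) (F G : C -> C) (P Q : C -> C -> C).

Definition off_centers s z := forall h, h \in s -> z != h.1.

(** [fraction] is a normal form. The equality is asked only off the centers, where the convention
    [0^-1 = 0] does not disturb the identities between fractions. *)
Definition rational s F :=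
  exists2 G, fraction s G & forall z, off_centers s z -> F z = G z.

Lemma rational_ext s F G : (forall z, off_centers s z -> F z = G z) ->
  rational s G -> rational s F.
Proof. by move=> FG [H hH GH]; exists H => // z hz; rewrite FG ?GH. Qed.

Lemma rational_elem s b a : pole_in s b -> rational s (fun z => a * elem_eval b z).
Proof.
move=> hb; exists (fun z => a * elem_eval b z + 0) => [|z _]; last by rewrite addr0.
by apply: fractionD => //; exact: fraction0.
Qed.

Lemma rational_cst s a : rational s (fun=> a).
Proof.
apply: rational_ext (@rational_elem s (Monomial R 0) a I) => z _.
by rewrite /= expr0 mulr1.
Qed.

Lemma rationalD s F G : rational s F -> rational s G -> rational s (fun z => F z + G z).
Proof.
move=> [F' hF' FF'] [G' hG' GG'].
apply: (@rational_ext _ _ (fun z => F' z + G' z)) => [z hz|].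
  by rewrite FF' ?GG'.
elim: hF' => [|a b {FF' F}F hb _ [H hH e]].
  by exists G' => // z _; rewrite add0r.
exists (fun z => a * elem_eval b z + H z); first exact: fractionD.
by move=> z hz; rewrite -addrA e.
Qed.

Lemma rational_mul_by s G : (forall b, pole_in s b ->
    rational s (fun z => G z * elem_eval b z)) ->
  forall F, rational s F -> rational s (fun z => G z * F z).
Proof.
move=> hG F [F' hF' FF']; apply: (@rational_ext _ _ (fun z => G z * F' z)) => [z hz|].
  by rewrite FF'.
elim: hF' => [|a b {FF' F}F hb _ IH].
  by apply: rational_ext (rational_cst s 0) => z _; rewrite mulr0.
apply: (@rational_ext _ _ (fun z => a * (G z * elem_eval b z) + G z * F z)) => [z _|].
  by rewrite mulrDr mulrCA.
apply: rationalD IH; have [H hH e] := hG _ hb.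
apply: (@rational_ext _ _ (fun z => a * H z)) => [z hz|]; first by rewrite e.
elim: hH {e} => [|a' b' H' hb' _ IH].
  by apply: rational_ext (rational_cst s 0) => z _; rewrite mulr0.
apply: (@rational_ext _ _ (fun z => a * a' * elem_eval b' z + a * H' z)) => [z _|].
  by rewrite mulrDr mulrA.
by apply: rationalD IH; exact: rational_elem.
Qed.

Lemma rationalZ s a F : rational s F -> rational s (fun z => a * F z).
Proof. by apply: rational_mul_by => b; exact: rational_elem. Qed.

Lemma rational_mulX s F : rational s F -> rational s (fun z => z * F z).
Proof.
apply: (@rational_mul_by s id) => -[n _|c n hc].
  apply: rational_ext (@rational_elem s (Monomial R n.+1) 1 I) => z _ /=.
  by rewrite mul1r exprS.
have [h hs ch] := hc; case: n hc => [|n] hc.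
  apply: (@rational_ext _ _ (fun z => 1 + c * elem_eval (Pole c 0) z)) => [z hz|].
    have zc : z - c != 0 by rewrite subr_eq0 ch; apply: hz.
    by rewrite /= expr1; field.
  by apply: rationalD; [exact: rational_cst|exact: rational_elem].
apply: (@rational_ext _ _
  (fun z => 1 * elem_eval (Pole c n) z + c * elem_eval (Pole c n.+1) z)) => [z hz|].
  have zc : z - c != 0 by rewrite subr_eq0 ch; apply: hz.
  have zcn : (z - c) ^+ n != 0 by rewrite expf_neq0.
  by rewrite /= !exprS; field; rewrite zc zcn.
by apply: rationalD; exact: rational_elem.
Qed.

Lemma rational_mul_pole s h F : h \in s -> rational s F ->
  rational s (fun z => (z - h.1)^-1 * F z).
Proof.
move=> hs; apply: (@rational_mul_by s (fun z => (z - h.1)^-1)) => -[n _|c n hc].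
  elim: n => [|n IH].
    apply: rational_ext (@rational_elem s (Pole h.1 0) 1 _) => [z _ /=|].
      by rewrite mulr1 mul1r expr1.
    by exists h.
  apply: (@rational_ext _ _ (fun z => 1 * elem_eval (Monomial R n) z +
    h.1 * ((z - h.1)^-1 * elem_eval (Monomial R n) z))) => [z hz|].
    have zc : z - h.1 != 0 by rewrite subr_eq0; apply: hz.
    by rewrite /= exprS; field.
  by apply: rationalD; [exact: rational_elem|exact: rationalZ].
have [h' h's ch'] := hc; have [hh|hh] := eqVneq c h.1.
  apply: rational_ext (@rational_elem s (Pole c n.+1) 1 hc) => z _ /=.
  by rewrite mul1r -hh [in RHS]exprS invfM.
have hc0 : h.1 - c != 0 by rewrite subr_eq0 eq_sym.
elim: n hc => [|n IH] hc.
  apply: (@rational_ext _ _ (fun z => (h.1 - c)^-1 * elem_eval (Pole h.1 0) z +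
    - (h.1 - c)^-1 * elem_eval (Pole c 0) z)) => [z hz|].
    have zc : z - c != 0 by rewrite subr_eq0 ch'; apply: hz.
    have zh : z - h.1 != 0 by rewrite subr_eq0; apply: hz.
    by rewrite /= !expr1; field; rewrite hc0 zc zh.
  by apply: rationalD; apply: rational_elem => //; exists h.
apply: (@rational_ext _ _ (fun z => (h.1 - c)^-1 *
    ((z - h.1)^-1 * elem_eval (Pole c n) z) +
    - (h.1 - c)^-1 * elem_eval (Pole c n.+1) z)) => [z hz|].
  have zc : z - c != 0 by rewrite subr_eq0 ch'; apply: hz.
  have zh : z - h.1 != 0 by rewrite subr_eq0; apply: hz.
  have zcn : (z - c) ^+ n != 0 by rewrite expf_neq0.
  by rewrite /= !exprS; field; rewrite hc0 zc zh zcn.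
by apply: rationalD; [apply/rationalZ/IH|exact: rational_elem].
Qed.

Lemma rationalM s F G : rational s F -> rational s G -> rational s (fun z => F z * G z).
Proof.
move=> hF hG; apply: (@rational_ext _ _ (fun z => G z * F z)) => [z _|].
  by rewrite mulrC.
apply: rational_mul_by hF => b hb.
apply: (@rational_ext _ _ (fun z => elem_eval b z * G z)) => [z _|].
  by rewrite mulrC.
case: b hb => [n _|c n [h hs ->]].
  elim: n => [|n IH].
    by apply: rational_ext hG => z _; rewrite /= mul1r.
  apply: rational_ext (rational_mulX IH) => z _ /=.
  by rewrite exprS mulrA.
elim: n => [|n IH].
  by apply: rational_ext (rational_mul_pole hs hG) => z _ /=; rewrite expr1.
apply: rational_ext (rational_mul_pole hs IH) => z _ /=.
by rewrite [in LHS]exprS invfM mulrA.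
Qed.

(** The coefficients are indexed by all naturals and vanish from [m] on, so that sums of different
    lengths can be padded. *)
Definition poly_in_w s Q := exists m (h : nat -> C -> C),
  [/\ forall k, rational s (h k), forall k z, (m <= k)%N -> h k z = 0 &
   forall z w, off_centers s z -> w != 0 -> Q z w = \sum_(k < m) h k z * w ^+ k].

Lemma poly_in_w_ext s P Q :
  (forall z w, off_centers s z -> w != 0 -> P z w = Q z w) ->
  poly_in_w s Q -> poly_in_w s P.
Proof.
move=> PQ [m [h [h1 h2 h3]]]; exists m, h; split=> // z w hz w0.
by rewrite PQ ?h3.
Qed.

Lemma poly_in_w_rational s F : rational s F -> poly_in_w s (fun z _ => F z).
Proof.
move=> hF; exists 1%N, (fun k => if k is 0 then F else fun=> 0); split.
- by case=> [|k] //; exact: rational_cst.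
- by case.
- by move=> z w _ _; rewrite big_ord1 expr0 mulr1.
Qed.

Lemma poly_in_w0 s : poly_in_w s (fun _ _ => 0).
Proof. exact: poly_in_w_rational (rational_cst s 0). Qed.

Lemma big_ord_pad (m m' : nat) (h : nat -> C) : (m <= m')%N ->
  (forall k, (m <= k)%N -> h k = 0) -> \sum_(k < m') h k = \sum_(k < m) h k.
Proof.
move=> mm' h0; rewrite [RHS](big_ord_widen _ _ mm') [RHS]big_mkcond.
by apply: eq_bigr => k _; case: ltnP => // /h0.
Qed.

Lemma poly_in_wD s P Q : poly_in_w s P -> poly_in_w s Q ->
  poly_in_w s (fun z w => P z w + Q z w).
Proof.
move=> [m [h [h1 h2 h3]]] [m' [h' [h1' h2' h3']]].
exists (maxn m m'), (fun k z => h k z + h' k z); split.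
- by move=> k; exact: rationalD.
- by move=> k z; rewrite geq_max => /andP[? ?]; rewrite h2 ?h2' ?addr0.
move=> z w hz w0; under eq_bigr do rewrite mulrDl.
rewrite big_split /= h3 // h3' //; congr (_ + _); apply/esym.
  apply: (big_ord_pad (h := fun k => h k z * w ^+ k)) => [|k mk].
    exact: leq_maxl.
  by rewrite h2 // mul0r.
apply: (big_ord_pad (h := fun k => h' k z * w ^+ k)) => [|k mk].
  exact: leq_maxr.
by rewrite h2' // mul0r.
Qed.

Lemma poly_in_w_mul_rational s F Q : rational s F -> poly_in_w s Q ->
  poly_in_w s (fun z w => F z * Q z w).
Proof.
move=> hF [m [h [h1 h2 h3]]]; exists m, (fun k z => F z * h k z); split.
- by move=> k; exact: rationalM.
- by move=> k z mk; rewrite h2 ?mulr0.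
- by move=> z w hz w0; rewrite h3 // mulr_sumr; apply: eq_bigr => k _; rewrite mulrA.
Qed.

Lemma poly_in_w_mulXn s Q n : poly_in_w s Q -> poly_in_w s (fun z w => w ^+ n * Q z w).
Proof.
move=> hQ; elim: n => [|n [m [h [h1 h2 h3]]]].
  by apply: poly_in_w_ext hQ => z w _ _; rewrite mul1r.
exists m.+1, (fun k => if k is k'.+1 then h k' else fun=> 0); split.
- by case=> [|k] //; exact: rational_cst.
- by case=> // k z mk; exact: h2.
move=> z w hz w0; rewrite exprS -mulrA h3 // big_ord_recl mul0r add0r mulr_sumr.
by apply: eq_bigr => k _; rewrite /= exprS mulrCA.
Qed.

Lemma poly_in_wM s P Q : poly_in_w s P -> poly_in_w s Q ->
  poly_in_w s (fun z w => P z w * Q z w).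
Proof.
move=> [m [h [h1 _ h3]]] hQ.
apply: (@poly_in_w_ext _ _ (fun z w => (\sum_(k < m) h k z * w ^+ k) * Q z w)).
  by move=> z w hz w0; rewrite h3.
elim: m {h3} => [|m IH].
  by apply: poly_in_w_ext (poly_in_w0 s) => z w _ _; rewrite big_ord0 mul0r.
apply: (@poly_in_w_ext _ _ (fun z w => (\sum_(k < m) h k z * w ^+ k) * Q z w +
  h m z * (w ^+ m * Q z w))) => [z w _ _|].
  by rewrite big_ord_recr /= mulrDl mulrA.
by apply: poly_in_wD IH _; apply/poly_in_w_mul_rational/poly_in_w_mulXn.
Qed.

Inductive laurent (S : nat -> seq (C * R)) : (C -> C -> C) -> Prop :=
| laurent_cst a : laurent S (fun _ _ => a)
| laurent_z : laurent S (fun z _ => z)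
| laurent_w : laurent S (fun _ w => w)
| laurent_wV : laurent S (fun _ w => w^-1)
| laurent_pole j h : h \in S j -> laurent S (fun z _ => (z - h.1)^-1)
| laurentD P Q : laurent S P -> laurent S Q -> laurent S (fun z w => P z w + Q z w)
| laurentM P Q : laurent S P -> laurent S Q -> laurent S (fun z w => P z w * Q z w).

(** An element involves finitely many poles, all present at some stage, and finitely many factors
    [1 / w], cleared by a power of [w]. *)
Lemma laurent_poly_in_w (S : nat -> seq (C * R)) P :
  (forall k j, (k <= j)%N -> {subset S k <= S j}) -> laurent S P ->
  exists j0 n0, forall j n, (j0 <= j)%N -> (n0 <= n)%N ->
    poly_in_w (S j) (fun z w => w ^+ n * P z w).
Proof.
move=> mono; elim=> {P} [a||||j h hj|P Q _ [j1 [n1 h1]] _ [j2 [n2 h2]]|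
  P Q _ [j1 [n1 h1]] _ [j2 [n2 h2]]].
- exists 0%N, 0%N => j n _ _; apply: poly_in_w_mulXn.
  exact/poly_in_w_rational/rational_cst.
- exists 0%N, 0%N => j n _ _; apply: poly_in_w_mulXn; apply: poly_in_w_rational.
  apply: (@rational_ext _ _ (fun z => z * 1)) => [z _|]; first by rewrite mulr1.
  exact/rational_mulX/rational_cst.
- exists 0%N, 0%N => j n _ _; apply: (@poly_in_w_ext _ _ (fun z w => w ^+ n.+1 * 1)).
    by move=> z w _ _; rewrite mulr1 exprSr.
  exact/poly_in_w_mulXn/poly_in_w_rational/rational_cst.
- exists 0%N, 1%N => j [|n] // _ _; apply: (@poly_in_w_ext _ _ (fun z w => w ^+ n * 1)).
    by move=> z w _ w0; rewrite mulr1 exprSr mulfK.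
  exact/poly_in_w_mulXn/poly_in_w_rational/rational_cst.
- exists j, 0%N => j' n jj' _; apply: poly_in_w_mulXn; apply: poly_in_w_rational.
  apply: (@rational_ext _ _ (fun z => (z - h.1)^-1 * 1)) => [z _|].
    by rewrite mulr1.
  by apply: rational_mul_pole; [exact: mono hj|exact: rational_cst].
- exists (maxn j1 j2), (maxn n1 n2) => j n; rewrite !geq_max.
  move=> /andP[? ?] /andP[? ?].
  apply: (@poly_in_w_ext _ _ (fun z w => w ^+ n * P z w + w ^+ n * Q z w)).
    by move=> z w _ _; rewrite mulrDr.
  by apply: poly_in_wD; [exact: h1|exact: h2].
exists (maxn j1 j2), (n1 + n2)%N => j n; rewrite geq_max => /andP[? ?] nn.
apply: (@poly_in_w_ext _ _ (fun z w => (w ^+ n1 * P z w) * (w ^+ (n - n1) * Q z w))).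
  by move=> z w _ _; rewrite mulrACA -exprD subnKC // (leq_trans (leq_addr _ _) nn).
by apply: poly_in_wM; [apply: h1|apply: h2] => //; lia.
Qed.

(** A Fourier coefficient along the rotations of [w]. For [n > m + k] all differences [i - k] with
    [i < m] lie strictly between [-n] and [n], so there is no aliasing. *)
Lemma mode_extraction s Q m (h : nat -> C -> C) z w k (n : nat) (u : C) :
  (forall k z, (m <= k)%N -> h k z = 0) ->
  (forall z w, off_centers s z -> w != 0 -> Q z w = \sum_(k < m) h k z * w ^+ k) ->
  off_centers s z -> w != 0 -> n.-primitive_root u -> (m + k < n)%N ->
  root_avg n u (fun t => t ^- k * Q z (w * t)) = h k z * w ^+ k.
Proof.
move=> h0 hQ hz w0 pu mkn.
rewrite (@eq_root_avg _ _ _ pu _ (fun t => \sum_(i0 <- iota 0 m)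
    h i0 z * w ^+ i0 * (t ^- k * t ^+ i0))); last first.
  move=> t t1; have t0 : t != 0 by rewrite -normc_gt0 t1.
  rewrite hQ ?mulf_neq0 // mulr_sumr.
  rewrite -(big_mkord xpredT (fun i0 => t ^- k * (h i0 z * (w * t) ^+ i0))).
  rewrite /index_iota subn0; apply: eq_bigr => i0 _.
  by rewrite exprMn; ring.
rewrite root_avg_sum.
have orth i0 : (i0 < n)%N -> root_avg n u (fun t => t ^- k * t ^+ i0) = (i0 == k)%:R.
  move=> i0n; have [ik|ik] := leqP i0 k.
    rewrite (@eq_root_avg _ _ _ pu _ (fun t => t ^- (k - i0))) => [|t t1].
      rewrite (root_avgXV pu); have [->|ne] := eqVneq i0 k.
        by rewrite subnn dvdn0.
      by rewrite gtnNdvd //; lia.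
    have t0 : t != 0 by rewrite -normc_gt0 t1.
    rewrite -{1}(subnK ik) exprD invfM -mulrA mulVf ?mulr1 //.
    by rewrite expf_neq0.
  rewrite (@eq_root_avg _ _ _ pu _ (fun t => t ^+ (i0 - k))) => [|t t1].
    by rewrite (root_avgX pu) gtnNdvd ?gtn_eqF //; lia.
  have t0 : t != 0 by rewrite -normc_gt0 t1.
  by rewrite -{1}(subnK (ltnW ik)) exprD mulrCA mulVf ?mulr1 // expf_neq0.
have [km|mk] := ltnP k m; last first.
  rewrite h0 // mul0r big_seq big1 // => i0; rewrite mem_iota => /= i0m.
  rewrite root_avgZ orth; last by lia.
  by rewrite ltn_eqF ?mulr0 //; lia.
rewrite (bigD1_seq k) ?iota_uniq ?mem_iota //= root_avgZ orth ?eqxx ?mulr1; last lia.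
rewrite big_seq_cond big1 ?addr0 // => i0 /andP[]; rewrite mem_iota => /= i0m ne.
by rewrite root_avgZ orth ?(negbTE ne) ?mulr0 //; lia.
Qed.

End RationalFunctions.

(** * Quasi-analyticity on the sphere over the remaining set *)

Section CheeseSphere.
Variable R : realType.
Local Notation C := R[i].
Variable S : nat -> seq (C * R).
Hypothesis sysS : hole_system S.
Implicit Types (z w t : C) (h : C * R) (P Q : C -> C -> C).

Let good k : good_holes (S k). Proof. by have [? _ _ _] := sysS. Qed.
Let mono k j : (k <= j)%N -> {subset S k <= S j}.
Proof. by have [_ + _ _] := sysS; exact. Qed.

Definition cheese z := forall k, outside (S k) z.

Definition cheese_sphere z w := cheese z /\ normc z ^+ 2 + normc w ^+ 2 = 5.

Lemma hole_gt0 k h : h \in S k -> 0 < h.2.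
Proof. by have [[_ hin _] _ _] := good k; move=> /hin[]. Qed.

(** The holes of all stages are disjoint, so the contours of Cauchy's formula lie in the final set,
    where bounds on [X] apply. *)
Lemma cheese_circle j h t : h \in (0, 2) :: S j -> normc t = 1 ->
  cheese (circle_pt h t).
Proof.
move=> hj t1 k; have h0 : 0 <= h.2.
  by move: hj; rewrite in_cons => /orP[/eqP -> //|/hole_gt0/ltW].
have hc := normc_circle_pt h0 t1.
pose m := maxn j k; have [[_ hin hdis] _ _] := good m.
have km : {subset S k <= S m} by apply: mono; exact: leq_maxr.
move: hj; rewrite in_cons => /orP[/eqP hE|/(mono (leq_maxl j k)) hm].
  move: hc; rewrite hE subr0 => hc; split=> [|h' /km h'm]; first by rewrite hc.
  have [_ h'2] := hin _ h'm.
  have := le_normc_dist (circle_pt (0, 2) t) h'.1; rewrite hc /=; lra.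
split=> [|h' /km h'm].
  have [_ h2] := hin _ hm; have := le_normcD (circle_pt h t - h.1) h.1.
  by rewrite subrK hc; lra.
have [<-|hh'] := eqVneq h h'; first by rewrite hc.
have := hdis _ _ hm h'm hh'.
have := le_normcD (circle_pt h t - h'.1) (h.1 - circle_pt h t).
rewrite [_ + (h.1 - _)]addrC addrA subrK [normc (h.1 - circle_pt h t)]normcBC hc.
lra.
Qed.

Lemma Re_circ_pt (t : R) : complex.Re (circ_pt t) = (1 - t ^+ 2) / (1 + t ^+ 2).
Proof.
have t0 : 1 + t ^+ 2 != 0 by rewrite gt_eqF // ltr_pwDl // sqr_ge0.
by rewrite /circ_pt /=; field.
Qed.

Lemma Re_arc (t : R) : 0 <= t <= 1 -> 0 <= complex.Re (circ_pt t).
Proof.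
move=> /andP[t0 t1]; rewrite Re_circ_pt divr_ge0 //.
  by rewrite subr_ge0 exprn_ile1.
by rewrite addr_ge0 ?sqr_ge0.
Qed.

Lemma unit_off_holes z k : normc z = 1 -> off_holes (S k) z.
Proof.
move=> z1; split=> [|h hk]; first by rewrite z1 ltr1n.
have [[_ hin _] _ /(_ _ hk)] := good k; have [h0 _] := hin _ hk.
rewrite /gap; have := le_normc_dist z h.1; have := le_normc_dist h.1 z.
by rewrite (normcBC h.1) z1; case: (ler0P (normc h.1 - 1)); lra.
Qed.

Lemma cheese_unit z : normc z = 1 -> cheese z.
Proof.
move=> z1 k; have [z2 hz] := unit_off_holes k z1.
by split=> [|h /hz]; exact: ltW.
Qed.

Lemma cheese_off_centers z k : cheese z -> off_centers (S k) z.
Proof.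
move=> hz h hk; have [_ /(_ _ hk) zh] := hz k; have h0 := hole_gt0 hk.
by rewrite -subr_eq0 -normc_gt0 (lt_le_trans h0).
Qed.

Lemma cheese_norm z : cheese z -> 2^-1 <= normc z <= 2.
Proof.
move=> /(_ 0%N)[z2 hz]; have [_ s0 _] := good 0; have := hz _ s0.
by rewrite subr0 => ->.
Qed.

Lemma cheese_fiber z : cheese z -> exists w, cheese_sphere z w.
Proof.
move=> hz; have /andP[_ z2] := cheese_norm hz.
have z4 : normc z ^+ 2 <= 2 ^+ 2 by rewrite lerXn2r ?nnegrE ?normc_ge0.
exists (Num.sqrt (5 - normc z ^+ 2))%:C; split=> //.
rewrite normc_real ger0_norm ?sqrtr_ge0 // sqr_sqrtr; last by lra.
by rewrite addrCA subrr addr0.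
Qed.

Lemma fiber_norm z w : cheese_sphere z w -> 1 <= normc w <= 3.
Proof.
move=> [hz e]; have /andP[_ z2] := cheese_norm hz.
have z4 : normc z ^+ 2 <= 2 ^+ 2 by rewrite lerXn2r ?nnegrE ?normc_ge0.
have z0 := sqr_ge0 (normc z).
by apply/andP; split; rewrite -ler_sqr ?nnegrE ?normc_ge0 //; lra.
Qed.

Lemma fiber_neq0 z w : cheese_sphere z w -> w != 0.
Proof. by move=> /fiber_norm/andP[w1 _]; rewrite -normc_gt0 (lt_le_trans ltr01). Qed.

Lemma fiber_rotate z w t : normc t = 1 -> cheese_sphere z w -> cheese_sphere z (w * t).
Proof. by move=> t1 [hz e]; split=> //; rewrite normcM t1 mulr1. Qed.

Lemma laurent_bounded P : laurent S P ->
  exists2 B, 0 < B & forall z w, cheese_sphere z w -> normc (P z w) <= B.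
Proof.
elim=> {P} [a||||j h hj|P Q _ [B B0 hB] _ [B' B'0 hB']|P Q _ [B B0 hB] _ [B' B'0 hB']].
- exists (normc a + 1) => [|z w _]; last by rewrite lerDl.
  by rewrite ltr_wpDl ?normc_ge0.
- by exists 2 => // z w [/cheese_norm/andP[]].
- by exists 3 => // z w /fiber_norm/andP[].
- exists 1 => // z w hw; have /andP[w1 _] := fiber_norm hw.
  by rewrite normcV invf_le1 // (lt_le_trans ltr01).
- have h0 := hole_gt0 hj; exists h.2^-1 => [|z w [/(_ j)[_ /(_ _ hj) hz] _]].
    by rewrite invr_gt0.
  by rewrite normcV lef_pV2 ?posrE // (lt_le_trans h0).
- exists (B + B') => [|z w hzw]; first by rewrite addr_gt0.
  by rewrite (le_trans (le_normcD _ _)) // lerD ?hB ?hB'.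
exists (B * B') => [|z w hzw]; first by rewrite mulr_gt0.
by rewrite normcM ler_pM ?normc_ge0 ?hB ?hB'.
Qed.

Let x : C := circ_pt 2.

Section ModeBound.
Variables (Q : C -> C -> C) (j n m k a : nat) (h : nat -> C -> C).
Hypothesis hrat : rational (S j) (h k).
Hypothesis h0 : forall k z, (m <= k)%N -> h k z = 0.
Hypothesis hQ : forall z w, off_centers (S j) z -> w != 0 ->
  w ^+ n * Q z w = \sum_(k < m) h k z * w ^+ k.
Hypothesis nka : (n <= k + a)%N.

(** [h k] is the coefficient of [w] to the power [k - n] in [Q], and [1 <= |w| <= 3], so
    [n <= k + a] costs a factor of at most [3 ^+ a]. This does not depend on [n], which varies with
    the approximant. *)
Lemma mode_le z (M : R) : cheese z ->
  (forall w, cheese_sphere z w -> normc (Q z w) <= M) -> normc (h k z) <= 3 ^+ a * M.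
Proof.
move=> hz hM; have [w hw] := cheese_fiber hz; have w0 := fiber_neq0 hw.
have /andP[w1 w3] := fiber_norm hw.
have [u pu] := @exists_prim_root R (m + k).+1 isT.
have M0 : 0 <= M by rewrite (le_trans (normc_ge0 _) (hM _ hw)).
have e := mode_extraction h0 hQ (@cheese_off_centers _ j hz) w0 pu (leqnn _).
have wk : 0 < normc w ^+ k by rewrite exprn_gt0 // (lt_le_trans ltr01).
rewrite -(ler_pM2r wk) -normcX -normcM -e.
apply: (le_normc_root_avg pu) => t t1.
rewrite normcM normcV !normcX t1 expr1n invr1 mul1r normcM normcX normcM t1 mulr1.
have hMt := hM _ (fiber_rotate t1 hw).
apply: (@le_trans _ _ (normc w ^+ (k + a) * M)).
  by rewrite ler_pM ?exprn_ge0 ?normc_ge0 // ler_weXn2l.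
rewrite exprD -mulrA [leRHS]mulrC ler_wpM2l ?(ltW wk) //.
by rewrite ler_wpM2r // lerXn2r ?nnegrE ?normc_ge0.
Qed.

(** [cauchy_bound] controls the evaluation at [x] minus the combination [c]; the points of [c] lie
    on the arc, where [Re z >= 0] and [e] bounds [Q]. *)
Lemma mode_bound c (E : C * R -> R) (M e : R) :
  (forall p, p \in c -> in_arc p.2) ->
  (forall h, h \in (0, 2) :: S j -> forall t, normc t = 1 ->
    kernel_error c (circle_pt h t) <= E h) ->
  (forall z w, cheese_sphere z w -> normc (Q z w) <= M) ->
  (forall z w, cheese_sphere z w -> 0 <= complex.Re z -> normc (Q z w) <= e) ->
  normc (h k x) <= 3 ^+ a * (M * (2 * E (0, 2) + \sum_(h <- S j) h.2 * E h) +
    e * \sum_(p <- c) normc p.1).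
Proof.
move=> carc cE hM he; have [F hF hFE] := hrat.
have x1 : normc x = 1 by exact: normc_circ_pt.
have [disj _ _] := good j.
have hFz z : normc z = 1 -> h k z = F z.
  by move=> /cheese_unit hz; apply: hFE; exact: cheese_off_centers.
pose c' := (1, x) :: pole_scale (- 1) c.
have sumE : \sum_(p <- c') p.1 * F p.2 = F x - \sum_(p <- c) p.1 * F p.2.
  rewrite big_cons mul1r big_map -sumrN; congr (_ + _).
  by apply: eq_bigr => p _ /=; rewrite mulN1r mulNr.
have arc1 p : p \in c -> normc p.2 = 1.
  by move=> /carc[t _ ->]; exact: normc_circ_pt.
have off p : p \in c' -> off_holes (S j) p.2.
  rewrite in_cons => /orP[/eqP -> /=|/mapP[p' /arc1 p1 ->]]; exact: unit_off_holes.
have bnd : normc (\sum_(p <- c') p.1 * F p.2) <=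
    3 ^+ a * M * (2 * E (0, 2) + \sum_(h <- S j) h.2 * E h).
  apply: cauchy_bound => // h' h'j t t1; split.
    have hK := cheese_circle h'j t1; rewrite -hFE; last exact: cheese_off_centers.
    by apply: mode_le => // w; exact: hM.
  rewrite /c' pole_sum_cons pole_sum_scale mul1r mulN1r /=.
  exact: cE.
rewrite hFz // -(subrK (\sum_(p <- c) p.1 * F p.2) (F x)) -sumE.
rewrite (le_trans (le_normcD _ _)) // mulrDr mulrA lerD //.
rewrite (le_trans (le_normc_sum _ _ _)) // mulrA mulr_sumr.
rewrite big_seq [leRHS]big_seq; apply: ler_sum => p pc.
rewrite normcM mulrC ler_wpM2r ?normc_ge0 // -hFz ?arc1 //.
apply: mode_le => [|w hw]; first exact/cheese_unit/arc1.
by apply: he => //; have [t /Re_arc ht ->] := carc _ pc.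
Qed.

End ModeBound.

(* Every Fourier mode of [f] in the fiber over [x] vanishes. *)
Lemma fiber_uniqueness (f : C -> C -> C) (d : R) : 0 < d ->
  (forall e, 0 < e -> exists2 P, laurent S P &
     forall z w, cheese_sphere z w -> normc (f z w - P z w) <= e) ->
  (forall z w, cheese_sphere z w -> 0 <= complex.Re z -> f z w = 0) ->
  ~ (forall t, normc t = 1 -> normc (t - 1) < d -> 2^-1 <= normc (f x (2 * t))).
Proof.
have nat1 a b k : (a + b <= k + b + a)%N by lia.
have nat2 a b c k : (k < b)%N -> (a + (k + c) < (a + b + c).+1)%N by lia.
move=> d0 fapprox f0 fnz.
have x1 : normc x = 1 by exact: normc_circ_pt.
have xt t : normc t = 1 -> cheese_sphere x (2 * t).
  move=> t1; split; first exact: cheese_unit.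
  by rewrite x1 normcM t1 mulr1 normc_nat; lra.
have [c0 c00 hc0] := root_avg_norm_lower_bound d0 fnz.
have [Mf Mf1 fM] : exists2 M, 1 <= M &
    forall z w, cheese_sphere z w -> normc (f z w) <= M.
  have [P /laurent_bounded[B B0 hB] fP] := fapprox 1 ltr01.
  exists (1 + B) => [|z w hzw]; first by rewrite lerDl ltW.
  rewrite -(subrK (P z w) (f z w)) (le_trans (le_normcD _ _)) // lerD ?fP ?hB //.
have Mf0 : 0 < Mf by lra.
(* [P0] is fixed before the stage [kk] and the second accuracy [e]. Pairing with it involves only
   [m0] modes of the finer approximant [P]. *)
have [|P0 hP0 fP0] := fapprox (c0 / (4 * Mf)).
  by rewrite divr_gt0 // mulr_gt0.
have [j0 [n0 hrep0]] := laurent_poly_in_w mono hP0.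
have [m0 [h0 [_ _ rep0]]] := hrep0 _ _ (leqnn j0) (leqnn n0).
pose g k : C := h0 k x * 2 ^+ k / 2 ^+ n0.
have two0 : (2 : C) != 0 by rewrite pnatr_eq0.
have P0E t : normc t = 1 -> P0 x (2 * t) = \sum_(k < m0) g k * (t ^+ k * t ^- n0).
  move=> t1; have t0 : t != 0 by rewrite -normc_gt0 t1.
  have wt0 : 2 * t != 0 by rewrite mulf_neq0.
  have xoff : off_centers (S j0) x by apply/cheese_off_centers/cheese_unit.
  apply: (@mulfI _ ((2 * t) ^+ n0)); first by rewrite expf_neq0.
  rewrite rep0 // mulr_sumr; apply: eq_bigr => k _.
  rewrite /g !exprMn; field.
  by rewrite !expf_neq0.
(* The total weight with which bounds on modes enter the pairing: [2 ^+ k] comes from [|w| = 2], and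
   [3 ^+ n0] from [mode_bound]. *)
pose G := \sum_(k < m0) normc (g k) * 2 ^+ k * 3 ^+ n0.
have G0 : 0 <= G.
  by apply: sumr_ge0 => k _; rewrite !mulr_ge0 ?normc_ge0 ?exprn_ge0.
have D0 : 0 < 24 * (G + 1) * (Mf + 1) by rewrite !mulr_gt0 //; lra.
have [kk hkk] : exists kk, 2^-1 ^+ kk <= c0 / (24 * (G + 1) * (Mf + 1)).
  by apply: small_pow; [lra | rewrite divr_gt0].
have [_ _ /(_ kk)[c carc hc] _] := sysS.
pose L := \sum_(p <- c) normc p.1.
have L0 : 0 <= L by apply: sumr_ge0 => p _; rewrite normc_ge0.
pose B := Mf + c0 + G * L + 1.
have GL0 : 0 <= G * L by rewrite mulr_ge0.
have B0 : 0 < B by rewrite /B; lra.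
pose e := Num.min 1 (c0 / (8 * B)).
have e0 : 0 < e by rewrite lt_min ltr01 divr_gt0 // mulr_gt0.
have e1 : e <= 1 by rewrite ge_min lexx.
have eB : e * B <= c0 / 8.
  have : e <= c0 / (8 * B) by rewrite ge_min lexx orbT.
  by rewrite -(ler_pM2r B0) => h; apply: le_trans h _; rewrite invfM mulrA mulfVK ?gt_eqF.
have [P hP fP] := fapprox e e0.
have [j1 [n1 hrep]] := laurent_poly_in_w mono hP.
(* After multiplication by [w ^+ (n0 + n1)], the coefficient of index [k + n1] is the mode of [P] of
   exponent [k - n0], the one paired with [g k]. *)
pose j := maxn kk j1; pose n := (n0 + n1)%N.
have [m [h [hrat hm rep]]] := hrep j n (leq_maxr _ _) (leq_addl _ _).
have [E hE1 hE2] := hc j (leq_maxl _ _).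
have PM z w : cheese_sphere z w -> normc (P z w) <= Mf + 1.
  move=> hzw; have := le_normcB (f z w) (f z w - P z w).
  rewrite opprB addrCA subrr addr0 => /le_trans; apply.
  by rewrite lerD ?fM // (le_trans (fP _ _ hzw)).
have Pe z w : cheese_sphere z w -> 0 <= complex.Re z -> normc (P z w) <= e.
  by move=> hzw hz; have := fP _ _ hzw; rewrite f0 // sub0r normcN.
have modes k : normc (h (k + n1)%N x) <= 3 ^+ n0 * (c0 / (8 * (G + 1)) + e * L).
  have kn : (n <= k + n1 + n0)%N by exact: nat1.
  apply: le_trans (mode_bound (hrat _) hm rep kn carc hE1 PM Pe) _.
  rewrite ler_wpM2l ?exprn_ge0 // lerD2r.
  apply: (@le_trans _ _ ((Mf + 1) * (3 * (c0 / (24 * (G + 1) * (Mf + 1)))))).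
    rewrite ler_wpM2l ?addr_ge0 ?(ltW Mf0) // (le_trans hE2) // ler_wpM2l //.
  have G1 : G + 1 != 0 by rewrite gt_eqF // ltr_wpDl.
  have M1 : Mf + 1 != 0 by rewrite gt_eqF // addr_gt0.
  by rewrite [leLHS](_ : _ = c0 / (8 * (G + 1))) //; field; rewrite G1 M1.
have [u pu] := @exists_prim_root R (m + m0 + n1).+1 isT.
have xoff : off_centers (S j) x by apply/cheese_off_centers/cheese_unit.
have modeE k : (k < m0)%N ->
    root_avg (m + m0 + n1).+1 u (fun t => t ^- k * t ^+ n0 * P x (2 * t)) =
    2 ^- n * (h (k + n1)%N x * 2 ^+ (k + n1)).
  move=> km; rewrite -(@mode_extraction _ _ (fun z w => w ^+ n * P z w) m h x 2
    (k + n1) _ _ hm rep xoff two0 pu) ?nat2 //.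
  rewrite -root_avgZ; apply: (eq_root_avg pu) => t t1.
  have t0 : t != 0 by rewrite -normc_gt0 t1.
  rewrite exprMn /n [t ^+ (n0 + n1)]exprD [t ^+ (k + n1)]exprD; field.
  by rewrite !expf_neq0.
have conjP0 t : normc t = 1 ->
    conjc (P0 x (2 * t)) = \sum_(k < m0) conjc (g k) * (t ^- k * t ^+ n0).
  move=> t1; rewrite P0E // rmorph_sum; apply: eq_bigr => k _.
  transitivity (conjc (g k) * conjc (t ^+ k * t ^- n0)); first exact: rmorphM.
  by rewrite conjc_unit_ratio.
(* Parseval: on the unit circle conjugation inverts [t], so the average is a combination of modes of
   [P], all small by [modes]. *)
have avgP : normc (root_avg (m + m0 + n1).+1 u
    (fun t => P x (2 * t) * conjc (P0 x (2 * t)))) <= c0 / 8 + e * (G * L).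
  rewrite (@eq_root_avg _ _ _ pu _ (fun t => \sum_(k <- iota 0 m0)
      conjc (g k) * (t ^- k * t ^+ n0 * P x (2 * t)))) => [|t t1]; last first.
    rewrite conjP0 // -(big_mkord xpredT (fun k => conjc (g k) * (t ^- k * t ^+ n0))).
    rewrite /index_iota subn0 mulr_sumr; apply: eq_bigr => k _.
    by rewrite mulrC -!mulrA.
  rewrite root_avg_sum (le_trans (le_normc_sum _ _ _)) //.
  apply: (@le_trans _ _ (G * (c0 / (8 * (G + 1)) + e * L))); last first.
    rewrite mulrDr [e * (G * L)]mulrCA lerD2r mulrA ler_pdivrMr ?mulr_gt0 //; last by lra.
    by rewrite [leRHS](_ : _ = c0 * (G + 1)); [nra|field].
  rewrite /G mulr_suml -(big_mkord xpredT (fun k => normc (g k) * 2 ^+ k *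
    3 ^+ n0 * (c0 / (8 * (G + 1)) + e * L))).
  rewrite /index_iota subn0 big_seq [leRHS]big_seq; apply: ler_sum => k.
  rewrite mem_iota add0n => /= km; rewrite root_avgZ modeE //.
  rewrite normcM normc_conj -!mulrA ler_wpM2l ?normc_ge0 //.
  rewrite normcM normcV normcM !normcX normc_nat.
  apply: (@le_trans _ _ (2 ^+ k * normc (h (k + n1)%N x))).
    rewrite /n !exprD.
    rewrite [leLHS](_ : _ = 2 ^+ k * normc (h (k + n1)%N x) * (2 ^+ n0)^-1).
      by rewrite ler_piMr ?mulr_ge0 ?exprn_ge0 ?normc_ge0 // invf_le1
        ?exprn_gt0 // exprn_ege1 // ler1n.
    by field; rewrite !expf_neq0 // pnatr_eq0.
  by rewrite ler_wpM2l ?exprn_ge0 // modes.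
have c4 : c0 / (4 * Mf) <= c0.
  by rewrite ler_pdivrMr ?mulr_gt0 // ler_peMr ?(ltW c00) //; lra.
have P0M t : normc t = 1 -> normc (P0 x (2 * t)) <= Mf + c0.
  move=> t1; have := le_normcB (f x (2 * t)) (f x (2 * t) - P0 x (2 * t)).
  rewrite opprB addrCA subrr addr0 => /le_trans; apply.
  by apply: lerD; [exact/fM/xt|apply: le_trans c4; exact/fP0/xt].
have := hc0 _ _ pu; rewrite leNgt => /negP; apply.
(* The square of the modulus of [f] splits into [P * conj P0] and two errors. In total this is at
   most [c0 / 8 + e * B + c0 / 4], hence at most [c0 / 2], against the lower bound [c0]. *)
rewrite (@eq_root_avg _ _ _ pu _ (fun t => P x (2 * t) * conjc (P0 x (2 * t)) +
    ((f x (2 * t) - P x (2 * t)) * conjc (P0 x (2 * t)) +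
     f x (2 * t) * conjc (f x (2 * t) - P0 x (2 * t))))) => [|t _]; last first.
  by rewrite rmorphB; ring.
rewrite !root_avgD; apply: le_lt_trans (le_normcD _ _) _.
have h2 : normc (root_avg (m + m0 + n1).+1 u
    (fun t => (f x (2 * t) - P x (2 * t)) * conjc (P0 x (2 * t)))) <= e * (Mf + c0).
  apply: (le_normc_root_avg pu) => t t1; rewrite normcM normc_conj.
  by apply: ler_pM; rewrite ?normc_ge0 //; [exact/fP/xt|exact: P0M].
have h3 : normc (root_avg (m + m0 + n1).+1 u
    (fun t => f x (2 * t) * conjc (f x (2 * t) - P0 x (2 * t)))) <= Mf * (c0 / (4 * Mf)).
  apply: (le_normc_root_avg pu) => t t1; rewrite normcM normc_conj.
  by apply: ler_pM; rewrite ?normc_ge0 //; [exact/fM/xt|exact/fP0/xt].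
have e3 : Mf * (c0 / (4 * Mf)) = c0 / 4 by field; rewrite gt_eqF.
apply: le_lt_trans (lerD (lexx _) (le_normcD _ _)) _.
move: avgP h2 h3 eB; rewrite e3 /B mulrDr !mulrDr => *.
lra.
Qed.

End CheeseSphere.

(** * Continuity and uniform closure in terms of distances *)

Section MetricContinuity.
Variables (R : realType) (T : metricType R).
Implicit Types p q : T.

Lemma nbhs_mdistP p (A : set T) :
  nbhs p A <-> exists2 d, 0 < d & forall q, mdist p q < d -> A q.
Proof.
split=> [/nbhs_ballP[d /= d0 dA]|[d d0 dA]].
  by exists d => // q pq; apply: dA; rewrite ballEmdist.
by apply/nbhs_ballP; exists d => //= q; rewrite ballEmdist => /dA.
Qed.

Lemma continuous_mdistP (f : T -> Cplx R) : continuous f <->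
  forall p e, 0 < e -> exists2 d, 0 < d &
    forall q, mdist p q < d -> normc (f p - f q) <= e.
Proof.
split=> [fc p e e0|hf p].
  have /cvgrPdist_le := fc p => /(_ e%:C); rewrite ltcR => /(_ e0).
  move=> /nbhs_mdistP[d d0 dP]; exists d => // q /dP.
  by rewrite normrc lecR.
(* A positive element of [R[i]] has imaginary part [0], so real radii suffice. *)
apply/cvgrPdist_le => e; rewrite ltcE => /= /andP[/eqP e1 e0].
have [d d0 dP] := hf p _ e0; apply/nbhs_mdistP; exists d => // q /dP h.
by rewrite normrc lecE /= e1 eqxx.
Qed.

Lemma uniform_limit_continuous (f : T -> Cplx R) :
  (forall e, 0 < e -> exists2 g : T -> Cplx R, continuous g &
     forall p, normc (f p - g p) <= e) -> continuous f.
Proof.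
move=> hf; apply/continuous_mdistP => p e e0.
have [|g /continuous_mdistP gc fg] := hf (e / 3); first by rewrite divr_gt0.
have [|d d0 hd] := gc p (e / 3); first by rewrite divr_gt0.
exists d => // q pq.
have -> : f p - f q = (f p - g p) + ((g p - g q) + (g q - f q)) by ring.
apply: le_trans (le_normcD _ _) _.
apply: le_trans (lerD (lexx _) (le_normcD _ _)) _.
have := fg p; have := fg q; have := hd q pq; rewrite [normc (g q - f q)]normcBC; lra.
Qed.

Lemma uniform_closedP (A : set (T -> Cplx R)) :
  (forall f, (forall e, 0 < e -> exists2 g, A g & forall p, normc (f p - g p) <= e) ->
     A f) ->
  closed (A : set {uniform T -> Cplx R}).
Proof.
move=> hA f clf; apply: hA => e e0.
have eC : 0 < e%:C :> R[i] by rewrite ltcR.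
have /clf[g [Ag fg]] : nbhs (f : {uniform T -> Cplx R})
    [set g | forall p, normc (f p - g p) <= e].
  apply/uniform_nbhs; exists [set xy : Cplx R * Cplx R | ball xy.1 e%:C xy.2].
  split; first exact: entourage_ball (PosNum eC).
  move=> g /= fg p; have := fg p I; rewrite -ball_normE /= normrc ltcR.
  exact: ltW.
by exists g.
Qed.

End MetricContinuity.

(** * The compact metric space *)

Section CheeseSpace.
Variable R : realType.
Local Notation C := R[i].
Variable S : nat -> seq (C * R).

(** The boolean predicate makes this a subtype, which inherits its choice structure; the metric is
    put on it separately. *)
Definition cheese_space := {p : C * C | `[< cheese_sphere S p.1 p.2 >]}.

HB.instance Definition _ := [Choice of cheese_space by <:].

Implicit Types p q : cheese_space.

Definition zcoord p : C := (val p).1.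
Definition wcoord p : C := (val p).2.

Definition cheese_dist p q : R :=
  normc (zcoord p - zcoord q) + normc (wcoord p - wcoord q).

Lemma cheese_distxx p : cheese_dist p p = 0.
Proof. by rewrite /cheese_dist !subrr normc0 addr0. Qed.

Lemma cheese_dist_eq0 p q : cheese_dist p q = 0 -> p = q.
Proof.
move/eqP; rewrite paddr_eq0 ?normc_ge0 // !normc_eq0 !subr_eq0.
move=> /andP[/eqP e1 /eqP e2]; apply: val_inj.
rewrite [val p]surjective_pairing [val q]surjective_pairing.
by congr pair; [exact: e1|exact: e2].
Qed.

Lemma cheese_distC p q : cheese_dist p q = cheese_dist q p.
Proof. by rewrite /cheese_dist normcBC [X in _ + X]normcBC. Qed.

Lemma cheese_dist_triangle q p r : cheese_dist p r <= cheese_dist p q + cheese_dist q r.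
Proof.
have tri (a b c : C) : normc (a - c) <= normc (a - b) + normc (b - c).
  by have := le_normcD (a - b) (b - c); rewrite addrA subrK.
by rewrite /cheese_dist addrACA lerD ?tri.
Qed.

HB.instance Definition _ := @isMetric.Build R cheese_space cheese_dist
  cheese_distxx cheese_dist_eq0 cheese_distC cheese_dist_triangle.

Lemma coordP p : cheese_sphere S (zcoord p) (wcoord p).
Proof. by have /asboolP := valP p. Qed.

Lemma cheese_point z w : cheese_sphere S z w ->
  exists2 p, zcoord p = z & wcoord p = w.
Proof.
move=> h; have hb : `[< cheese_sphere S (z, w).1 (z, w).2 >] by apply/asboolP.
by exists (exist _ (z, w) hb).
Qed.

Let box : set ((R * R) * (R * R)) :=
  (`[(-3), 3] `*` `[(-3), 3]) `*` (`[(-3), 3] `*` `[(-3), 3]).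

Let coords p : (R * R) * (R * R) :=
  ((complex.Re (zcoord p), complex.Im (zcoord p)),
   (complex.Re (wcoord p), complex.Im (wcoord p))).

Lemma cheese_sphere_closed z w :
  (forall e, 0 < e -> exists2 p, normc (z - zcoord p) < e & normc (w - wcoord p) < e) ->
  cheese_sphere S z w.
Proof.
move=> h.
have zK : cheese S z.
  move=> k; split=> [|c ck].
    apply/ler_addgt0Pl => e /h[p pz _]; have [/(_ k)[p2 _] _] := coordP p.
    have := le_normc_dist z (zcoord p); lra.
  apply/ler_addgt0Pl => e /h[p pz _]; have [/(_ k)[_ /(_ _ ck) pc] _] := coordP p.
  have := le_normcD (z - c.1) (zcoord p - z); rewrite [_ + (zcoord p - z)]addrC addrA subrK.
  rewrite [normc (zcoord p - z)]normcBC; lra.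
split=> //; apply/eqP; rewrite -subr_eq0 -normr_eq0 eq_le normr_ge0 andbT.
apply/ler_addgt0Pl => e e0; rewrite addr0.
(* [16] exceeds twice the constant [7] of [sq], where [a + b <= (3 + 1) + 3]. *)
have d0 : 0 < Num.min 1 (e / 16) by rewrite lt_min ltr01 divr_gt0.
have [p pz pw] := h _ d0; have [_ pe] := coordP p.
have pz' := coordP p.
move: pz pw; rewrite !lt_min => /andP[pz1 pze] /andP[pw1 pwe].
have z0 := normc_ge0 z; have w0 := normc_ge0 w.
have a0 := normc_ge0 (zcoord p); have b0 := normc_ge0 (wcoord p).
have a3 : normc (zcoord p) <= 3.
  by rewrite -ler_sqr ?nnegrE //; have := sqr_ge0 (normc (wcoord p)); lra.
have b3 : normc (wcoord p) <= 3.
  by rewrite -ler_sqr ?nnegrE //; have := sqr_ge0 (normc (zcoord p)); lra.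
have sq (a b d : R) : 0 <= a -> 0 <= b -> b <= 3 -> `|a - b| <= d -> d <= 1 ->
    `|a ^+ 2 - b ^+ 2| <= 7 * d.
  move=> ha hb hb3 hd hd1; rewrite subr_sqr normrM mulrC.
  have : `|a + b| <= 7 by rewrite ger0_norm ?addr_ge0 //; move: hd; rewrite ler_norml; lra.
  by move=> h7; rewrite ler_pM.
have dist (a b : C) : `|normc a - normc b| <= normc (a - b).
  by rewrite ler_norml le_normc_dist lerNl opprB (normcBC a) le_normc_dist.
have s1 := sq _ _ _ z0 a0 a3 (dist z (zcoord p)) (ltW pz1).
have s2 := sq _ _ _ w0 b0 b3 (dist w (wcoord p)) (ltW pw1).
have -> : normc z ^+ 2 + normc w ^+ 2 - 5 =
  (normc z ^+ 2 - normc (zcoord p) ^+ 2) + (normc w ^+ 2 - normc (wcoord p) ^+ 2).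
  by rewrite -pe; ring.
apply: le_trans (ler_normD _ _) _; lra.
Qed.

(** Real coordinates push a filter into [[-3, 3]^4], which is compact as a product of segments. A
    cluster point there lies on the sphere by closedness, and the coordinates control
    [cheese_dist]. *)
Lemma cheese_space_compact : compact [set: cheese_space].
Proof.
move=> F PF _.
have cbox : compact box by do ![apply: compact_setX | exact: segment_compact].
have Fbox : (coords @ F) box.
  have all_box p : box (coords p).
    have [_ pe] := coordP p.
    have z3 : `|complex.Re (zcoord p)| <= 3 /\ `|complex.Im (zcoord p)| <= 3.
      rewrite -!(@ler_sqr _ `|_|) ?nnegrE // !real_normK ?num_real //.
      have := sqr_normcE (zcoord p); have := sqr_ge0 (normc (wcoord p)).
      by have := sqr_ge0 (complex.Re (zcoord p)); have := sqr_ge0 (complex.Im (zcoord p)); lra.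
    have w3 : `|complex.Re (wcoord p)| <= 3 /\ `|complex.Im (wcoord p)| <= 3.
      rewrite -!(@ler_sqr _ `|_|) ?nnegrE // !real_normK ?num_real //.
      have := sqr_normcE (wcoord p); have := sqr_ge0 (normc (zcoord p)).
      by have := sqr_ge0 (complex.Re (wcoord p)); have := sqr_ge0 (complex.Im (wcoord p)); lra.
    by case: z3 w3 => h1 h2 [h3 h4]; split; split; rewrite /= in_itv /= -ler_norml.
  have -> : (coords @ F) box = F setT.
    by congr (F _); apply/seteqP; split=> // p _; exact: all_box.
  exact: filterT.
have [[[a b] [c d]] [_ cl]] := cbox _ _ Fbox.
have close e : 0 < e -> forall B, F B -> exists2 p, B p &
    normc ((a +i* b) - zcoord p) < e /\ normc ((c +i* d) - wcoord p) < e.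
  move=> e0 B FB; have e20 : 0 < e / 2 by rewrite divr_gt0.
  have FB' : (coords @ F) (coords @` B).
    by apply: (@filterS _ F _ B (coords @^-1` (coords @` B))) FB => p Bp; exists p.
  have [_ [[p Bp <-] [[/= h1 h2] [/= h3 h4]]]] :=
    cl _ _ FB' (nbhsx_ballx ((a, b), (c, d)) _ e20).
  exists p => //.
  move: h1 h2 h3 h4; rewrite /ball /= => h1 h2 h3 h4.
  split; apply: le_lt_trans (le_normc_ReIm _) _; rewrite !raddfB /=; lra.
have [p pz pw] : exists2 p, zcoord p = a +i* b & wcoord p = c +i* d.
  apply: cheese_point; apply: cheese_sphere_closed => e e0.
  by have [p _ []] := close _ e0 _ (filterT : F setT); exists p.
exists p; split=> // B V FB /nbhs_mdistP[e e0 eV].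
have e20 : 0 < e / 2 by rewrite divr_gt0.
have [q Bq [h1 h2]] := close _ e20 _ FB; exists q; split=> //.
by apply: eV; rewrite /mdist /= /cheese_dist pz pw; lra.
Qed.

End CheeseSpace.

(** * The uniform algebra, its peak points and its failure to be regular *)

Section CheeseAlgebra.
Variable R : realType.
Local Notation C := R[i].
Variable S : nat -> seq (C * R).
Hypothesis sysS : hole_system S.
Local Notation X := (cheese_space S).
Implicit Types (p q : X) (f g : X -> Cplx R).

Let mono k j : (k <= j)%N -> {subset S k <= S j}.
Proof. by have [_ + _ _] := sysS; exact. Qed.

Definition laurent_fun (P : C -> C -> C) : X -> Cplx R :=
  fun p => P (zcoord p) (wcoord p).

Definition cheese_algebra : set (X -> Cplx R) := [set f | forall e : R, 0 < e ->
  exists2 P, laurent S P & forall p, normc (f p - laurent_fun P p) <= e].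

Local Notation A := cheese_algebra.

Lemma algebra_laurent P : laurent S P -> A (laurent_fun P).
Proof. by move=> hP e e0; exists P => // p; rewrite subrr normc0 ltW. Qed.

Lemma algebra_lim f :
  (forall e, 0 < e -> exists2 g, A g & forall p, normc (f p - g p) <= e) -> A f.
Proof.
move=> hf e e0; have e20 : 0 < e / 2 by rewrite divr_gt0.
have [g /(_ _ e20)[P hP gP] fg] := hf _ e20; exists P => // p.
by rewrite -(subrKA (g p)) (le_trans (le_normcD _ _)) // (splitr e) lerD.
Qed.

Lemma algebra_bounded f : A f -> exists2 B, 0 < B & forall p, normc (f p) <= B.
Proof.
move=> /(_ 1 ltr01)[P hP fP]; have [B B0 hB] := laurent_bounded sysS hP.
exists (1 + B) => [|p]; first by rewrite addr_gt0.
rewrite -(subrK (laurent_fun P p) (f p)) (le_trans (le_normcD _ _)) //.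
by rewrite lerD ?fP // hB //; exact: coordP.
Qed.

Lemma algebra_cst a : A (fun=> a).
Proof. exact: (algebra_laurent (laurent_cst S a)). Qed.

Lemma algebraD f g : A f -> A g -> A (fun p => f p + g p).
Proof.
move=> hf hg e e0; have e20 : 0 < e / 2 by rewrite divr_gt0.
have [P hP fP] := hf _ e20; have [Q hQ gQ] := hg _ e20.
exists (fun z w => P z w + Q z w) => [|p]; first exact: laurentD.
rewrite /laurent_fun opprD addrACA (le_trans (le_normcD _ _)) // (splitr e).
by rewrite lerD ?fP ?gQ.
Qed.

Lemma algebraM f g : A f -> A g -> A (fun p => f p * g p).
Proof.
move=> hf hg e e0; have [B B0 gB] := algebra_bounded hg.
have [|P hP fP] := hf (e / 2 / B); first by rewrite !divr_gt0.
have [B' B'0 PB'] := laurent_bounded sysS hP.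
have [|Q hQ gQ] := hg (e / 2 / B'); first by rewrite !divr_gt0.
exists (fun z w => P z w * Q z w) => [|p]; first exact: laurentM.
have -> : f p * g p - laurent_fun (fun z w => P z w * Q z w) p =
    (f p - laurent_fun P p) * g p + laurent_fun P p * (g p - laurent_fun Q p).
  by rewrite /laurent_fun; ring.
rewrite (le_trans (le_normcD _ _)) // !normcM [leRHS](splitr e) lerD //.
  rewrite -[leRHS](mulfVK (lt0r_neq0 B0)).
  by rewrite ler_pM ?normc_ge0 ?fP ?gB.
rewrite -[leRHS](mulfVK (lt0r_neq0 B'0)) mulrC.
by rewrite ler_pM ?normc_ge0 ?gQ // PB' //; exact: coordP.
Qed.

Lemma algebraZ a f : A f -> A (fun p => a * f p).
Proof. by move=> hf; apply: algebraM => //; exact: algebra_cst. Qed.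

Lemma algebraX f n : A f -> A (fun p => f p ^+ n).
Proof.
move=> hf; elim: n => [|n IH]; first exact: algebra_cst.
have -> : (fun p => f p ^+ n.+1) = (fun p => f p * f p ^+ n).
  by apply/funext => p; rewrite exprS.
exact: algebraM.
Qed.

Lemma algebra_sum n (F : nat -> X -> Cplx R) : (forall k, A (F k)) ->
  A (fun p => \sum_(k < n) F k p).
Proof.
move=> hF; elim: n => [|n IH].
  have -> : (fun p => \sum_(k < 0) F k p) = (fun=> 0).
    by apply/funext => p; rewrite big_ord0.
  exact: algebra_cst.
have -> : (fun p => \sum_(k < n.+1) F k p) = (fun p => \sum_(k < n) F k p + F n p).
  by apply/funext => p; rewrite big_ord_recr.
exact: algebraD.
Qed.

Lemma algebra_z : A (@zcoord R S).
Proof. exact: (algebra_laurent (laurent_z S)). Qed.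

Lemma algebra_w : A (@wcoord R S).
Proof. exact: (algebra_laurent (laurent_w S)). Qed.

Lemma algebra_wV : A (fun p => (wcoord p)^-1).
Proof. exact: (algebra_laurent (laurent_wV S)). Qed.

Lemma algebra_geometric f (th : R) : A f -> th < 1 ->
  (forall p, normc (f p) <= th) -> A (fun p => (1 - f p)^-1).
Proof.
move=> hf th1 fth; apply: algebra_lim => e e0.
(* A point of [X] is what shows [0 <= th]. *)
have [[p0]|nop] := pselect (inhabited X); last first.
  by exists (fun=> 0) => [|p]; [exact: algebra_cst | case: nop].
have th0 : 0 <= th by exact: le_trans (normc_ge0 _) (fth p0).
have th10 : 0 < 1 - th by rewrite subr_gt0.
have [||n hn] := @small_pow R th (e * (1 - th)).
- by rewrite th0.
- by rewrite mulr_gt0.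
exists (fun p => \sum_(k < n) f p ^+ k) => [|p].
  by apply: (@algebra_sum n (fun k p => f p ^+ k)) => k; exact: algebraX.
have d1 : 1 - th <= normc (1 - f p).
  by have := le_normc_dist 1 (f p); rewrite normc1; have := fth p; lra.
have nz : 1 - f p != 0 by rewrite -normc_gt0 (lt_le_trans th10).
have -> : (1 - f p)^-1 - \sum_(k < n) f p ^+ k = f p ^+ n / (1 - f p).
  apply: (mulIf nz); rewrite mulrBl mulVf // mulfVK //.
  have := subrX1 (f p) n; set s := \sum_(_ < _) _ => hs.
  have -> : s * (1 - f p) = - ((f p - 1) * s) by ring.
  by rewrite -hs opprK addrCA subrr addr0.
rewrite normc_div ler_pdivrMr ?normc_gt0 // normcX.
apply: (@le_trans _ _ (th ^+ n)); first by rewrite lerXn2r ?nnegrE ?normc_ge0.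
by rewrite (le_trans hn) // ler_wpM2l // ltW.
Qed.

Lemma algebra_pole k (h : C * R) : h \in S k -> A (fun p => (zcoord p - h.1)^-1).
Proof. by move=> hk; exact: (algebra_laurent (laurent_pole hk)). Qed.

Lemma hole_le_dist k (h : C * R) p : h \in S k -> h.2 <= normc (zcoord p - h.1).
Proof. by move=> hk; have [/(_ k)[_ ] + _] := coordP p; exact. Qed.

(** A pole can be moved inside its hole: [1 / (z - c)] is a geometric series in
    [(c - h.1) / (z - h.1)]. This covers the roots that lie in older holes. *)
Lemma algebra_pole_in_hole k (h : C * R) (c : C) : h \in S k ->
  normc (c - h.1) < h.2 -> A (fun p => (zcoord p - c)^-1).
Proof.
move=> hk ch; have h0 := hole_gt0 sysS hk.
have -> : (fun p : X => (zcoord p - c)^-1) = (fun p => (zcoord p - h.1)^-1 *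
    (1 - (c - h.1) * (zcoord p - h.1)^-1)^-1).
  apply/funext => p; have hp := hole_le_dist p hk.
  have zh : zcoord p - h.1 != 0 by rewrite -normc_gt0 (lt_le_trans h0).
  by rewrite -invfM mulrBr mulr1 mulrCA divff // mulr1 opprB addrA subrK.
apply: algebraM; first exact: algebra_pole hk.
apply: (@algebra_geometric _ (normc (c - h.1) / h.2)).
- by apply: algebraZ; exact: algebra_pole hk.
- by rewrite ltr_pdivrMr // mul1r.
move=> p; have hp := hole_le_dist p hk.
rewrite normc_div ler_wpM2l ?normc_ge0 // lef_pV2 ?posrE //.
exact: lt_le_trans hp.
Qed.

Lemma continuous_laurent P : laurent S P -> continuous (laurent_fun P).
Proof.
move=> hP; apply/continuous_mdistP; elim: hP => {P} [a||||j h hj|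
  P Q _ IH1 _ IH2|P Q hP IH1 hQ IH2] p e e0.
- by exists 1 => // q _; rewrite subrr normc0 ltW.
- exists e => // q /ltW; apply: le_trans; rewrite /mdist /= /cheese_dist.
  by rewrite lerDl normc_ge0.
- exists e => // q /ltW; apply: le_trans; rewrite /mdist /= /cheese_dist.
  by rewrite lerDr normc_ge0.
- exists e => // q /ltW; apply: le_trans; rewrite /mdist /= /cheese_dist.
  have wp := fiber_neq0 sysS (coordP p); have wq := fiber_neq0 sysS (coordP q).
  have /andP[p1 _] := fiber_norm sysS (coordP p).
  have /andP[q1 _] := fiber_norm sysS (coordP q).
  have -> : laurent_fun (fun=> GRing.inv) p - laurent_fun (fun=> GRing.inv) q =
    (wcoord q - wcoord p) / (wcoord p * wcoord q).
    by rewrite /laurent_fun; field; rewrite wp wq.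
  rewrite normc_div normcM normcBC ler_wpDl ?normc_ge0 // ler_pdivrMr; last first.
    by rewrite mulr_gt0 // (lt_le_trans ltr01).
  by rewrite ler_peMr ?normc_ge0 // -[leLHS]mulr1 ler_pM.
- have h0 := hole_gt0 sysS hj.
  have d0 : 0 < e * (h.2 * h.2) by rewrite !mulr_gt0.
  exists (e * (h.2 * h.2)) => // q; rewrite /mdist /= /cheese_dist => pq.
  have zp := hole_le_dist p hj; have zq := hole_le_dist q hj.
  have zp0 : zcoord p - h.1 != 0 by rewrite -normc_gt0 (lt_le_trans h0).
  have zq0 : zcoord q - h.1 != 0 by rewrite -normc_gt0 (lt_le_trans h0).
  have -> : laurent_fun (fun z _ => (z - h.1)^-1) p -
      laurent_fun (fun z _ => (z - h.1)^-1) q =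
    (zcoord q - zcoord p) / ((zcoord p - h.1) * (zcoord q - h.1)).
    by rewrite /laurent_fun; field; rewrite zp0 zq0.
  rewrite normc_div normcM normcBC ler_pdivrMr ?mulr_gt0 ?normc_gt0 //.
  have : e * (h.2 * h.2) <= e * (normc (zcoord p - h.1) * normc (zcoord q - h.1)).
    by rewrite ler_wpM2l ?(ltW e0) // ler_pM ?(ltW h0).
  have := normc_ge0 (wcoord p - wcoord q); lra.
- have e20 : 0 < e / 2 by rewrite divr_gt0.
  have [d1 d10 h1] := IH1 p _ e20; have [d2 d20 h2] := IH2 p _ e20.
  exists (Num.min d1 d2) => [|q]; first by rewrite lt_min d10.
  rewrite lt_min => /andP[/h1 {}h1 /h2 {}h2].
  rewrite /laurent_fun opprD addrACA (le_trans (le_normcD _ _)) // (splitr e).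
  exact: lerD.
have [B B0 hB] := laurent_bounded sysS hP; have [B' B'0 hB'] := laurent_bounded sysS hQ.
have [|d1 d10 h1] := IH1 p (e / 2 / B'); first by rewrite !divr_gt0.
have [|d2 d20 h2] := IH2 p (e / 2 / B); first by rewrite !divr_gt0.
exists (Num.min d1 d2) => [|q]; first by rewrite lt_min d10.
rewrite lt_min => /andP[/h1 {}h1 /h2 {}h2].
have -> : laurent_fun (fun z w => P z w * Q z w) p -
    laurent_fun (fun z w => P z w * Q z w) q =
  (laurent_fun P p - laurent_fun P q) * laurent_fun Q p +
  laurent_fun P q * (laurent_fun Q p - laurent_fun Q q).
  by rewrite /laurent_fun; ring.
rewrite (le_trans (le_normcD _ _)) // !normcM [leRHS](splitr e) lerD //.
  rewrite -[leRHS](mulfVK (lt0r_neq0 B'0)).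
  by rewrite ler_pM ?normc_ge0 //; apply: hB'; exact: coordP.
rewrite -[leRHS](mulfVK (lt0r_neq0 B0)) mulrC.
by rewrite ler_pM ?normc_ge0 //; apply: hB; exact: coordP.
Qed.

Lemma continuous_algebra f : A f -> continuous f.
Proof.
move=> hf; apply: uniform_limit_continuous => e /hf[P hP fP].
by exists (laurent_fun P) => //; exact: continuous_laurent.
Qed.

Lemma cheese_uniform_algebra : uniform_algebra A.
Proof.
split.
- exact: cheese_space_compact.
- exact: metric_hausdorff.
- exact: continuous_algebra.
- exact: algebra_cst.
- exact: algebraD.
- by move=> a f; exact: algebraZ.
- exact: algebraM.
- move=> p q pq; have [zz|zz] := eqVneq (zcoord p) (zcoord q).
    exists (@wcoord R S); first exact: algebra_w.
    move=> ww; apply: pq; apply: val_inj.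
    by rewrite [val p]surjective_pairing [val q]surjective_pairing; congr pair.
  by exists (@zcoord R S); [exact: algebra_z|exact/eqP].
- by apply: uniform_closedP => f; exact: algebra_lim.
Qed.

(** For [q] on the same sphere the inner product [s] of [q] and [p] satisfies
    [2 Re s = 10 - |q - p|^2]. So [Re s < 5] for [q <> p], and with [|s| <= 5] this gives
    [|5 + s| < 10]. *)
Lemma cheese_peak_point p : peak_point A p.
Proof.
pose a := zcoord p; pose b := wcoord p.
exists (fun q => 10%:R^-1 * (5 + (zcoord q * conjc a + wcoord q * conjc b))); split.
- apply: algebraZ; apply: algebraD; first exact: algebra_cst.
  apply: algebraD.
    by apply: algebraM; [exact: algebra_z|exact: algebra_cst].
  by apply: algebraM; [exact: algebra_w|exact: algebra_cst].
- have [_ pe] := coordP p; rewrite -/a -/b in pe *.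
  rewrite !mulc_conj -rmorphD /= pe.
  rewrite -[5 + _]/((5%:R : C) + 5%:C) -(rmorph_nat (real_complex R) 5) -rmorphD.
  rewrite -(rmorph_nat (real_complex R) 10) -fmorphV -rmorphM /=.
  by congr (_%:C); field.
move=> q qp; rewrite normrc ltcR normcM normcV normc_nat.
have [_ pe] := coordP p; have [_ qe] := coordP q.
set s := _ + _ * conjc b.
have ne : 0 < normc (zcoord q - a) ^+ 2 + normc (wcoord q - b) ^+ 2.
  rewrite lt_def addr_ge0 ?sqr_ge0 // andbT paddr_eq0 ?sqr_ge0 //.
  rewrite !sqrf_eq0 !normc_eq0 !subr_eq0; apply/negP => /andP[/eqP e1 /eqP e2].
  apply: qp; apply: val_inj.
  by rewrite [val p]surjective_pairing [val q]surjective_pairing; congr pair.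
have Res : complex.Re s < 5.
  have conjN (u : C) : conjc (- u) = - conjc u by exact: rmorphN.
  move: ne; rewrite !sqr_normcD !conjN !mulrN !normcN !raddfN /= /s raddfD /=.
  rewrite /a /b; lra.
have ns : normc s <= 5.
  apply: le_trans (le_normcD _ _) _; rewrite !normcM !normc_conj.
  (* Twice a product is at most the sum of the squares; over both coordinates these squares add up
     to [10]. *)
  have := sqr_ge0 (normc (zcoord q) - normc a).
  have := sqr_ge0 (normc (wcoord q) - normc b).
  by rewrite !sqrrB /a /b; lra.
have : normc (5 + s) ^+ 2 < 10 ^+ 2.
  rewrite sqr_normcD normc_nat.
  have : normc s ^+ 2 <= 5 ^+ 2 by rewrite lerXn2r ?nnegrE ?normc_ge0.
  have -> : complex.Re (5 * conjc s) = 5 * complex.Re s.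
    by case: (s) => u v; rewrite -(rmorph_nat (real_complex R)) /=; ring.
  lra.
rewrite ltr_sqr ?nnegrE ?normc_ge0 // => h.
by rewrite mulrC ltr_pdivrMr // mul1r.
Qed.

Lemma cheese_not_regular : ~ regular_algebra A.
Proof.
move=> reg; pose x : C := circ_pt 2.
have x1 : normc x = 1 by exact: normc_circ_pt.
have xt (t : C) : normc t = 1 -> cheese_sphere S x (2 * t).
  move=> t1; split; first exact: cheese_unit.
  by rewrite x1 normcM t1 mulr1 normc_nat; lra.
have [p pz pw] : exists2 p : X, zcoord p = x & wcoord p = 2.
  by apply: cheese_point; rewrite -[2]mulr1; apply: xt; exact: normc1.
pose E : set X := [set q | 0 <= complex.Re (zcoord q)].
have clE : closed E.
  move=> q clq; rewrite /E /= leNgt; apply/negP => q0.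
  have : nbhs q [set r | complex.Re (zcoord r) < 0].
    apply/nbhs_mdistP; exists (- complex.Re (zcoord q)); first by rewrite oppr_gt0.
    move=> r qr /=; have := le_Re_normc (zcoord r - zcoord q).
    move: qr; rewrite /mdist /= /cheese_dist raddfB /= normcBC.
    have := normc_ge0 (wcoord q - wcoord r); lra.
  by move=> /clq[r [/= r1 r2]]; rewrite ltNge r1 in r2.
have nEp : ~ E p.
  rewrite /E /= pz Re_circ_pt; apply/negP; rewrite -ltNge.
  by rewrite ltr_pdivrMr ?mul0r; lra.
have [f [Af fp fE]] := reg E p clE nEp.
(* [fiber_uniqueness] speaks of functions of two complex variables; [f] is extended by [0] off the
   sphere. *)
have [F hF] : exists F : C -> C -> C, forall q, F (zcoord q) (wcoord q) = f q.
  exists (fun z w => if pselect (exists q : X, zcoord q = z /\ wcoord q = w) is left h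
    then f (projT1 (cid h)) else 0).
  move=> q; case: pselect => [h|[]]; last by exists q.
  case: cid => r /= [e1 e2]; congr f; apply: val_inj.
  by rewrite [val r]surjective_pairing [val q]surjective_pairing; congr pair.
have onX z w : cheese_sphere S z w -> exists2 q : X, zcoord q = z & wcoord q = w.
  exact: cheese_point.
have /continuous_mdistP/(_ p 2^-1)[|d d0 hd] := continuous_algebra Af.
  by rewrite invr_gt0.
(* Rotation by [t] moves the coordinate [w = 2] of [p] by [2 |t - 1|], whence [d / 2]. *)
apply: (@fiber_uniqueness R S sysS F (d / 2)).
- by rewrite divr_gt0.
- move=> e /Af[P hP fP]; exists P => // z w /onX[q <- <-].
  by rewrite hF; exact: fP.
- by move=> z w /onX[q <- <-] hq; rewrite hF; exact: fE.
move=> t t1 td; have [q qz qw] := onX _ _ (xt t t1).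
rewrite -/x -qz -qw hF; have /hd : mdist p q < d.
  rewrite /mdist /= /cheese_dist pz pw qz qw subrr normc0 add0r.
  have -> : 2 - 2 * t = 2 * (1 - t) by ring.
  by rewrite normcM normc_nat normcBC; lra.
by rewrite fp; have := le_normc_dist 1 (f q); rewrite normc1; lra.
Qed.

End CheeseAlgebra.

(** * Characters are evaluations *)

Section Characters.
Variable R : realType.
Local Notation C := R[i].
Variable S : nat -> seq (C * R).
Hypothesis sysS : hole_system S.
Local Notation X := (cheese_space S).
Local Notation A := (cheese_algebra (S := S)).
Implicit Types (p q : X) (f g : X -> Cplx R).

Variable phi : (X -> Cplx R) -> Cplx R.
Hypothesis chi : character A phi.

Let le_expr (n : nat) (x y : R) : 0 <= x -> x <= y -> x ^+ n <= y ^+ n.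
Proof. by move=> x0 xy; rewrite lerXn2r ?nnegrE // (le_trans x0). Qed.

Lemma phiD f g : A f -> A g -> phi (fun p => f p + g p) = phi f + phi g.
Proof. exact: (char_add chi). Qed.

Lemma phiM f g : A f -> A g -> phi (fun p => f p * g p) = phi f * phi g.
Proof. exact: (char_mul chi). Qed.

Lemma phiZ (a : C) f : A f -> phi (fun p => a * f p) = a * phi f.
Proof. exact: (char_scale chi). Qed.

Lemma phi1 : phi (fun=> 1) = 1.
Proof.
have [f Af /eqP f0] := char_neq0 chi.
apply: (mulfI f0); rewrite mulr1 -phiM //; last exact: algebra_cst.
by congr phi; apply/funext => p; rewrite mulr1.
Qed.

Lemma phi_cst (a : C) : phi (fun=> a) = a.
Proof.
rewrite -[RHS]mulr1 -phi1 -phiZ; last exact: algebra_cst.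
by congr phi; apply/funext => p; rewrite mulr1.
Qed.

Lemma phiX f n : A f -> phi (fun p => f p ^+ n) = phi f ^+ n.
Proof.
move=> Af; elim: n => [|n IH]; first by rewrite expr0 phi_cst.
rewrite exprS -IH -phiM //; last exact: algebraX.
by congr phi; apply/funext => p; rewrite exprS.
Qed.

(** A geometric series inverts [1 - f] in [A], and a character does not vanish on an invertible
    element. *)
Lemma phi_neq1 f (th : R) : A f -> th < 1 -> (forall p, normc (f p) <= th) -> phi f <> 1.
Proof.
move=> Af th1 fth f1; have Ag := algebra_geometric sysS Af th1 fth.
have A1f : A (fun p => 1 + -1 * f p).
  by apply: algebraD; [exact: algebra_cst|exact: algebraZ].
have := phiM A1f Ag.
rewrite phiD ?phiZ ?phi1 //; [|exact: algebra_cst|exact: algebraZ].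
rewrite f1 mulr1 subrr mul0r.
have -> : (fun p => (1 + -1 * f p) * (1 - f p)^-1) = (fun=> 1).
  apply/funext => p; rewrite mulN1r mulfV // subr_eq0.
  by apply: contraTneq (fth p) => <-; rewrite normc1 -ltNge.
by rewrite phi1 => /eqP; rewrite oner_eq0.
Qed.

Lemma normc_phi_le f (M : R) : A f -> 0 < M -> (forall p, normc (f p) <= M) ->
  normc (phi f) <= M.
Proof.
move=> Af M0 fM; rewrite leNgt; apply/negP => Mphi.
have phi0 : phi f != 0 by rewrite -normc_gt0 (lt_trans M0).
have nphi : 0 < normc (phi f) by rewrite normc_gt0.
apply: (@phi_neq1 (fun p => (phi f)^-1 * f p) (M / normc (phi f))).
- exact: algebraZ.
- by rewrite ltr_pdivrMr // mul1r.
- by move=> p; rewrite normcM normcV mulrC ler_wpM2r // invr_ge0 ltW.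
by rewrite phiZ // mulVf.
Qed.

Let a : C := phi (@zcoord R S).
Let b : C := phi (@wcoord R S).

Lemma phi_wV : b * phi (fun p => (wcoord p)^-1) = 1.
Proof.
rewrite -phiM; [|exact: algebra_w|exact: algebra_wV].
rewrite -[RHS]phi1; congr phi; apply/funext => p.
by rewrite divff // (fiber_neq0 sysS (coordP p)).
Qed.

Lemma phi_pole k (h : C * R) : h \in S k ->
  (a - h.1) * phi (fun p => (zcoord p - h.1)^-1) = 1.
Proof.
move=> hk; have -> : a - h.1 = phi (fun p => zcoord p + - h.1).
  by rewrite phiD ?phi_cst //; [exact: algebra_z|exact: algebra_cst].
rewrite -phiM; last 2 first.
- by apply: algebraD; [exact: algebra_z|exact: algebra_cst].
- exact: algebra_pole hk.
rewrite -[RHS]phi1; congr phi; apply/funext => p.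
rewrite divff // -normc_gt0 (lt_le_trans (hole_gt0 sysS hk)) //.
exact: hole_le_dist hk.
Qed.

(** If [a] were inside a hole [h], then the value of [phi] at [1 / (z - h.1)], which is
    [1 / (a - h.1)], would exceed the sup bound [1 / h.2]. *)
Lemma phi_z_cheese : cheese S a.
Proof.
move=> k; split=> [|h hk].
  apply: normc_phi_le => //; first exact: algebra_z.
  by move=> p; have [/(cheese_norm sysS)/andP[]] := coordP p.
have h0 := hole_gt0 sysS hk; have ah := phi_pole hk.
have : normc (phi (fun p : X => (zcoord p - h.1)^-1)) <= h.2^-1.
  apply: normc_phi_le; rewrite ?invr_gt0 //; first exact: algebra_pole hk.
  move=> p; have hp := hole_le_dist p hk.
  by rewrite normcV lef_pV2 ?posrE // (lt_le_trans h0).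
have nah : normc (a - h.1) * normc (phi (fun p : X => (zcoord p - h.1)^-1)) = 1.
  by rewrite -normcM ah normc1.
move=> le; have : 1 <= normc (a - h.1) * h.2^-1.
  by rewrite -nah ler_wpM2l ?normc_ge0.
by rewrite ler_pdivlMr // mul1r.
Qed.

(* [1 / (u - 1)] for [u = (z / r)^N], expanded in partial fractions: large only
   near its poles, almost [-1] inside the circle of radius [r], almost [0] outside. *)
Definition circle_kernel (r : R) N (w : C) p : C :=
  root_avg N w (fun t => r%:C * t / (zcoord p - r%:C * t)).

Section Killing.
Variables (k0 l : nat) (r0 r1 r : R) (n : nat) (w : C) (kappa : R).
Hypotheses (l0 : (0 < l)%N) (r00 : 0 < r0) (r0r : r0 <= r) (rr1 : r <= r1) (r12 : r1 <= 2).
Hypotheses (n0 : (0 < n)%N) (pw : (l * n).-primitive_root w) (kap0 : 0 < kappa).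
Hypothesis grow : 2 * (1 + 2 / kappa) <= (1 + l%:R^-1) ^+ n.
Hypothesis poles : pole_circle (S k0) r w kappa.

Let r_gt0 : 0 < r. Proof. exact: lt_le_trans r0r. Qed.
Let rC : r%:C != 0 :> C. Proof. by rewrite eq_complex /= eqxx andbT gt_eqF. Qed.
Let g := circle_kernel r (l * n) w.
Let u p : C := (zcoord p / r%:C) ^+ (l * n).

Let pole_dist k p : kappa <= normc (zcoord p - r%:C * w ^+ k).
Proof. by have [zP _] := coordP p; have [/(_ _ (zP k0))] := poles k. Qed.

Lemma algebra_circle_kernel : A g.
Proof.
apply: algebraZ => //.
apply: (@algebra_sum R S (l * n)%N
  (fun k p => r%:C * w ^+ k / (zcoord p - r%:C * w ^+ k))) => k.
apply: algebraZ => //; have [_ [h hk hc]] := poles k.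
exact: algebra_pole_in_hole hk hc.
Qed.

Lemma circle_kernelE p : g p * (u p - 1) = 1.
Proof.
rewrite /g /circle_kernel /root_avg -mulrA mulr_suml.
rewrite (eq_bigr (fun k : 'I_(l * n) => \sum_(m < l * n)
    (zcoord p / r%:C) ^+ m * (w ^+ k) ^- m)); last first.
  move=> k _; have pk := pole_dist k p.
  have zk : zcoord p - r%:C * w ^+ k != 0 by rewrite -normc_gt0 (lt_le_trans kap0).
  rewrite -(unity_root_kernel (n := l * n)).
  - rewrite /u; congr (_ * _).
    have -> : zcoord p / r%:C - w ^+ k = (zcoord p - r%:C * w ^+ k) / r%:C.
      by rewrite mulrBl [_ * w ^+ k]mulrC mulfK.
    by field; rewrite rC zk.
  - by rewrite -exprM mulnC exprM (prim_expr_order pw) expr1n.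
  - apply: contra_neq zk => <-.
    by rewrite mulrC mulfVK // subrr.
  - exact: prim_root_neq0 pw.
rewrite exchange_big mulr_sumr /=.
have ln0 := prim_order_gt0 pw.
rewrite (eq_bigr (fun m : 'I_(l * n) => (zcoord p / r%:C) ^+ m * (m == 0 :> nat)%:R)).
  rewrite (bigD1 (Ordinal ln0)) //= mulr1 expr0 big1 ?addr0 // => m.
  by rewrite -val_eqE /= => /negbTE ->; rewrite mulr0.
move=> m _; rewrite -mulr_sumr mulrCA; congr (_ * _).
rewrite -/(root_avg (l * n) w (fun t => t ^- m)) (root_avgXV pw).
have [->|m0] := eqVneq (m : nat) 0%N; first by rewrite dvdn0.
by rewrite gtnNdvd // lt0n.
Qed.

Lemma normc_circle_kernel p : normc (g p) <= 2 / kappa.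
Proof.
apply: (le_normc_root_avg_roots pw) => k; have pk := pole_dist k p.
rewrite normc_div normcM (normc_prim_root _ pw) mulr1 normc_real gtr0_norm //.
have r2 : r <= 2 by exact: le_trans r12.
rewrite ler_pM ?invr_ge0 ?normc_ge0 ?(ltW r_gt0) //.
by rewrite lef_pV2 ?posrE // (lt_le_trans kap0).
Qed.

Lemma phi_circle_kernel : phi g * ((a / r%:C) ^+ (l * n) - 1) = 1.
Proof.
have Ag := algebra_circle_kernel.
have Az : A (fun p => r%:C^-1 * zcoord p) by apply: algebraZ => //; exact: algebra_z.
have Au : A (fun p => (r%:C^-1 * zcoord p) ^+ (l * n)) by exact: algebraX.
have -> : (a / r%:C) ^+ (l * n) - 1 =
    phi (fun p => (r%:C^-1 * zcoord p) ^+ (l * n) + -1).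
  rewrite phiD ?phi_cst ?phiX ?phiZ //; last exact: algebra_cst.
    by rewrite mulrC.
  exact: algebra_z.
rewrite -phiM //; last by apply: algebraD => //; exact: algebra_cst.
rewrite -[RHS]phi1; congr phi; apply/funext => p.
by rewrite -[RHS](circle_kernelE p) [r%:C^-1 * _]mulrC.
Qed.

Let ua : C := (a / r%:C) ^+ (l * n).

Let phig : phi g = (ua - 1)^-1.
Proof.
have h := phi_circle_kernel; have nz : ua - 1 != 0.
  by apply: contra_eq_neq h => ->; rewrite mulr0 eq_sym oner_eq0.
by apply: (mulIf nz); rewrite h mulVf.
Qed.

Let gE p : normc (g p) = (normc (u p - 1))^-1.
Proof.
have h := circle_kernelE p; have nz : u p - 1 != 0.
  by apply: contra_eq_neq h => ->; rewrite mulr0 eq_sym oner_eq0.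
by rewrite -normcV; congr normc; apply: (mulIf nz); rewrite h mulVf.
Qed.

(** [1 + g = u / (u - 1)] is divided by its value at [phi], whose inverse is at most [2] in modulus
    as [|ua| >= 1]. On [|z| <= s] one has [|u| <= 1/2], so [|1 + g| <= 2 |u|]; hence [4 = 2 * 2]. *)
Lemma kill_inside_circle (s : R) : r <= normc a -> 0 <= s -> s < r0 ->
  (s / r0) ^+ l <= 2^-1 ->
  exists h, [/\ A h, phi h = 1, forall p, normc (h p) <= (1 + l%:R^-1) ^+ n &
    forall p, normc (zcoord p) <= s -> normc (h p) <= 4 * ((s / r0) ^+ l) ^+ n].
Proof.
move=> ra s0 sr0 half; have Ag := algebra_circle_kernel.
have A1g : A (fun p => 1 + g p) by apply: algebraD => //; exact: algebra_cst.
have ua1 : 1 <= normc ua.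
  by rewrite /ua normcX normc_rescale // exprn_ege1 // ler_pdivlMr // mul1r.
have nz : ua - 1 != 0.
  have h := phi_circle_kernel.
  by apply: contra_eq_neq h => ->; rewrite mulr0 eq_sym oner_eq0.
have phi1g : phi (fun p => 1 + g p) = ua / (ua - 1).
  by rewrite phiD ?phi1 ?phig //; [field | exact: algebra_cst].
have pos : 0 < normc (ua / (ua - 1)).
  by rewrite normc_gt0 mulf_neq0 ?invr_eq0 // -normc_gt0 (lt_le_trans ltr01).
have inv2 : (normc (ua / (ua - 1)))^-1 <= 2.
  rewrite normc_div invfM invrK mulrC ler_pdivrMr ?(lt_le_trans ltr01) //.
  by have := le_normcB ua 1; rewrite normc1; lra.
have hle p (B : R) : normc (1 + g p) <= B ->
    normc ((ua / (ua - 1))^-1 * (1 + g p)) <= 2 * B.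
  by move=> hB; rewrite normcM normcV ler_pM ?invr_ge0 ?normc_ge0.
exists (fun p => (ua / (ua - 1))^-1 * (1 + g p)); split.
- exact: algebraZ.
- by rewrite phiZ // phi1g mulVf // -normc_gt0.
- move=> p; apply: le_trans grow; apply: hle.
  by rewrite (le_trans (le_normcD _ _)) // normc1 lerD2l normc_circle_kernel.
move=> p zs; have -> : 4 * ((s / r0) ^+ l) ^+ n = 2 * (2 * ((s / r0) ^+ l) ^+ n) :> R.
  by ring.
apply: hle; have sr : 0 <= s / r0 by rewrite divr_ge0 // ltW.
have ule : normc (u p) <= ((s / r0) ^+ l) ^+ n.
  rewrite /u normcX normc_rescale // exprM.
  have zr : 0 <= normc (zcoord p) / r by rewrite divr_ge0 ?normc_ge0 ?(ltW r_gt0).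
  apply: le_expr; rewrite ?exprn_ge0 //; apply: le_expr => //.
  by rewrite ler_pM ?normc_ge0 ?invr_ge0 ?(ltW r_gt0) // lef_pV2 ?posrE.
have half' : ((s / r0) ^+ l) ^+ n <= 2^-1.
  apply: le_trans (half); apply: ler_iXnr => //; first exact: exprn_ge0.
  by lra.
have u1 : 2^-1 <= normc (u p - 1).
  by have := le_normc_dist 1 (u p); rewrite normc1 normcBC; lra.
have u10 : 0 < normc (u p - 1) by apply: lt_le_trans u1; rewrite invr_gt0.
have -> : 1 + g p = u p * g p.
  by have h := circle_kernelE p; rewrite -h; ring.
rewrite normcM gE mulrC ler_pM ?invr_ge0 ?normc_ge0 //.
by rewrite -[2]invrK lef_pV2 ?posrE ?invr_gt0.
Qed.

(** Here [g = 1 / (u - 1)] itself is normalized, and [|ua - 1| <= 2] as [|ua| <= 1]. On [|z| >= s]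
    one has [|u| >= 2], so [|g| <= 2 / |u|]. *)
Lemma kill_outside_circle (s : R) : normc a <= r -> r1 < s -> (r1 / s) ^+ l <= 2^-1 ->
  exists h, [/\ A h, phi h = 1, forall p, normc (h p) <= (1 + l%:R^-1) ^+ n &
    forall p, s <= normc (zcoord p) -> normc (h p) <= 4 * ((r1 / s) ^+ l) ^+ n].
Proof.
move=> ar r1s half; have Ag := algebra_circle_kernel.
have r10 : 0 < r1 by exact: lt_le_trans rr1.
have s0 : 0 < s by exact: lt_trans r1s.
have ua1 : normc ua <= 1.
  rewrite /ua normcX normc_rescale // exprn_ile1 ?divr_ge0 ?normc_ge0 ?(ltW r_gt0) //.
  by rewrite ler_pdivrMr // mul1r.
have nz : ua - 1 != 0.
  have h := phi_circle_kernel.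
  by apply: contra_eq_neq h => ->; rewrite mulr0 eq_sym oner_eq0.
have inv2 : normc (ua - 1) <= 2 by have := le_normcB ua 1; rewrite normc1; lra.
have hle p (B : R) : normc (g p) <= B -> normc ((ua - 1) * g p) <= 2 * B.
  by move=> hB; rewrite normcM ler_pM ?normc_ge0.
exists (fun p => (ua - 1) * g p); split.
- exact: algebraZ.
- by rewrite phiZ // phig mulfV.
- move=> p; apply: le_trans grow; apply: hle.
  by rewrite (le_trans (normc_circle_kernel p)) // lerDr.
move=> p zs; have -> : 4 * ((r1 / s) ^+ l) ^+ n = 2 * (2 * ((r1 / s) ^+ l) ^+ n) :> R.
  by ring.
apply: hle; have sr : 0 < r1 / s by rewrite divr_gt0.
have half' : ((r1 / s) ^+ l) ^+ n <= 2^-1.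
  apply: le_trans (half); apply: ler_iXnr => //; first exact/exprn_ge0/ltW.
  by lra.
have q0 : 0 < ((r1 / s) ^+ l) ^+ n by rewrite !exprn_gt0.
have ule : (((r1 / s) ^+ l) ^+ n)^-1 <= normc (u p).
  rewrite /u normcX normc_rescale // -!exprVn exprM invf_div.
  have sr1 : 0 <= s / r1 by rewrite divr_ge0 ?(ltW s0) ?(ltW r10).
  apply: le_expr; rewrite ?exprn_ge0 //; apply: le_expr => //.
  by rewrite ler_pM ?(ltW s0) ?invr_ge0 ?(ltW r10) // lef_pV2 ?posrE.
have u2 : 2 <= (((r1 / s) ^+ l) ^+ n)^-1.
  by rewrite -[2]invrK lef_pV2 ?posrE ?invr_gt0.
have u1 : normc (u p) - 1 <= normc (u p - 1).
  by have := le_normc_dist (u p) 1; rewrite normc1.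
have u10 : 0 < normc (u p - 1) by lra.
have e : 2 * ((r1 / s) ^+ l) ^+ n = ((((r1 / s) ^+ l) ^+ n)^-1 / 2)^-1.
  by rewrite invfM !invrK mulrC.
rewrite gE e lef_pV2 ?posrE //; first by lra.
by rewrite divr_gt0 // invr_gt0.
Qed.

End Killing.

Lemma small_ratio_exponent (rho eps tau : R) : 0 <= rho < 1 -> 0 < eps -> 0 < tau ->
  exists2 l, (0 < l)%N & [/\ l%:R^-1 <= eps, rho ^+ l <= 2^-1 & 4 * rho ^+ l <= tau].
Proof.
move=> /andP[rho0 rho1] eps0 tau0.
have [||m hm] := @small_pow R rho (Num.min 2^-1 (tau / 4)).
- by rewrite rho0.
- by rewrite lt_min invr_gt0 divr_gt0 // ltr0n.
pose m' := Num.bound eps^-1.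
have hm' : eps^-1 < m'%:R by apply: archi_boundP; rewrite invr_ge0 ltW.
move: hm; rewrite le_min => /andP[h1 h2].
have dec : rho ^+ (m + m').+1 <= rho ^+ m.
  by rewrite -addnS exprD ler_piMr ?exprn_ge0 // exprn_ile1 // ltW.
exists (m + m').+1 => //; split.
- rewrite -[eps]invrK lef_pV2 ?posrE ?ltr0n ?invr_gt0 //.
  by rewrite (le_trans (ltW hm')) // ler_nat -addnS addnC addSn leqW // leq_addr.
- exact: le_trans h1.
by apply: le_trans (ler_wpM2l _ dec) _ => //; lra.
Qed.

(** The relevant size is the [n]-th root of [|h|]. The exponent is existential because it comes from
    the construction of the holes. *)
Definition envelope (eps tau : R) (P : X -> Prop) := exists n h,
  [/\ (0 < n)%N, A h, phi h = 1, forall p, normc (h p) <= (1 + eps) ^+ n &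
    forall p, P p -> normc (h p) <= tau ^+ n].

Lemma envelope_trivial eps tau (P : X -> Prop) : 0 < eps -> (forall p, ~ P p) ->
  envelope eps tau P.
Proof.
move=> eps0 nP; exists 1%N, (fun=> 1); split=> //.
- exact: algebra_cst.
- exact: phi1.
- by move=> p; rewrite normc1 expr1 lerDl ltW.
by move=> p /nP.
Qed.

Lemma le_envelope (l n : nat) (rho eps tau : R) (P : X -> Prop) h :
  (0 < l)%N -> 0 <= rho -> l%:R^-1 <= eps -> 4 * rho ^+ l <= tau -> (0 < n)%N ->
  [/\ A h, phi h = 1, forall p, normc (h p) <= (1 + l%:R^-1) ^+ n &
    forall p, P p -> normc (h p) <= 4 * (rho ^+ l) ^+ n] ->
  envelope eps tau P.
Proof.
move=> l0 rho0 leps ltau n0 [h1 h2 h3 h4]; exists n, h; split=> // p.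
  apply: le_trans (h3 p) _; apply: le_expr; last by rewrite lerD2l.
  by rewrite addr_ge0 // invr_ge0.
move=> /h4 hp; apply: (le_trans hp); have r4 : 0 <= 4 * rho ^+ l.
  by rewrite mulr_ge0 ?exprn_ge0.
apply: (@le_trans _ _ ((4 * rho ^+ l) ^+ n)); last first.
  exact: le_expr.
rewrite exprMn ler_wpM2r ?exprn_ge0 //.
by rewrite -[X in X <= _]expr1 ler_weXn2l // ler1n.
Qed.

Lemma envelope_inside (d eps tau : R) : 0 < d -> 0 < eps -> 0 < tau ->
  envelope eps tau (fun p => normc (zcoord p) <= normc a - d).
Proof.
move=> d0 eps0 tau0; have /andP[a1 a2] := cheese_norm sysS phi_z_cheese.
have [small|big] := ltP (normc a - d) 2^-1.
  apply: envelope_trivial => // p hp.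
  have [/(cheese_norm sysS)/andP[p1 _] _] := coordP p; lra.
(* The poles are placed at a radius between [|a| - d / 2] and [|a| - d / 4]: below [|a|], and above
   [s] by a ratio fixed before [l]. *)
pose r0 := normc a - d / 2; pose s := normc a - d.
have s0 : 0 < s by rewrite (lt_le_trans _ big) // invr_gt0.
have sr0 : s < r0 by rewrite /s /r0; lra.
have r00 : 0 < r0 by exact: lt_trans sr0.
have rho1 : 0 <= s / r0 < 1.
  by rewrite divr_ge0 ?(ltW s0) ?(ltW r00) //= ltr_pdivrMr // mul1r.
have [l l0 [h1 h2 h3]] := small_ratio_exponent rho1 eps0 tau0.
have [_ _ _ kl] := sysS.
have [||||j [r [n [w [kappa [/andP[r0r rr1] n0 pw [k0 grow] poles]]]]]] :=
  kl r0 (normc a - d / 4) l => //.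
- by apply: le_trans big _; rewrite /r0; lra.
- by rewrite /r0; lra.
- lra.
have [||h hh] := kill_inside_circle r00 r0r rr1 _ n0 pw k0 grow poles _ (ltW s0) sr0 h2.
- lra.
- lra.
apply: (le_envelope l0 _ h1 h3 n0 hh).
by rewrite divr_ge0 ?(ltW s0) ?(ltW r00).
Qed.

Lemma envelope_outside (d eps tau : R) : 0 < d -> 0 < eps -> 0 < tau ->
  envelope eps tau (fun p => normc a + d <= normc (zcoord p)).
Proof.
move=> d0 eps0 tau0; have /andP[a1 a2] := cheese_norm sysS phi_z_cheese.
have [big|small] := ltP 2 (normc a + d).
  apply: envelope_trivial => // p hp.
  have [/(cheese_norm sysS)/andP[_ p1] _] := coordP p; lra.
pose r0 := normc a + d / 4; pose r1 := normc a + d / 2; pose s := normc a + d.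
have a0 := normc_ge0 a.
have r00 : 0 < r0 by rewrite /r0; lra.
have r10 : 0 < r1 by rewrite /r1; lra.
have s0 : 0 < s by rewrite /s; lra.
have r1s : r1 < s by rewrite /s /r1; lra.
have rho1 : 0 <= r1 / s < 1.
  by rewrite divr_ge0 ?(ltW s0) ?(ltW r10) //= ltr_pdivrMr // mul1r.
have [l l0 [h1 h2 h3]] := small_ratio_exponent rho1 eps0 tau0.
have [_ _ _ kl] := sysS.
have [||||j [r [n [w [kappa [/andP[r0r rr1] n0 pw [k0 grow] poles]]]]]] := kl r0 r1 l => //.
- by rewrite /r0; lra.
- by rewrite /r0 /r1; lra.
- by rewrite /r1; lra.
have [||h hh] := kill_outside_circle r00 r0r rr1 _ n0 pw k0 grow poles _ r1s h2.
- by rewrite /r1; lra.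
- by apply: le_trans r0r; rewrite /r0; lra.
apply: (le_envelope l0 _ h1 h3 n0 hh).
by rewrite divr_ge0 ?(ltW s0) ?(ltW r10).
Qed.

(* In other words, the Jensen measures of [phi] live on the circle [|z| = |a|]. *)
Lemma phi_neq1_circle v (d th : R) : A v -> 0 < d -> th < 1 ->
  (forall p, `|normc (zcoord p) - normc a| < d -> normc (v p) <= th) -> phi v <> 1.
Proof.
move=> Av d0 th1 hth v1.
have [B B0 vB] := algebra_bounded sysS Av.
pose th' := Num.max th 2^-1.
have th'1 : th' < 1 by rewrite gt_max th1; lra.
have th'0 : 0 < th' by rewrite lt_max invr_gt0 orbC; apply/orP; left.
(* With [th' = 1 - 6 eps], the product [(1 + eps)^2 th'] is less than [1]. *)
pose eps := (1 - th') / 6.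
have eps0 : 0 < eps by rewrite divr_gt0 ?subr_gt0.
have eps1 : eps < 1 by rewrite /eps; lra.
(* Then [tau * B <= th']: off the ring, the smallness of one envelope outweighs the size of [v]. *)
pose tau := th' / (2 * (B + 1)).
have tau0 : 0 < tau by rewrite divr_gt0 // mulr_gt0 // addr_gt0.
have [n1 [h1 [n10 Ah1 ph1 e1 k1]]] := envelope_inside d0 eps0 tau0.
have [n2 [h2 [n20 Ah2 ph2 e2 k2]]] := envelope_outside d0 eps0 tau0.
pose n := (n1 * n2)%N.
(* Bounds by [n1]-th and [n2]-th powers become bounds by powers with the common exponent
   [n1 * n2]. *)
pose H p := h1 p ^+ n2 * h2 p ^+ n1 * v p ^+ n.
have A1 : A (fun p => h1 p ^+ n2) by exact: algebraX.
have A2 : A (fun p => h2 p ^+ n1) by exact: algebraX.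
have A3 : A (fun p => v p ^+ n) by exact: algebraX.
have A12 : A (fun p => h1 p ^+ n2 * h2 p ^+ n1) by exact: algebraM.
apply: (@phi_neq1 H (((1 + eps) * (1 + eps) * th') ^+ n)).
- exact: algebraM.
- rewrite exprn_ilt1 ?muln_eq0 ?negb_or -?lt0n ?n10 ?n20 //.
    by rewrite !mulr_ge0 ?addr_ge0 ?(ltW eps0) ?(ltW th'0).
  by rewrite /eps; nra.
- move=> p; have bd (x1 x2 x3 : R) : normc (h1 p) <= x1 ^+ n1 ->
      normc (h2 p) <= x2 ^+ n2 -> normc (v p) <= x3 ->
      0 <= x1 -> 0 <= x2 -> 0 <= x3 -> x1 * x2 * x3 <= (1 + eps) * (1 + eps) * th' ->
      normc (H p) <= ((1 + eps) * (1 + eps) * th') ^+ n.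
    move=> b1 b2 b3 x10 x20 x30 le.
    apply: (@le_trans _ _ ((x1 * x2 * x3) ^+ n)); last first.
      by apply: le_expr => //; rewrite !mulr_ge0.
    rewrite /H !normcM !normcX !exprMn /n.
    apply: ler_pM; rewrite ?mulr_ge0 ?exprn_ge0 ?normc_ge0 //; last first.
      by apply: le_expr; rewrite ?normc_ge0.
    apply: ler_pM; rewrite ?exprn_ge0 ?normc_ge0 //.
      by rewrite exprM; apply: le_expr; rewrite ?normc_ge0.
    by rewrite mulnC exprM; apply: le_expr; rewrite ?normc_ge0.
  have eps10 : 0 <= 1 + eps by lra.
  have tauB : (1 + eps) * tau * B <= (1 + eps) * (1 + eps) * th'.
    have tB : tau * B <= th'.
      rewrite /tau mulrAC ler_pdivrMr ?mulr_gt0 ?addr_gt0 //.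
      by rewrite ler_wpM2l ?(ltW th'0) //; lra.
    apply: (@le_trans _ _ ((1 + eps) * th')); first by rewrite -mulrA ler_wpM2l.
    by rewrite ler_wpM2r ?(ltW th'0) // ler_peMl //; lra.
  have [inn|inn] := leP (normc (zcoord p)) (normc a - d).
    apply: (bd tau (1 + eps) B) => //; [exact: k1|exact: ltW|exact: ltW|].
    by rewrite [tau * _]mulrC.
  have [out|out] := leP (normc a + d) (normc (zcoord p)).
    by apply: (bd (1 + eps) tau B) => //; [exact: k2|exact: ltW|exact: ltW].
  apply: (bd (1 + eps) (1 + eps) th') => //; last exact: ltW.
  rewrite (le_trans (hth p _)) ?le_max ?lexx // ltr_norml; lra.
by rewrite !phiM // !phiX // ph1 ph2 v1 !expr1n !mulr1.
Qed.

Let b0 : b != 0.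
Proof.
have h := phi_wV; apply: contra_eq_neq h => ->.
by rewrite mul0r eq_sym oner_eq0.
Qed.

Lemma sqr_dist_le (d : R) p : `|normc (zcoord p) - normc a| < d ->
  `|normc (zcoord p) ^+ 2 - normc a ^+ 2| <= 4 * d.
Proof.
have /andP[_ a2] := cheese_norm sysS phi_z_cheese.
have [/(cheese_norm sysS)/andP[_ p2] _] := coordP p.
move=> hd; rewrite subr_sqr normrM mulrC ler_pM // ?(ltW hd) //.
by rewrite ger0_norm ?addr_ge0 ?normc_ge0 //; lra.
Qed.

Lemma phi_sphere : normc a ^+ 2 + normc b ^+ 2 = 5.
Proof.
have nb : 0 < normc b by rewrite normc_gt0.
have nb2 : 0 < normc b ^+ 2 by rewrite exprn_gt0.
have sph p : normc (wcoord p) ^+ 2 = 5 - normc (zcoord p) ^+ 2.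
  by have [_ <-] := coordP p; rewrite addrAC subrr add0r.
have [lt|lt|//] := ltgtP (normc a ^+ 2 + normc b ^+ 2) 5; exfalso.
  (* [4 * d] is half the defect: over the ring [|w|^2 >= m - 4 d], which still exceeds [|b|^2]. *)
  pose m := 5 - normc a ^+ 2; pose d := (m - normc b ^+ 2) / 8.
  have d0 : 0 < d by rewrite divr_gt0 // /m; lra.
  have q0 : 0 < m - 4 * d by rewrite /d /m; lra.
  pose th := Num.sqrt (normc b ^+ 2 / (m - 4 * d)).
  apply: (@phi_neq1_circle (fun p => b * (wcoord p)^-1) d th) => //.
  - by apply: algebraZ => //; exact: algebra_wV.
  - rewrite /th -[ltRHS]sqrtr1 ltr_sqrt // ltr_pdivrMr // mul1r /d /m; lra.
  - move=> p /sqr_dist_le hp; rewrite normc_div.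
    have /andP[w1 _] := fiber_norm sysS (coordP p).
    have w0 : 0 < normc (wcoord p) by exact: lt_le_trans w1.
    rewrite -[leLHS]ger0_norm ?divr_ge0 ?normc_ge0 // -sqrtr_sqr ler_wsqrtr //.
    rewrite expr_div_n ler_wpM2l ?(ltW nb2) // lef_pV2 ?posrE ?exprn_gt0 //.
    by rewrite sph /m; move: hp; rewrite ler_norml; lra.
  by rewrite phiZ ?phi_wV //; exact: algebra_wV.
pose m := 5 - normc a ^+ 2; pose d := (normc b ^+ 2 - m) / 8.
have d0 : 0 < d by rewrite divr_gt0 // /m; lra.
pose th := Num.sqrt ((m + 4 * d) / normc b ^+ 2).
apply: (@phi_neq1_circle (fun p => b^-1 * wcoord p) d th) => //.
- by apply: algebraZ => //; exact: algebra_w.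
- rewrite /th -[ltRHS]sqrtr1 ltr_sqrt // ltr_pdivrMr // mul1r /d /m; lra.
- move=> p /sqr_dist_le hp; rewrite normcM normcV.
  rewrite -[leLHS]ger0_norm ?mulr_ge0 ?invr_ge0 ?normc_ge0 // -sqrtr_sqr ler_wsqrtr //.
  rewrite exprMn exprVn mulrC ler_wpM2r ?invr_ge0 ?(ltW nb2) //.
  by rewrite sph /m; move: hp; rewrite ler_norml; lra.
by rewrite phiZ ?mulVf //; exact: algebra_w.
Qed.

(** [a] and [b] determine [phi] on the generators, and [normc_phi_le] carries the equality over to
    uniform limits. *)
Lemma phi_evaluation : exists p : X, forall f, A f -> phi f = f p.
Proof.
have [p pz pw] : exists2 p : X, zcoord p = a & wcoord p = b.
  by apply: cheese_point; split; [exact: phi_z_cheese|exact: phi_sphere].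
exists p.
have lift P : laurent S P -> phi (laurent_fun P) = P a b.
  elim=> {P} [c||||j h hj|P Q hP IH1 hQ IH2|P Q hP IH1 hQ IH2].
  - exact: phi_cst.
  - by [].
  - by [].
  - by apply: (mulfI b0); rewrite phi_wV divff.
  - have h1 := phi_pole hj; have nz : a - h.1 != 0.
      by apply: contra_eq_neq h1 => ->; rewrite mul0r eq_sym oner_eq0.
    by apply: (mulfI nz); rewrite h1 divff.
  - by rewrite -IH1 -IH2; apply: phiD; exact: algebra_laurent.
  by rewrite -IH1 -IH2; apply: phiM; exact: algebra_laurent.
move=> f Af; apply/eqP; rewrite -subr_eq0 -normc_eq0 eq_le normc_ge0 andbT.
apply/ler_addgt0Pl => e e0; rewrite addr0.
have e20 : 0 < e / 2 by rewrite divr_gt0.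
have [P hP fP] := Af _ e20; have AP := algebra_laurent hP.
have AnP : A (fun q => f q + -1 * laurent_fun P q).
  by apply: algebraD => //; exact: algebraZ.
have h1 : normc (phi f - P a b) <= e / 2.
  rewrite -(lift _ hP) -mulN1r -phiZ // -phiD //; last exact: algebraZ.
  by apply: normc_phi_le => // q; rewrite mulN1r.
have h2 : normc (f p - P a b) <= e / 2 by have := fP p; rewrite /laurent_fun pz pw.
rewrite -(subrKA (P a b)) (le_trans (le_normcD _ _)) // (splitr e) lerD //.
by rewrite normcBC.
Qed.

End Characters.
Theorem corollary8 (R : realType) :
  exists (X : metricType R) (A : set (X -> Cplx R)),
    [/\ compact [set: X],
        uniform_algebra A,
        is_character_space A,
        (forall x : X, peak_point A x)
      & ~ regular_algebra A].
Proof.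
have [S sysS] := @hole_system_exists R.
exists (cheese_space S), (cheese_algebra (S := S)); split.
- exact: cheese_space_compact.
- exact: cheese_uniform_algebra.
- by move=> phi chi; exact: phi_evaluation.
- exact: cheese_peak_point.
- exact: cheese_not_regular.
Qed.
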